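(* Let $\Omega\subset\mathbb R^3$ be a bounded Lipschitz domain and $0<T<\infty$. Let $\varepsilon,\mu,\sigma\in L^\infty(\Omega;\mathbb R^{3\times3})$ be symmetric tensor fields such that, for some constants $\varepsilon_0,\mu_0>0$, $\xi^\top\varepsilon(x)\xi\ge\varepsilon_0|\xi|^2$ and $\xi^\top\mu(x)\xi\ge\mu_0|\xi|^2$ for all $\xi\in\mathbb R^3$ and a.e. $x\in\Omega$, and $\sigma(x)$ is positive semi-definite for a.e. $x\in\Omega$. Let $f\in L^2(0,T;L^2(\Omega)^3)$ and $E_0,B_0\in L^2(\Omega)^3$ with $\operatorname{div}B_0=0$ in $L^2(\Omega)$. Let $(E,B)$ be the weak solution (in the sense defined in the context) of the Maxwell system with these data. Then $E,B\in C([0,T];L^2(\Omega)^3)$ and, for every $t\in[0,T]$, $$\mathcal E(t)+\int_0^t(\sigma E(s),E(s))\,ds=\mathcal E(0)+\int_0^t(f(s),E(s))\,ds,\qquad \mathcal E(t):=\tfrac12\big(\|\sqrt\varepsilon\,E(t)\|_{L^2}^2+\|\sqrt{\mu^{-1}}\,B(t)\|_{L^2}^2\big).$$ In particular, $t\mapsto\|E(t)\|_{L^2}$ and $t\mapsto\|B(t)\|_{L^2}$ are continuous on $[0,T]$.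
   Context: $(\cdot,\cdot)$ is the $L^2$ scalar product on $\Omega$. $H(\operatorname{curl};\Omega)=\{v\in L^2(\Omega)^3:\operatorname{curl}v\in L^2(\Omega)^3\}$; $H_0(\operatorname{curl};\Omega)$ is the subspace with vanishing tangential trace $v\times\nu=0$ on $\partial\Omega$; $H(\operatorname{div}^0;\Omega)=\{v\in L^2(\Omega)^3:\operatorname{div}v=0\}$. For a Banach space $X$, $X^*$ is its dual and $\langle\cdot,\cdot\rangle_X$ the duality pairing between $X^*$ and $X$; $L^2(\Omega)^3$ is embedded in $H_0(\operatorname{curl};\Omega)^*$ and in $H(\operatorname{curl};\Omega)^*$ via $(\cdot,\cdot)$. Weak solution of the Maxwell system with data $f,E_0,B_0$: a pair $(E,B)$ with $E\in H^1(0,T;H_0(\operatorname{curl};\Omega)^* )\cap L^\infty(0,T;L^2(\Omega)^3)$ and $B\in H^1(0,T;H(\operatorname{curl};\Omega)^* )\cap L^\infty(0,T;L^2(\Omega)^3)$ such that for a.e. $t\in(0,T)$ $$\langle\varepsilon\partial_tE,\psi\rangle_{H_0(\operatorname{curl};\Omega)}+(\sigma E,\psi)-(\mu^{-1}B,\operatorname{curl}\psi)=(f,\psi)\quad\forall\psi\in H_0(\operatorname{curl};\Omega),$$ $$\langle\partial_tB,\phi\rangle_{H(\operatorname{curl};\Omega)}+(E,\operatorname{curl}\phi)=0\quad\forall\phi\in H(\operatorname{curl};\Omega),$$ with $E(0)=E_0$, $B(0)=B_0$ (for the time-continuous representatives), and, since $\operatorname{div}B_0=0$, additionally $B\in L^\infty(0,T;H(\operatorname{div}^0;\Omega))$.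 Here $\varepsilon\partial_tE$ is understood as the weak time derivative of $\varepsilon E$ in $L^2(0,T;H_0(\operatorname{curl};\Omega)^* )$. *)

(* Defs.v *)
From HB Require Import structures.
From mathcomp Require Import all_boot all_order all_algebra.
From mathcomp Require Import all_classical all_reals all_analysis.

Set Implicit Arguments.
Unset Strict Implicit.
Unset Printing Implicit Defensive.

Import Order.TTheory GRing.Theory Num.Theory.
Import numFieldNormedType.Exports.

Local Open Scope classical_set_scope.
Local Open Scope ring_scope.

(* Points of space are triples, because the product sigma-algebra and the
   product measure live on R * R * R; values of fields are column vectors. *)
Notation pt R := (R * R * R)%type.
Notation field R := (pt R -> 'cV[R]_3).
Notation tensor R := (pt R -> 'M[R]_3).

Notation leb1 := (@lebesgue_measure _).
Notation leb3 :=
  ((@lebesgue_measure _ \x @lebesgue_measure _) \x @lebesgue_measure _)%E.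

Section Euclidean.
Context {R : realType}.

Definition coords (x : pt R) : 'cV[R]_3 :=
  \col_i nth 0 [:: x.1.1; x.1.2; x.2] i.

Definition basis (j : 'I_3) : pt R :=
  (((j : nat) == 0)%:R, ((j : nat) == 1)%:R, ((j : nat) == 2)%:R).

Definition dot (a b : 'cV[R]_3) : R := (a^T *m b) 0 0.

Definition partial (j : 'I_3) (f : pt R -> R) : pt R -> R :=
  fun x => 'D_(basis j) f x.

Definition psd (A : 'M[R]_3) : Prop := forall xi : 'cV[R]_3, 0 <= dot xi (A *m xi).

(* The positive semi-definite square root; the default value 0 is only taken
   when there is none, i.e. when A is not symmetric positive semi-definite. *)
Definition sqrtmx (A : 'M[R]_3) : 'M[R]_3 :=
  xget 0 [set S : 'M[R]_3 | [/\ S^T = S, psd S & S *m S = A]].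

(* Near each boundary point, in suitable orthonormal coordinates y centred at
   that point, Om is the strict epigraph of a Lipschitz function. *)
Definition lipschitz_boundary (Om : set (pt R)) : Prop :=
  forall p, (closure Om `\` interior Om) p ->
  exists (Q : 'M[R]_3) (g : R * R -> R) (r : R),
    [/\ Q *m Q^T = 1%:M, lipschitz g, 0 < r &
     forall x, ball p r x ->
       let y := Q *m (coords x - coords p) in
       Om x <-> g (y 0 0, y 1 0) < y 2%:R 0].

Definition bounded_lipschitz_domain (Om : set (pt R)) : Prop :=
  [/\ open Om, connected Om, Om !=set0, bounded_set Om & lipschitz_boundary Om].

End Euclidean.

(* A (semi-)normed space of representatives: the space is the quotient of dom
   by the relation nrm (u - v) = 0. *)
Record space (R : realType) := Space {
  vec : lmodType R;
  dom : set vec;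
  nrm : vec -> R }.

Arguments dom {R} s.
Arguments nrm {R} s.

Section Dual.
Context {R : realType}.

(* Functionals are arbitrary functions on the ambient type of which only the
   restriction to dom X matters. *)
Definition dual_nrm (X : space R) (l : vec X -> R^o) : R :=
  sup [set `|l v| | v in [set v | dom X v /\ nrm X v <= 1]].

Definition dual_dom (X : space R) (l : vec X -> R^o) : Prop :=
  (forall (a : R) u v, dom X u -> dom X v -> l (a *: u + v) = a * l u + l v) /\
  (exists C : R, forall u, dom X u -> `|l u| <= C * nrm X u).

Definition dual (X : space R) : space R :=
  @Space R (vec X -> R^o) (@dual_dom X) (@dual_nrm X).

End Dual.

Section FieldsOnDomain.
Context {R : realType}.
Variable Om : set (pt R).
Implicit Types (v w : field R).

Definition in_L2 (f : pt R -> R) : Prop := f \_ Om \in Lfun leb3 2%:E.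

Definition in_Linfty (A : tensor R) : Prop :=
  forall i j, (fun x => A x i j) \_ Om \in Lfun leb3 +oo%E.

Definition ip v w : R := \int[leb3]_(x in Om) dot (v x) (w x).

Definition L2nrm v : R := Num.sqrt (ip v v).

Definition L2 : space R :=
  @Space R (field R) [set v | forall i, in_L2 (fun x => v x i 0)] L2nrm.

Definition test_function (phi : pt R -> R) : Prop :=
  (forall s : seq 'I_3, let f := foldr partial phi s in
     continuous f /\ forall j x, derivable f x (basis j)) /\
  (exists K : set (pt R), [/\ compact K, K `<=` Om & forall x, ~ K x -> phi x = 0]).

Definition test_field (phi : field R) : Prop := forall i, test_function (fun x => phi x i 0).

(* Indices are taken modulo 3 ('I_3 is the cyclic group of order 3). *)
Definition classical_curl (phi : field R) : field R := fun x =>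
  \col_i (partial (i + 1) (fun y => phi y (i + 2%:R) 0) x
          - partial (i + 2%:R) (fun y => phi y (i + 1) 0) x).

Definition grad (phi : pt R -> R) : field R := fun x => \col_i partial i phi x.

Definition weak_curl v w : Prop :=
  dom L2 w /\ forall phi, test_field phi -> ip v (classical_curl phi) = ip w phi.

Definition curl v : field R := xget 0 [set w | weak_curl v w].

Definition Hcurl_nrm v : R := Num.sqrt (ip v v + ip (curl v) (curl v)).

Definition Hcurl : space R :=
  @Space R (field R) [set v | dom L2 v /\ exists w, weak_curl v w] Hcurl_nrm.

Definition weak_partial (j : 'I_3) (f g : pt R -> R) : Prop :=
  in_L2 g /\ forall phi, test_function phi ->
    \int[leb3]_(x in Om) (f x * partial j phi x)
    = - \int[leb3]_(x in Om) (g x * phi x).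

Definition in_H1 v : Prop :=
  dom L2 v /\ forall i j : 'I_3, exists g, weak_partial j (fun x => v x i 0) g.

(* The tangential trace (v x nu)|_{bd Om} as the functional on H^1(Om)^3 given
   by Green's formula
     < v x nu, phi >_{bd Om} = (v, curl phi) - (curl v, phi). *)
Definition tangential_trace v (phi : field R) : R :=
  ip v (curl phi) - ip (curl v) phi.

Definition H0curl : space R :=
  @Space R (field R)
    [set v | dom Hcurl v /\ forall phi, in_H1 phi -> tangential_trace v phi = 0]
    Hcurl_nrm.

Definition Hdiv0 : space R :=
  @Space R (field R)
    [set v | dom L2 v /\ forall phi, test_function phi -> ip v (grad phi) = 0] L2nrm.

(* Embedding of L^2(Om)^3 into the duals of Hcurl and H0curl. *)
Definition embed v : field R -> R^o := fun psi => ip v psi.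

End FieldsOnDomain.

Section Bochner.
Context {R : realType}.
Variables (T : R) (X : space R).
Implicit Types (u d : R -> vec X) (y : vec X).

Record simple := Simple {
  ncells : nat;
  cell : 'I_ncells -> set R;
  cst : 'I_ncells -> vec X;
  cell_measurable : forall i, measurable (cell i);
  cst_dom : forall i, dom X (cst i) }.

Definition simple_fun (s : simple) (t : R) : vec X :=
  \sum_(i < ncells s) \1_(@cell s i) t *: @cst s i.

Definition simple_integral (s : simple) : vec X :=
  \sum_(i < ncells s) fine (leb1 (`]0, T[ `&` @cell s i)) *: @cst s i.

Definition ae_limit (s : nat -> simple) u : Prop :=
  {ae leb1, forall t, t \in `]0, T[ ->
     nrm X (simple_fun (s n) t - u t) @[n --> \oo] --> (0 : R)}.

Definition strongly_measurable u : Prop :=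
  {ae leb1, forall t, t \in `]0, T[ -> dom X (u t)} /\ exists s, ae_limit s u.

(* Elements of Bochner spaces are determined up to null sets, so that the scalar
   function below is Lebesgue measurable but maybe not Borel measurable; its
   integral, a supremum over Borel simple functions, is insensitive to this. *)
Definition bochner_integral u y : Prop :=
  [/\ strongly_measurable u, dom X y &
   exists s : nat -> simple,
   [/\ ae_limit s u,
       (\int[leb1]_(t in `]0%R, T[) (nrm X (simple_fun (s n) t - u t))%:E)%E
         @[n --> \oo] --> 0%E &
       nrm X (simple_integral (s n) - y) @[n --> \oo] --> (0 : R)]].

Definition L2t u : Prop :=
  strongly_measurable u /\
  (\int[leb1]_(t in `]0%R, T[) ((nrm X (u t)) ^+ 2)%:E < +oo)%E.

Definition Linftyt u : Prop :=
  strongly_measurable u /\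
  exists M : R, {ae leb1, forall t, t \in `]0, T[ -> nrm X (u t) <= M}.

Definition time_test (eta : R -> R) : Prop :=
  (forall n t, derivable (derive1n n eta) t 1) /\
  (exists K : set R, [/\ compact K, K `<=` `]0, T[ & forall t, ~ K t -> eta t = 0]).

Definition weak_derivative u d : Prop :=
  [/\ L2t u, L2t d &
   forall eta, time_test eta -> exists y,
     bochner_integral (fun t => derive1 eta t *: u t) y /\
     bochner_integral (fun t => eta t *: d t) (- y)].

Definition H1t u : Prop := exists d, weak_derivative u d.

Definition continuous_in_time u : Prop :=
  (forall t, t \in `[0, T] -> dom X (u t)) /\
  (forall t, t \in `[0, T] ->
     nrm X (u s - u t) @[s --> within `[0, T] (nbhs t)] --> (0 : R)).

Definition continuous_representative u u' : Prop :=
  continuous_in_time u' /\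
  {ae leb1, forall t, t \in `]0, T[ -> nrm X (u' t - u t) = 0}.

Definition initial_value u (u0 : vec X) : Prop :=
  exists u', continuous_representative u u' /\ nrm X (u' 0 - u0) = 0.

End Bochner.

Section Maxwell.
Context {R : realType}.
Variables (Om : set (pt R)) (T : R).

Definition tensor_app (A : tensor R) (v : field R) : field R := fun x => A x *m v x.
Definition inv_tensor (A : tensor R) : tensor R := fun x => invmx (A x).
Definition sqrt_tensor (A : tensor R) : tensor R := fun x => sqrtmx (A x).

Definition symmetric_tensor (A : tensor R) : Prop :=
  {ae leb3, forall x, Om x -> (A x)^T = A x}.

Definition coercive (a : R) (A : tensor R) : Prop :=
  {ae leb3, forall x, Om x ->
     forall xi : 'cV[R]_3, a * dot xi xi <= dot xi (A x *m xi)}.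

(* The functional dE t stands for eps \partial_t E(t), the time derivative of
   eps E in L^2(0, T; (H0curl)^* ). *)
Record weak_solution (eps mu sigma : tensor R) (f : R -> field R)
    (E0 B0 : field R) (E B : R -> field R) : Prop := WeakSolution {
  ws_E_H1 : H1t T (X := dual (H0curl Om)) (fun t => embed Om (E t));
  ws_E_Linfty : Linftyt T (X := L2 Om) E;
  ws_B_H1 : H1t T (X := dual (Hcurl Om)) (fun t => embed Om (B t));
  ws_B_Linfty : Linftyt T (X := L2 Om) B;
  ws_ampere : exists dE,
    weak_derivative T (X := dual (H0curl Om))
      (fun t => embed Om (tensor_app eps (E t))) dE /\
    {ae leb1, forall t, t \in `]0, T[ -> forall psi, dom (H0curl Om) psi ->
       dE t psi + ip Om (tensor_app sigma (E t)) psi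
       - ip Om (tensor_app (inv_tensor mu) (B t)) (curl Om psi) = ip Om (f t) psi};
  ws_faraday : exists dB,
    weak_derivative T (X := dual (Hcurl Om)) (fun t => embed Om (B t)) dB /\
    {ae leb1, forall t, t \in `]0, T[ -> forall phi, dom (Hcurl Om) phi ->
       dB t phi + ip Om (E t) (curl Om phi) = 0};
  ws_E_initial :
    initial_value T (X := dual (H0curl Om)) (fun t => embed Om (E t)) (embed Om E0);
  ws_B_initial :
    initial_value T (X := dual (Hcurl Om)) (fun t => embed Om (B t)) (embed Om B0);
  ws_B_div : Linftyt T (X := Hdiv0 Om) B }.

Definition energy (eps mu : tensor R) (E B : R -> field R) (t : R) : R :=
  2^-1 * (L2nrm Om (tensor_app (sqrt_tensor eps) (E t)) ^+ 2
          + L2nrm Om (tensor_app (sqrt_tensor (inv_tensor mu)) (B t)) ^+ 2).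

End Maxwell.

(* Main.v *)
(* Mollify in time with a kernel supported on one side of 0: it is then an
   admissible test function for every t up to one of the two end points. The
   mollified fields U of E and W of B are smooth in t with values in L^2, and
   Faraday's law says that U lies in H_0(curl) with curl U = - W'. Hence U may be
   inserted in Ampere's law, where the two curl terms combine into
     (eps U', U) + (mu^-1 W', W) = (G, U),
   G being the mollification of f - sigma E. The energy of the difference of two
   mollifications is thus controlled by its value at one time plus L^1 errors,
   so averaging over that time gives uniform convergence, hence continuous
   representatives and, in the limit, the energy identity. A forward kernel
   handles [0, 2T/3], a backward one [T/3, T]. *)
Require Import Defs.
From HB Require Import structures.
From mathcomp Require Import all_boot all_order all_algebra.
From mathcomp Require Import all_classical all_reals all_analysis.
From mathcomp Require Import measurable_realfun ess_sup_inf sesquilinear spectral ring lra.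
From mathcomp Require complex.

Set Implicit Arguments.
Unset Strict Implicit.
Unset Printing Implicit Defensive.

Import Order.TTheory GRing.Theory Num.Theory.
Import numFieldNormedType.Exports.

Local Open Scope classical_set_scope.
Local Open Scope ring_scope.

(** * Square roots of positive semi-definite matrices *)

(** Neither equation can be tested with its own solution: [E] is not known to have a curl, and the
    time derivatives are mere functionals. Frozen at one instant, however, a mollified field is a
    single fixed element, so the weak formulation is only ever applied to one test field and one
    scalar test function of time, and every time integral becomes a scalar one. For the same reason
    integrals of curves are taken weakly, through Riesz representation. The fields are bounded in
    time, so in each quadratic error one factor is bounded by a constant and the other is
    integrated; this is why errors in L^1 suffice. The field equations enter the abstract argument
    only through the relation [balance]. L^2 is a set of functions with a degenerate scalar product:
    limits are unique up to norm zero, a chosen [curl] is meaningful only inside scalar products,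
    and curves may fail to be Borel measurable. Hence the passage to everywhere defined Borel
    representatives, and integral lemmas free of measurability assumptions. *)

Section MatrixSquareRoot.
Import complex.
Variables (R : realType) (n : nat).
Implicit Types (A : 'M[R]_n.+1) (p q : {poly R}).

(** This replaces functional calculus: a polynomial with prescribed values on the spectrum of a
    symmetric matrix [A] gives a function of [A] that is real and symmetric by construction. *)
Lemma interpolation (F : fieldType) (f : F -> F) (s : seq F) :
  exists p : {poly F}, {in s, forall x, p.[x] = f x}.
Proof.
elim: s => [|x s [p hp]]; first by exists 0.
have [xs|xs] := boolP (x \in s).
  by exists p => y; rewrite inE => /orP[/eqP ->|]; exact: hp.
(* [r] vanishes at the old nodes but not at [x], so a multiple of it corrects the value at [x] and
   leaves the others alone. *)
pose r : {poly F} := \prod_(y <- s) ('X - y%:P).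
have rx : r.[x] != 0.
  by rewrite -/(root r x) root_prod_XsubC.
exists (p + ((f x - p.[x]) / r.[x]) *: r) => y; rewrite inE => /orP[/eqP ->|ys].
  by rewrite hornerD hornerZ divfK// addrC subrK.
rewrite hornerD hornerZ (_ : r.[y] = 0) ?mulr0 ?addr0 ?hp//.
by apply/eqP; rewrite -/(root r y) root_prod_XsubC.
Qed.

Lemma horner_mx_sym A p : A^T = A -> (horner_mx A p)^T = horner_mx A p.
Proof.
move=> As; elim/poly_ind: p => [|p c IH]; first by rewrite rmorph0 trmx0.
rewrite rmorphD rmorphM /= horner_mx_C horner_mx_X raddfD /= tr_scalar_mx.
rewrite trmx_mul IH As; congr (_ + _).
exact: (comm_mx_horner p (erefl (A *m A))).
Qed.

(* Polynomials in A vanish as soon as they vanish on the spectrum: this reduces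
   to diagonal matrices over the complex numbers. *)
Lemma sym_psd_spectrum A :
  A^T = A -> (forall xi : 'cV[R]_n.+1, 0 <= (xi^T *m (A *m xi)) 0 0) ->
  exists s : seq R, all (>= 0) s /\
    forall q, {in s, forall x, q.[x] = 0} -> horner_mx A q = 0.
Proof.
move=> As Ap; pose toC := (real_complex_def (Phant R) : {rmorphism R -> complex R}).
pose AC := map_mx toC A.
have AR : AC \is a realmx.
  by apply/mxOverP => i j; rewrite mxE complex_real.
have AS : AC \is symmetricmx.
  apply/is_hermitianmxP; rewrite expr0 scale1r.
  by apply/matrixP => i j; rewrite !mxE -{1}As mxE.
have AH := realsym_hermsym AS AR.
have /orthomx_spectralP AE := symmetric_normalmx AS AR.
have /mxOverP dR := hermitian_spectral_diag_real AH.
set d := spectral_diag AC in AE dR.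
set P := spectralmx AC in AE.
have Pu : P \is a GRing.unit by exact: spectral_unit.
pose r j := Re (d 0 j).
have rE j : d 0 j = toC (r j) by rewrite /r -[LHS]RRe_real.
exists [seq r j | j : 'I_n.+1]; split.
  apply/allP => x /mapP[j _ ->]; rewrite /=.
  have : eigenvalue AC (d 0 j).
    apply/eigenvalueP; exists (row j P).
      have: row j P *m AC = d 0 j *: row j P.
        rewrite AE !mulmxA -!row_mul mulmxV// mul1mx.
        by apply/rowP => k; rewrite !mxE (bigD1 j)//= mxE eqxx mulr1n
          big1 ?addr0// => i ij; rewrite mxE eq_sym (negPf ij) mulr0n mul0r.
      by [].
    apply/negP => /eqP rj0; have := mulmxV Pu; move/(congr1 (row j)).
    rewrite row_mul rj0 mul0mx => /rowP/(_ j); rewrite !mxE eqxx => /eqP.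
    by rewrite eq_sym oner_eq0.
  (* Positivity is known for real vectors only. The eigenvalue is real, hence a root of the real
     characteristic polynomial, and so has a real eigenvector [v]; the quadratic form at [v] is the
     eigenvalue times |v|^2. *)
  rewrite rE eigenvalue_root_char -map_char_poly fmorph_root.
  rewrite -eigenvalue_root_char => /eigenvalueP[v vA v0].
  have := Ap v^T; rewrite trmxK mulmxA vA -scalemxAl mxE.
  have vv : 0 < (v *m v^T) 0 0.
    rewrite lt_neqAle; apply/andP; split; last first.
      by rewrite mxE sumr_ge0// => i _; rewrite mxE -expr2 sqr_ge0.
    apply: contra v0; rewrite eq_sym mxE => /eqP/psumr_eq0P hv.
    apply/eqP/rowP => i; rewrite mxE; apply/eqP.
    rewrite -sqrf_eq0 expr2; apply/eqP.
    have := hv _ i isT; rewrite !mxE; apply => k _.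
    by rewrite mxE -expr2 sqr_ge0.
  by rewrite pmulr_lge0.
move=> q q0; apply: (map_mx_inj (f := toC)).
rewrite map_mx0 (map_horner_mx toC A q) -/AC.
have -> : horner_mx AC (map_poly toC q) =
    invmx P *m horner_mx (diag_mx d) (map_poly toC q) *m P.
  by rewrite -(horner_mx_uconjC _ _ Pu) -AE.
rewrite (horner_mx_diag d).
rewrite (_ : map_mx _ d = 0) ?raddf0 ?mulmx0 ?mul0mx//.
apply/rowP => j; rewrite !mxE rE horner_map q0 ?rmorph0//.
by apply/mapP; exists j; rewrite ?mem_enum.
Qed.

(** With [p] interpolating the square root on the spectrum, [p(A)] squares to [A]. Its positivity
    comes from [q], which interpolates the fourth root: [p(A) = q(A)^T q(A)]. *)
Lemma sqrt_exists A :
  A^T = A -> (forall xi : 'cV[R]_n.+1, 0 <= (xi^T *m (A *m xi)) 0 0) ->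
  exists S : 'M[R]_n.+1, [/\ S^T = S,
    forall xi : 'cV[R]_n.+1, 0 <= (xi^T *m (S *m xi)) 0 0 & S *m S = A].
Proof.
move=> As Ap; have [s [s0 sq]] := sym_psd_spectrum As Ap.
have [p pE] := interpolation Num.sqrt s.
have [q qE] := interpolation (fun x => Num.sqrt (Num.sqrt x)) s.
have AE : horner_mx A ('X - p * p) = 0.
  apply: sq => x xs; rewrite !hornerE pE// -expr2 sqr_sqrtr ?subrr//.
  by move/allP: s0; exact.
have SE : horner_mx A (p - q * q) = 0.
  by apply: sq => x xs; rewrite !hornerE pE// qE// -expr2 sqr_sqrtr ?subrr ?sqrtr_ge0.
exists (horner_mx A p); split; first exact: horner_mx_sym.
  move=> xi; move: SE; rewrite rmorphB rmorphM /= => /eqP; rewrite subr_eq0 => /eqP ->.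
  have := horner_mx_sym q As; set Q := horner_mx A q => QT.
  rewrite -mulmxA mulmxA -{1}QT -trmx_mul mxE sumr_ge0// => i _.
  by rewrite mxE -expr2 sqr_ge0.
move: AE; rewrite rmorphB rmorphM /= horner_mx_X => /eqP; rewrite subr_eq0.
by move=> /eqP/esym.
Qed.

End MatrixSquareRoot.


(** * Integrals of real functions *)

Section NonMeasurableIntegrals.
Import HBSimple HBNNSimple.
Context d (T : measurableType d) (R : realType).
Variable mu : {measure set T -> \bar R}.
Implicit Types (f g : T -> \bar R) (D : set T).
Local Open Scope ereal_scope.

(* No measurability: the integral of a nonnegative function is a supremum over
   simple functions, which can be cut off on a null set. *)
Lemma ge0_ae_le_integral_nonmeas D f g :
  (forall x, D x -> 0 <= f x) -> (forall x, D x -> 0 <= g x) ->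
  {ae mu, forall x, D x -> f x <= g x} ->
  \int[mu]_(x in D) f x <= \int[mu]_(x in D) g x.
Proof.
move=> f0 g0 [N [mN N0 hN]]; rewrite !ge0_integralE//.
apply: ge_ereal_sup => _ [h hf <-].
have mNc : measurable (~` N) by exact: measurableC.
rewrite -integralT_nnsfun.
have -> : \int[mu]_x (h x)%:E = \int[mu]_x ((h x)%:E * (\1_(~` N) x)%:E).
  apply: ge0_ae_eq_integral => //.
  - by apply/measurable_EFinP.
  - by apply: emeasurable_funM; apply/measurable_EFinP.
  - by move=> x _; rewrite lee_fin.
  - by move=> x _; rewrite mule_ge0// lee_fin// indicE.
  exists N; split => // x /= hx; apply: contrapT => Nx; apply: hx => _.
  by rewrite indicE mem_set// mule1.
pose k : {nnsfun T >-> R} := mul_nnsfun h (indic_nnsfun R mNc).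
have kE x : k x = (h x * \1_(~` N) x)%R by [].
have -> : \int[mu]_x ((h x)%:E * (\1_(~` N) x)%:E) = \int[mu]_x (k x)%:E.
  by apply: eq_integral => x _; rewrite -EFinM.
rewrite integralT_nnsfun; apply: ereal_sup_ubound; exists k => // x.
suff : (h x * \1_(~` N) x)%:E <= (g \_ D) x by [].
rewrite patchE; case: ifPn => [/set_mem Dx|/negP Dx]; last first.
  have := hf x; rewrite /= patchE ifF; last by apply/negbTE/negP.
  rewrite lee_fin => h0; rewrite lee_fin.
  have -> : h x = 0%R by apply/eqP; rewrite eq_le h0/=.
  by rewrite mul0r.
rewrite indicE; have [Nx|Nx] := boolP (x \in ~` N); last first.
  by rewrite mulr0 g0.
rewrite mulr1; have := hf x; rewrite /= patchE mem_set// => /le_trans; apply.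
have [//|fg] := pselect (f x <= g x).
by move: Nx => /set_mem []; apply: hN => /=; apply: contra_not fg; exact.
Qed.

Lemma ge0_ae_eq_integral_nonmeas D f g :
  (forall x, D x -> 0 <= f x) -> (forall x, D x -> 0 <= g x) ->
  {ae mu, forall x, D x -> f x = g x} ->
  \int[mu]_(x in D) f x = \int[mu]_(x in D) g x.
Proof.
move=> f0 g0 fg; apply/eqP; rewrite eq_le; apply/andP; split;
  apply: ge0_ae_le_integral_nonmeas => //; apply: filterS fg => x h Dx;
  by rewrite h.
Qed.

(** Curves such as [f] and [E] are given up to null sets and need not be Borel in time, so replacing
    them under an integral must not presuppose measurability. *)
Lemma ae_eq_integral_nonmeas D f g :
  {ae mu, forall x, D x -> f x = g x} ->
  \int[mu]_(x in D) f x = \int[mu]_(x in D) g x.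
Proof.
move=> fg; rewrite [LHS]integralE [RHS]integralE.
congr (_ - _); apply: ge0_ae_eq_integral_nonmeas => //;
  apply: filterS fg => x h Dx; by rewrite ?funeposE ?funenegE h.
Qed.

Lemma ae_eq_Rintegral_nonmeas D (f g : T -> R) :
  {ae mu, forall x, D x -> f x = g x} ->
  (\int[mu]_(x in D) f x = \int[mu]_(x in D) g x)%R.
Proof.
move=> fg; rewrite /Rintegral; congr fine; apply: ae_eq_integral_nonmeas.
by apply: filterS fg => x h Dx; rewrite h.
Qed.

End NonMeasurableIntegrals.

Section RealIntegrals.
Context d (T : measurableType d) (R : realType).
Variable mu : {measure set T -> \bar R}.
Implicit Types (f g : T -> R).

Lemma ae_imp (P Q : T -> Prop) : {ae mu, forall x, P x} ->
  (forall x, P x -> Q x) -> {ae mu, forall x, Q x}.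
Proof. by move=> + PQ; apply: filterS. Qed.

Lemma ae_imp2 (P1 P2 Q : T -> Prop) : {ae mu, forall x, P1 x} ->
  {ae mu, forall x, P2 x} -> (forall x, P1 x -> P2 x -> Q x) ->
  {ae mu, forall x, Q x}.
Proof. by move=> + + PQ; apply: filterS2. Qed.

Definition ig f := mu.-integrable setT (EFin \o f).

Lemma ig_meas f : ig f -> measurable_fun setT f.
Proof. by move=> /integrableP[/measurable_EFinP]. Qed.

Lemma ig_le g f : measurable_fun setT f -> ig g -> (forall x, `|f x| <= g x) -> ig f.
Proof.
move=> mf ig_g fg; apply: (le_integrable _ _ _ ig_g) => //; first exact/measurable_EFinP.
by move=> x _; rewrite lee_fin (le_trans (fg x))// ler_norm.
Qed.

Lemma ge0_ig f : measurable_fun setT f -> (forall x, 0 <= f x) ->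
  (\int[mu]_x (f x)%:E < +oo)%E -> ig f.
Proof.
move=> mf f0 foo; apply/integrableP; split; first exact/measurable_EFinP.
apply: le_lt_trans foo; rewrite le_eqVlt; apply/orP; left; apply/eqP.
by apply: eq_integral => x _; rewrite /= ger0_norm.
Qed.

Lemma ig0 : ig (fun=> 0). Proof. exact: integrable0. Qed.
Lemma igD f g : ig f -> ig g -> ig (fun x => f x + g x).
Proof.
move=> hf hg; have := integrableD measurableT hf hg.
by apply: eq_integrable => // x _; rewrite /= EFinD.
Qed.
Lemma igZ k f : ig f -> ig (fun x => k * f x).
Proof.
move=> hf; have := integrableZl measurableT k hf.
by apply: eq_integrable => // x _; rewrite /= EFinM.
Qed.
Lemma igN f : ig f -> ig (fun x => - f x).
Proof.
move=> hf; have := integrableN hf.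
by apply: eq_integrable => // x _; rewrite /= EFinN.
Qed.
Lemma igB f g : ig f -> ig g -> ig (fun x => f x - g x).
Proof. by move=> hf hg; apply: igD => //; exact: igN. Qed.
Lemma ig_norm f : ig f -> ig (fun x => `|f x|).
Proof. exact: integrable_norm. Qed.

Lemma RintD f g : ig f -> ig g ->
  \int[mu]_x (f x + g x) = \int[mu]_x f x + \int[mu]_x g x.
Proof. by move=> hf hg; rewrite RintegralD. Qed.
Lemma RintB f g : ig f -> ig g ->
  \int[mu]_x (f x - g x) = \int[mu]_x f x - \int[mu]_x g x.
Proof. by move=> hf hg; rewrite RintegralB. Qed.
Lemma RintZ k f : ig f -> \int[mu]_x (k * f x) = k * \int[mu]_x f x.
Proof. by move=> hf; rewrite RintegralZl. Qed.
Lemma Rint0 : \int[mu]_x (0 : R) = 0.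
Proof. by rewrite /Rintegral integral0. Qed.

Lemma le_Rint f g : ig f -> ig g -> (forall x, f x <= g x) ->
  \int[mu]_x f x <= \int[mu]_x g x.
Proof. by move=> hf hg fg; apply: le_Rintegral. Qed.

Lemma le_norm_Rint f g : measurable_fun setT f -> ig g ->
  (forall x, `|f x| <= g x) -> `|\int[mu]_x f x| <= \int[mu]_x g x.
Proof.
move=> mf hg fg; have hf := ig_le mf hg fg.
apply: (le_trans (le_normr_Rintegral _ _)) => //.
by apply: le_Rint => //; exact: ig_norm.
Qed.

Lemma EFin_Rint f : ig f -> (\int[mu]_x f x)%:E = (\int[mu]_x (f x)%:E)%E.
Proof. by move=> hf; rewrite fineK//; exact: integrable_fin_num. Qed.

Lemma Rint_dct (fn : nat -> T -> R) f g :
  (forall n, measurable_fun setT (fn n)) -> measurable_fun setT f -> ig g ->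
  (forall n x, `|fn n x| <= g x) ->
  {ae mu, forall x, fn n x @[n --> \oo] --> f x} ->
  \int[mu]_x fn n x @[n --> \oo] --> \int[mu]_x f x.
Proof.
move=> mfn mf hg fg fnf.
have [hf _ h] : [/\ mu.-integrable setT (EFin \o f),
   [sequence (\int[mu]_x `|(EFin \o fn n) x - (EFin \o f) x|)%E]_n @ \oo --> 0%E &
   [sequence (\int[mu]_x (EFin \o fn n) x)%E]_n @ \oo --> (\int[mu]_x (EFin \o f) x)%E].
  apply: (@dominated_convergence _ _ _ mu setT measurableT (fun n => EFin \o fn n)
    (EFin \o f) (EFin \o g)) => //.
  - by move=> n; exact/measurable_EFinP.
  - exact/measurable_EFinP.
  - apply: filterS fnf => x h _; apply: cvg_EFin; [exact: nearW|exact: h].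
  - by apply: aeW => x n _; rewrite /= lee_fin.
apply: fine_cvg; rewrite fineK//; exact: integrable_fin_num.
Qed.

Lemma Rint_ae_eq f g : {ae mu, forall x, f x = g x} ->
  \int[mu]_x f x = \int[mu]_x g x.
Proof.
by move=> fg; apply: ae_eq_Rintegral_nonmeas; apply: filterS fg.
Qed.

End RealIntegrals.

(** * Hilbert spaces of representatives *)

Section RealSequences.
Variable R : realType.
Implicit Types a b : nat -> R.

Lemma cvg0_le a b : (forall n, `|a n| <= b n) -> b n @[n --> \oo] --> (0 : R) ->
  a n @[n --> \oo] --> (0 : R).
Proof.
move=> ab b0; apply/norm_cvg0P.
apply: (@squeeze_cvgr _ _ _ _ (fun=> 0) b) => //; last exact: cvg_cst.
by apply: nearW => n; rewrite normr_ge0 ab.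
Qed.

Lemma cvg_ext b (l' : R) a (l : R) : a n @[n --> \oo] --> l -> (forall n, b n = a n) ->
  l' = l -> b n @[n --> \oo] --> l'.
Proof. by move=> al ba ->; rewrite (_ : b = a)//; exact/funext. Qed.

Lemma cvg_sub0 a (l : R) : a n - l @[n --> \oo] --> (0 : R) -> a n @[n --> \oo] --> l.
Proof. by move=> h; apply/subr_cvg0. Qed.

Lemma cvg_dist_le a b (l : R) : (forall n, `|a n - l| <= b n) ->
  b n @[n --> \oo] --> (0 : R) -> a n @[n --> \oo] --> l.
Proof. by move=> ab b0; apply: cvg_sub0; exact: cvg0_le b0. Qed.

Lemma cvg0P a : a n @[n --> \oo] --> (0 : R) <->
  forall e, 0 < e -> exists N, forall n, (N <= n)%N -> `|a n| < e.
Proof.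
split=> [/cvgrPdist_lt h e e0|h].
  by have [N _ hN] := h e e0; exists N => n Nn; have := hN n Nn; rewrite sub0r normrN.
apply/cvgrPdist_lt => e e0; have [N hN] := h e e0.
by exists N => // n /= Nn; rewrite sub0r normrN; exact: hN.
Qed.

Lemma cvg0_lin a b (c d : R) : a n @[n --> \oo] --> (0 : R) ->
  b n @[n --> \oo] --> (0 : R) -> c * a n + d * b n @[n --> \oo] --> (0 : R).
Proof.
move=> a0 b0; rewrite -[X in _ --> X](_ : c * 0 + d * 0 = 0); last by rewrite !mulr0 addr0.
by apply: cvgD; apply: cvgM => //; exact: cvg_cst.
Qed.

Lemma invS_cvg0 : (n.+1%:R)^-1 @[n --> \oo] --> (0 : R).
Proof. exact: cvg_harmonic. Qed.

End RealSequences.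

(** Models L^2 by functions instead of classes: [p] is constrained only on [D] and may vanish at a
    nonzero vector, so completeness asserts a limit that is unique only up to norm zero. *)
Record semihilbert (R : realType) (V : lmodType R) (D : set V) (p : V -> V -> R)
    : Prop := SemiHilbert {
  sh_D0 : D 0;
  sh_DL : forall (a : R) u v, D u -> D v -> D (a *: u + v);
  sh_C : forall u v, D u -> D v -> p u v = p v u;
  sh_L : forall (a : R) u v w, D u -> D v -> D w ->
    p (a *: u + v) w = a * p u w + p v w;
  sh_ge0 : forall u, D u -> 0 <= p u u;
  sh_complete : forall u : nat -> V, (forall n, D (u n)) ->
    (forall e, 0 < e -> exists N, forall n m, (N <= n)%N -> (N <= m)%N ->
       Num.sqrt (p (u n - u m) (u n - u m)) <= e) ->
    exists v, D v /\
      Num.sqrt (p (u n - v) (u n - v)) @[n --> \oo] --> (0 : R) }.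

Section SemiHilbertTheory.
Variables (R : realType) (V : lmodType R) (D : set V) (p : V -> V -> R).
Hypothesis H : semihilbert D p.
Implicit Types (u v w : V) (a : R).

Definition hnorm u : R := Num.sqrt (p u u).

Let D0 := sh_D0 H.
Lemma shDD u v : D u -> D v -> D (u + v).
Proof. by move=> Du Dv; rewrite -[u]scale1r; exact: (sh_DL H). Qed.
Lemma shDZ a u : D u -> D (a *: u).
Proof. by move=> Du; rewrite -[_ *: _]addr0; exact: (sh_DL H). Qed.
Lemma shDN u : D u -> D (- u).
Proof. by move=> Du; rewrite -scaleN1r; exact: shDZ. Qed.
Lemma shDB u v : D u -> D v -> D (u - v).
Proof. by move=> Du Dv; apply: shDD => //; exact: shDN. Qed.
Hint Resolve shDD shDZ shDN shDB D0 : core.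

Lemma shpDl u v w : D u -> D v -> D w -> p (u + v) w = p u w + p v w.
Proof. by move=> Du Dv Dw; rewrite -{1}[u]scale1r (sh_L H)// mul1r. Qed.
Lemma shp0l w : D w -> p 0 w = 0.
Proof.
move=> Dw; have := shpDl D0 D0 Dw; rewrite addr0 => /eqP.
by rewrite -subr_eq subrr => /eqP <-.
Qed.
Lemma shpZl a u w : D u -> D w -> p (a *: u) w = a * p u w.
Proof. by move=> Du Dw; rewrite -[_ *: _]addr0 (sh_L H)// shp0l// addr0. Qed.
Lemma shpNl u w : D u -> D w -> p (- u) w = - p u w.
Proof. by move=> Du Dw; rewrite -scaleN1r shpZl// mulN1r. Qed.
Lemma shpBl u v w : D u -> D v -> D w -> p (u - v) w = p u w - p v w.
Proof. by move=> Du Dv Dw; rewrite shpDl ?shpNl//; exact: shDN. Qed.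
Lemma shpDr u v w : D u -> D v -> D w -> p w (u + v) = p w u + p w v.
Proof. by move=> Du Dv Dw; rewrite (sh_C H Dw (shDD Du Dv)) shpDl// !(sh_C H Dw). Qed.
Lemma shpZr a u w : D u -> D w -> p w (a *: u) = a * p w u.
Proof. by move=> Du Dw; rewrite (sh_C H Dw (shDZ a Du)) shpZl// (sh_C H Dw). Qed.
Lemma shpNr u w : D u -> D w -> p w (- u) = - p w u.
Proof. by move=> Du Dw; rewrite -scaleN1r shpZr// mulN1r. Qed.
Lemma shpBr u v w : D u -> D v -> D w -> p w (u - v) = p w u - p w v.
Proof. by move=> Du Dv Dw; rewrite shpDr ?shpNr//; exact: shDN. Qed.
Lemma hnorm_ge0 u : 0 <= hnorm u. Proof. exact: sqrtr_ge0. Qed.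
Lemma hnorm_sqr u : D u -> hnorm u ^+ 2 = p u u.
Proof. by move=> Du; rewrite sqr_sqrtr// (sh_ge0 H). Qed.
Lemma hnorm0 : hnorm 0 = 0.
Proof. by rewrite /hnorm shp0l// sqrtr0. Qed.

Lemma sh_CS_sqr u v : D u -> D v -> p u v ^+ 2 <= p u u * p v v.
Proof.
move=> Du Dv; have uu := sh_ge0 H Du; have vv := sh_ge0 H Dv.
have key a b : 0 <= a ^+ 2 * p u u + 2 * a * b * p u v + b ^+ 2 * p v v.
  have := sh_ge0 H (shDD (shDZ a Du) (shDZ b Dv)).
  rewrite shpDl ?shpDr ?shpZl ?shpZr//; try by [exact: shDZ|apply: shDD; exact: shDZ].
  by rewrite (sh_C H (u:=v) (v:=u))//; congr (_ <= _); ring.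
(* The form may be degenerate. If [p v v = 0], the nonnegative expression [key] is affine in its
   second coefficient, which can be chosen to make it [-1] unless [p u v = 0]. *)
have [v0|v0] := eqVneq (p v v) 0.
  have [->|uv] := eqVneq (p u v) 0; first by rewrite expr0n/= mulr_ge0.
  have := key 1 (- (p u u + 1) / (2 * p u v)); rewrite v0 mulr0 addr0.
  have -> : 1 ^+ 2 * p u u + 2 * 1 * (- (p u u + 1) / (2 * p u v)) * p u v = -1.
    by field.
  by rewrite ler0N1.
have := key (p v v) (- p u v).
have -> : p v v ^+ 2 * p u u + 2 * p v v * - p u v * p u v + (- p u v) ^+ 2 * p v v
  = p v v * (p u u * p v v - p u v ^+ 2) by ring.
by rewrite pmulr_rge0 ?subr_ge0// lt_neqAle eq_sym v0.
Qed.

Lemma sh_CS u v : D u -> D v -> `|p u v| <= hnorm u * hnorm v.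
Proof.
move=> Du Dv; rewrite -sqrtrM ?(sh_ge0 H)// -sqrtr_sqr ler_wsqrtr//.
exact: sh_CS_sqr.
Qed.

Lemma hnormZ a u : D u -> hnorm (a *: u) = `|a| * hnorm u.
Proof.
move=> Du; rewrite /hnorm shpZl ?shpZr//; last exact: shDZ.
by rewrite mulrA -expr2 sqrtrM ?sqr_ge0// sqrtr_sqr.
Qed.

Lemma hnormN u : D u -> hnorm (- u) = hnorm u.
Proof. by move=> Du; rewrite -scaleN1r hnormZ// normrN1 mul1r. Qed.

Lemma hnormD u v : D u -> D v -> hnorm (u + v) <= hnorm u + hnorm v.
Proof.
move=> Du Dv; rewrite -(ler_pXn2r (n := 2))//; last first.
- by rewrite nnegrE addr_ge0 ?hnorm_ge0.
- by rewrite nnegrE hnorm_ge0.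
rewrite sqrrD !hnorm_sqr//; last exact: shDD.
rewrite shpDl ?shpDr//; last exact: shDD.
rewrite (sh_C H (u:=v) (v:=u))//; have := sh_CS Du Dv; have := ler_norm (p u v); lra.
Qed.

Lemma hnormB u v : D u -> D v -> hnorm (u - v) <= hnorm u + hnorm v.
Proof. by move=> Du Dv; rewrite -(hnormN Dv); apply: hnormD => //; exact: shDN. Qed.

Lemma hnormBC u v : D u -> D v -> hnorm (u - v) = hnorm (v - u).
Proof. by move=> Du Dv; rewrite -opprB hnormN//; exact: shDB. Qed.

Lemma hnorm_tri w u v : D u -> D v -> D w ->
  hnorm (u - v) <= hnorm (u - w) + hnorm (w - v).
Proof.
move=> Du Dv Dw; rewrite (_ : u - v = (u - w) + (w - v)).
  by apply: hnormD; exact: shDB.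
by rewrite addrA subrK.
Qed.

Lemma hnorm_dist u v : D u -> D v -> `|hnorm u - hnorm v| <= hnorm (u - v).
Proof.
move=> Du Dv; rewrite ler_norml; apply/andP; split.
  rewrite lerBrDl lerBlDr -[in X in X <= _](subrK u v) (hnormBC Du Dv) addrC.
  by apply: hnormD => //; exact: shDB.
rewrite lerBlDr -[in X in X <= _](subrK v u).
by apply: hnormD => //; exact: shDB.
Qed.

Lemma hnorm_eq0_p u v : D u -> D v -> hnorm u = 0 -> p u v = 0.
Proof.
move=> Du Dv u0; have := sh_CS Du Dv; rewrite u0 mul0r normr_le0.
by move/eqP.
Qed.

(** Taking [c = u] suffices. This is how Riesz representers, known only through their pairings, are
    estimated. *)
Lemma hnorm_le_dual u C : D u -> 0 <= C ->
  (forall c, D c -> p u c <= C * hnorm c) -> hnorm u <= C.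
Proof.
move=> Du C0 h; have [u0|u0] := eqVneq (hnorm u) 0; first by rewrite u0.
have := h u Du; rewrite -hnorm_sqr// expr2 ler_pM2r// lt_neqAle eq_sym u0.
exact: hnorm_ge0.
Qed.

Lemma sh_cvg_p (s : nat -> V) u w : (forall n, D (s n)) -> D u -> D w ->
  hnorm (s n - u) @[n --> \oo] --> (0 : R) -> p (s n) w @[n --> \oo] --> p u w.
Proof.
move=> Ds Du Dw h; apply: (@cvg_dist_le _ _ (fun n => hnorm w * hnorm (s n - u))).
  by move=> n; rewrite -shpBl// mulrC; apply: sh_CS => //; exact: shDB.
have := cvg0_lin (hnorm w) 0 h h.
by under eq_fun do rewrite mul0r addr0.
Qed.

Lemma sh_cvg_pp (s r : nat -> V) u w : (forall n, D (s n)) -> (forall n, D (r n)) ->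
  D u -> D w -> hnorm (s n - u) @[n --> \oo] --> (0 : R) ->
  hnorm (r n - w) @[n --> \oo] --> (0 : R) ->
  p (s n) (r n) @[n --> \oo] --> p u w.
Proof.
move=> Ds Dr Du Dw hs hr.
have h n : p (s n) (r n) = p (s n - u) (r n - w) + p (s n) w + (p (r n) u - p w u).
  rewrite !shpBl ?shpBr//; try exact: shDB.
  by rewrite (sh_C H (u:=(r n)) (v:=u))// (sh_C H (u:=w) (v:=u))//; ring.
apply: (@cvg_ext _ _ _ _ (0 + p u w + (p w u - p w u))); last 2 first.
- exact: h.
- by rewrite subrr addr0 add0r.
apply: cvgD; [apply: cvgD|apply: cvgB]; last exact: cvg_cst.
- apply: (@cvg0_le _ _ (fun n => hnorm (s n - u) * hnorm (r n - w))).
    by move=> n; apply: sh_CS; exact: shDB.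
  by rewrite -[X in _ --> X](mulr0 0); exact: cvgM.
- exact: sh_cvg_p.
- exact: sh_cvg_p.
Qed.

Lemma sh_lim_uniq (s : nat -> V) u w : (forall n, D (s n)) -> D u -> D w ->
  hnorm (s n - u) @[n --> \oo] --> (0 : R) ->
  hnorm (s n - w) @[n --> \oo] --> (0 : R) -> hnorm (u - w) = 0.
Proof.
move=> Ds Du Dw hu hw; apply/eqP; rewrite eq_le hnorm_ge0 andbT.
apply/ler_addgt0Pr => e e0; rewrite add0r.
have [N hN] := (cvg0P _).1 (cvg0_lin 1 1 hu hw) e e0.
have := hN N (leqnn _); rewrite !mul1r ger0_norm ?addr_ge0 ?hnorm_ge0// => h.
apply/ltW; apply: le_lt_trans h.
by rewrite (hnormBC (Ds N) Du); exact: hnorm_tri.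
Qed.

(* Riesz: the minimising sequence of |v|^2 - 2 l v is Cauchy by the
   parallelogram law. *)
Lemma sh_riesz (l : V -> R) (C : R) :
  (forall a u v, D u -> D v -> l (a *: u + v) = a * l u + l v) ->
  (forall u, D u -> `|l u| <= C * hnorm u) ->
  exists y, D y /\ forall c, D c -> p y c = l c.
Proof.
move=> lL lC.
have lD u v : D u -> D v -> l (u + v) = l u + l v.
  by move=> Du Dv; rewrite -{1}[u]scale1r lL// mul1r.
have l0 : l 0 = 0.
  by have /eqP := lD _ _ D0 D0; rewrite addr0 -subr_eq subrr => /eqP <-.
have lZ a u : D u -> l (a *: u) = a * l u.
  by move=> Du; rewrite -[_ *: _]addr0 lL// l0 addr0.
pose J v := p v v - 2 * l v.
pose S : set R := [set J v | v in D].
have S0 : S !=set0 by exists (J 0); exists 0.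
have Slb : has_lbound S.
  (* [J v] is at least |v|^2 - 2 C |v| = (|v| - C)^2 - C^2. *)
  exists (- C ^+ 2) => _ [v Dv <-]; rewrite /J -hnorm_sqr//.
  have := lC v Dv; have := ler_norm (l v); have := sqr_ge0 (hnorm v - C); lra.
have mJ v : D v -> inf S <= J v by move=> Dv; apply: ge_inf => //; exists v.
have JC n : exists v, D v /\ J v < inf S + (n.+1%:R)^-1.
  have n0 : 0 < (n.+1%:R)^-1 :> R by rewrite invr_gt0.
  have [_ [v Dv <-] hv] := inf_adherent n0 (conj S0 Slb).
  by exists v.
have {JC}[v vP] := choice JC.
have Dv n : D (v n) by case: (vP n).
have [|y [Dy vy]] := sh_complete H Dv.
  move=> e e0.
  (* Comparing [J] at [v n], [v m] and their midpoint gives |v n - v m|^2 <= 2/(n+1) + 2/(m+1),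
     whence the threshold [e ^+ 2 / 4]. *)
  have [N hN] := (cvg0P _).1 (@invS_cvg0 R) (e ^+ 2 / 4) (ltac:(by rewrite divr_gt0 ?exprn_gt0)).
  exists N => n m Nn Nm; rewrite -/(hnorm _) -(ler_pXn2r (n := 2))// ?nnegrE ?hnorm_ge0 ?(ltW e0)//.
  rewrite hnorm_sqr; last exact: shDB.
  have hn := hN n Nn; have hm := hN m Nm.
  rewrite gtr0_norm ?invr_gt0// in hn; rewrite gtr0_norm ?invr_gt0// in hm.
  have Dh : D (2^-1 *: (v n + v m)) by apply: shDZ; exact: shDD.
  have := mJ _ Dh; have [_] := vP n; have [_] := vP m; rewrite /J lZ ?lD//; last exact: shDD.
  rewrite shpZl ?shpZr//; try by [exact: shDD|apply: shDZ; exact: shDD].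
  rewrite shpBl ?shpBr ?shpDl ?shpDr//; try by [exact: shDB|exact: shDD].
  rewrite (sh_C H (u:=(v m)) (v:=(v n)))//; move: hn hm.
  set x := (n.+1%:R)^-1; set z := (m.+1%:R)^-1; lra.
exists y; split=> // c Dc.
(* This is the limit in [n] of the almost minimality of [v n], compared with [v n + t *: c]. *)
have key t : 0 <= 2 * t * (p y c - l c) + t ^+ 2 * p c c.
  have hn n : - (n.+1%:R)^-1 <= 2 * t * (p (v n) c - l c) + t ^+ 2 * p c c.
    have Dt : D (v n + t *: c) by apply: shDD => //; exact: shDZ.
    have := mJ _ Dt; have [_] := vP n; rewrite /J lD ?lZ//; last exact: shDZ.
    rewrite shpDl ?shpDr ?shpZl ?shpZr//; try by [exact: shDZ|apply: shDD => //; exact: shDZ].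
    rewrite (sh_C H (u:=c) (v:=(v n)))//; set x := (n.+1%:R)^-1; lra.
  have h1 : - (n.+1%:R)^-1 @[n --> \oo] --> (0 : R).
    by rewrite -[X in _ --> X]oppr0; apply: cvgN; exact: invS_cvg0.
  have h2 : 2 * t * (p (v n) c - l c) + t ^+ 2 * p c c @[n --> \oo] -->
      2 * t * (p y c - l c) + t ^+ 2 * p c c.
    apply: cvgD; last exact: cvg_cst.
    apply: cvgM; first exact: cvg_cst.
    by apply: cvgB; [exact: sh_cvg_p|exact: cvg_cst].
  by apply: (ler_cvg_to h1 h2); apply: nearW.
set x := p y c - l c in key; apply/eqP; rewrite -subr_eq0 -/x.
have cc := sh_ge0 H Dc; apply/eqP.
(* A step against the sign of the first variation [x]; the [+ 1] keeps it defined when [p c c = 0].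
   The value is then minus [x ^+ 2] times a positive factor, which forces [x = 0]. *)
have h := key (- x / (p c c + 1)).
have c1 : p c c + 1 != 0 by rewrite gt_eqF// ltr_wpDl.
have E : 2 * (- x / (p c c + 1)) * x + (- x / (p c c + 1)) ^+ 2 * p c c =
   - (x ^+ 2 * ((p c c + 2) / (p c c + 1) ^+ 2)) by field.
rewrite E oppr_ge0 pmulr_lle0 in h; last first.
  by rewrite divr_gt0 ?exprn_gt0// ltr_wpDl.
by apply/eqP; rewrite -sqrf_eq0 eq_le h sqr_ge0.
Qed.

End SemiHilbertTheory.


(** * Strong measurability and weak integrals of curves *)

Section GoodFunctions.
Variables (R : realType) (V : lmodType R) (D : set V) (p : V -> V -> R).
Hypothesis H : semihilbert D p.
Local Notation hnorm := (hnorm p).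
Local Notation leb := (@lebesgue_measure R).

(* Strong measurability, as an inductive closure: everywhere defined limits of
   combinations of indicators. *)
Inductive good : (R -> V) -> Prop :=
| good_cst A c : measurable A -> D c -> good (fun t => \1_A t *: c)
| good_add u v : good u -> good v -> good (fun t => u t + v t)
| good_lim (s : nat -> R -> V) u : (forall n, good (s n)) -> (forall t, D (u t)) ->
    (forall t, hnorm (s n t - u t) @[n --> \oo] --> (0 : R)) -> good u.

Lemma good_D u : good u -> forall t, D (u t).
Proof.
elim=> [A c mA Dc t|{}u v _ Du _ Dv t|//]; first exact: (shDZ H).
exact: (shDD H).
Qed.

(** Induction on the construction of [u] while [w] stays merely weakly measurable. The asymmetry
    serves mollified curves, for which continuity of the scalar pairings is what is at hand. *)
Lemma good_pmeas w u : (forall t, D (w t)) ->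
  (forall c, D c -> measurable_fun setT (fun t => p (w t) c)) -> good u ->
  measurable_fun setT (fun t => p (w t) (u t)).
Proof.
move=> Dw mw; elim=> [A c mA Dc|{}u v gu mu gv mv|s {}u gs ms Du su].
- rewrite (_ : (fun t => _) = (fun t => \1_A t * p (w t) c)).
    by apply: measurable_funM; [exact: measurable_indic|exact: mw].
  by apply/funext => t; rewrite (shpZr H).
- rewrite (_ : (fun t => _) = (fun t => p (w t) (u t) + p (w t) (v t))).
    exact: measurable_funD.
  by apply/funext => t; rewrite (shpDr H)//; exact: good_D.
- apply: (@measurable_fun_cvg _ _ _ _ (fun n t => p (w t) (s n t))) => // t _.
  have Ds n : D (s n t) by exact: good_D.
  apply: (@cvg_ext _ _ _ (fun n => p (s n t) (w t)) (p (u t) (w t))).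
  - exact: (sh_cvg_p H).
  - by move=> n; rewrite (sh_C H).
  - by rewrite (sh_C H).
Qed.

Lemma good_meas u c : good u -> D c -> measurable_fun setT (fun t => p (u t) c).
Proof.
move=> gu Dc.
rewrite (_ : (fun t => _) = (fun t => p c (u t))).
  by apply: (@good_pmeas (fun=> c)) => // d Dd; exact: measurable_cst.
by apply/funext => t; rewrite (sh_C H)//; exact: good_D.
Qed.

Lemma good_meas2 u v : good u -> good v -> measurable_fun setT (fun t => p (u t) (v t)).
Proof.
by move=> gu gv; apply: good_pmeas => //; [exact: good_D|move=> c Dc; exact: good_meas].
Qed.

(** Expanding the square leaves [p w w], [p w u] and [p u u], each measurable by hypothesis or by
    the lemmas on good functions. *)
Lemma weak_meas_hnorm w u : (forall t, D (w t)) ->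
  (forall c, D c -> measurable_fun setT (fun t => p (w t) c)) ->
  measurable_fun setT (fun t => p (w t) (w t)) -> good u ->
  measurable_fun setT (fun t => hnorm (w t - u t)).
Proof.
move=> Dw mw mww gu; have Du := good_D gu.
rewrite (_ : (fun t => _) = Num.sqrt \o (fun t => p (w t - u t) (w t - u t)))//.
apply: measurableT_comp.
  by apply: continuous_measurable_fun; exact: sqrt_continuous.
rewrite (_ : (fun t => _) = (fun t => p (w t) (w t) - 2 * p (w t) (u t) + p (u t) (u t))).
  apply: measurable_funD; last exact: good_meas2.
  apply: measurable_funB => //; apply: measurable_funM; first exact: measurable_cst.
  exact: good_pmeas.
apply/funext => t; rewrite (shpBl H) ?(shpBr H)//; try exact: (shDB H).
by rewrite (sh_C H (u := u t) (v := w t))//; ring.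
Qed.

Lemma good_scale k u : good u -> good (fun t => k *: u t).
Proof.
elim=> [A c mA Dc|{}u v _ gu _ gv|s {}u gs gks Du su].
- rewrite (_ : (fun t => _) = (fun t => \1_A t *: (k *: c))).
    by apply: good_cst => //; exact: (shDZ H).
  by apply/funext => t; rewrite !scalerA mulrC.
- rewrite (_ : (fun t => _) = (fun t => k *: u t + k *: v t)); first exact: good_add.
  by apply/funext => t; rewrite scalerDr.
- apply: (good_lim gks) => t; first exact: (shDZ H).
  have Ds n : D (s n t) by exact: good_D.
  apply: (@cvg0_le _ _ (fun n => `|k| * hnorm (s n t - u t))).
    by move=> n; rewrite -scalerBr (hnormZ H) ?normrM ?normr_id ?[`|hnorm _|]ger0_norm ?hnorm_ge0//;
      exact: (shDB H).
  have := cvg0_lin `|k| 0 (su t) (su t).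
  by under eq_fun do rewrite mul0r addr0.
Qed.

Lemma good_sub u v : good u -> good v -> good (fun t => u t - v t).
Proof.
move=> gu gv; rewrite (_ : (fun t => _) = (fun t => u t + (-1) *: v t)).
  by apply: good_add => //; exact: good_scale.
by apply/funext => t; rewrite scaleN1r.
Qed.

Lemma good_hnorm_cst u c : good u -> D c -> measurable_fun setT (fun t => hnorm (u t - c)).
Proof.
move=> gu Dc; have gc : good (fun=> c).
  rewrite (_ : (fun=> c) = (fun t => \1_[set: R] t *: c)); first exact: good_cst.
  by apply/funext => t; rewrite indicE mem_set// scale1r.
apply: weak_meas_hnorm => //; [exact: good_D| |exact: good_meas2].
by move=> d Dd; exact: good_meas.
Qed.

Lemma good_hnorm u : good u -> measurable_fun setT (fun t => hnorm (u t)).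
Proof.
move=> gu; rewrite (_ : (fun t => _) = (fun t => hnorm (u t - 0))).
  by apply: good_hnorm_cst => //; exact: (sh_D0 H).
by apply/funext => t; rewrite subr0.
Qed.

Lemma good_op (A : V -> V) C : (forall u, D u -> D (A u)) -> linear A ->
  (forall u, D u -> hnorm (A u) <= C * hnorm u) ->
  forall u, good u -> good (fun t => A (u t)).
Proof.
move=> DA lA AC u.
have A0 : A 0 = 0.
  have := lA 1 0 0; rewrite scaler0 addr0 scale1r => /eqP.
  by rewrite -subr_eq subrr => /eqP <-.
have AZ a c : A (a *: c) = a *: A c by rewrite -[a *: c]addr0 lA A0 addr0.
have AD b c : A (b + c) = A b + A c by rewrite -{1}[b]scale1r lA scale1r.
have AB b c : A (b - c) = A b - A c by rewrite AD -scaleN1r AZ scaleN1r.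
elim=> [B c mB Dc|{}u v _ gu _ gv|s {}u gs gks Du su].
- rewrite (_ : (fun t => _) = (fun t => \1_B t *: A c)).
    by apply: good_cst => //; exact: DA.
  by apply/funext => t; rewrite AZ.
- rewrite (_ : (fun t => _) = (fun t => A (u t) + A (v t))); first exact: good_add.
  by apply/funext => t; rewrite AD.
- apply: (good_lim gks) => t; first exact: DA.
  have Ds n : D (s n t) by exact: good_D.
  apply: (@cvg0_le _ _ (fun n => C * hnorm (s n t - u t))).
    by move=> n; rewrite -AB ger0_norm ?hnorm_ge0// AC//; exact: (shDB H).
  have := cvg0_lin C 0 (su t) (su t).
  by under eq_fun do rewrite mul0r addr0.
Qed.

Let pairing (T : Type) (x0 : T) (f : nat -> nat -> T) (n : nat) : T :=
  if @unpickle (nat * nat)%type n is Some ij then f ij.1 ij.2 else x0.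

Let pairingE T x0 (f : nat -> nat -> T) i j : pairing x0 f (pickle (i, j)) = f i j.
Proof. by rewrite /pairing pickleK. Qed.

Let D0 := sh_D0 H.

(** A good curve has separable range: an indicator function takes two values, and for sums and
    limits countable families indexed by pairs are enumerated through [pickle]. This stands in for
    separability of the whole space in the Lebesgue point argument. *)
Lemma good_sep u : good u -> exists x : nat -> V, (forall n, D (x n)) /\
  forall t e, 0 < e -> exists n, hnorm (u t - x n) < e.
Proof.
elim=> [A c mA Dc|{}u v gu [x [Dx xu]] gv [y [Dy yv]]|s {}u gs xs Du su].
- exists (fun n => if n is 0%N then 0 else c); split=> [[|]//|t e e0].
  rewrite indicE; have [tA|tA] := boolP (t \in A).
    by exists 1%N; rewrite scale1r subrr (hnorm0 H).
  by exists 0%N; rewrite scale0r subrr (hnorm0 H).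
- exists (pairing 0 (fun i j => x i + y j)); split.
    move=> n; rewrite /pairing; case: unpickle => // -[i j] /=.
    exact: (shDD H).
  move=> t e e0; have e2 : 0 < e / 2 by rewrite divr_gt0.
  have [i hi] := xu t _ e2; have [j hj] := yv t _ e2.
  exists (pickle (i, j)); rewrite pairingE opprD addrACA.
  have Dut := good_D gu t; have Dvt := good_D gv t.
  apply: le_lt_trans (hnormD H _ _) _; try exact: (shDB H).
  lra.
- have {xs}[x hx] := choice xs.
  exists (pairing 0 x); split.
    move=> n; rewrite /pairing; case: unpickle => // -[i j] /=.
    by have [+ _] := hx i; apply.
  move=> t e e0; have e2 : 0 < e / 2 by rewrite divr_gt0.
  have [N hN] := (cvg0P _).1 (su t) _ e2; have := hN N (leqnn _).
  rewrite ger0_norm ?hnorm_ge0// => h1.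
  have [Dx /(_ t _ e2)[j hj]] := hx N.
  exists (pickle (N, j)); rewrite pairingE.
  have Dst := good_D (gs N) t.
  apply: le_lt_trans (hnorm_tri H (w := s N t) _ _ _) _ => //.
  rewrite (hnormBC H)//; lra.
Qed.

Definition L1 u := good u /\ ig leb (fun t => hnorm (u t)).

(** The weak (Pettis) integral of [k] times [u]. It is a relation because pairings determine [y]
    only up to norm zero. *)
Definition isint (k : R -> R) (u : R -> V) (y : V) :=
  D y /\ forall c, D c -> p y c = \int[leb]_t (k t * p (u t) c).

Lemma L1_ig u (k : R -> R) (K : R) c : L1 u -> measurable_fun setT k -> (forall t, `|k t| <= K) ->
  D c -> ig leb (fun t => k t * p (u t) c).
Proof.
move=> [gu iu] mk kK Dc.
apply: (@ig_le _ _ _ leb (fun t => K * hnorm c * hnorm (u t))).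
- by apply: measurable_funM => //; exact: good_meas.
- exact: igZ.
move=> t; rewrite normrM -mulrA; apply: ler_pM => //.
by rewrite mulrC; apply: (sh_CS H) => //; exact: good_D.
Qed.

Lemma L1_ig_norm u (k : R -> R) (K : R) : L1 u -> measurable_fun setT k -> (forall t, `|k t| <= K) ->
  ig leb (fun t => k t * hnorm (u t)).
Proof.
move=> [gu iu] mk kK; apply: (@ig_le _ _ _ leb (fun t => K * hnorm (u t))).
- by apply: measurable_funM => //; exact: good_hnorm.
- exact: igZ.
by move=> t; rewrite normrM [X in _ * X]ger0_norm ?hnorm_ge0// ler_wpM2r ?hnorm_ge0.
Qed.

(** The functional [c |-> \int k (u, c)] is bounded by [K] times the L^1 norm of [u], so Riesz
    representation applies. *)
Lemma isint_exists u (k : R -> R) (K : R) : L1 u -> measurable_fun setT k -> (forall t, `|k t| <= K) ->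
  exists y, isint k u y.
Proof.
move=> Lu mk kK; have Du := good_D Lu.1.
have [//|//|y [Dy hy]] := @sh_riesz _ _ _ _ H
  (fun c => \int[leb]_t (k t * p (u t) c)) (K * \int[leb]_t hnorm (u t)); last first.
- by exists y.
- move=> c Dc; rewrite -RintZ; last exact: Lu.2.
  rewrite mulrC -RintZ; last by apply: igZ; exact: Lu.2.
  apply: le_norm_Rint.
  + by apply: measurable_funM => //; apply: good_meas => //; exact: Lu.1.
  + by apply: igZ; apply: igZ; exact: Lu.2.
  move=> t; rewrite normrM mulrCA; apply: ler_pM => //.
  by rewrite mulrC; apply: (sh_CS H).
- move=> a c d Dc Dd.
  rewrite -RintZ; last exact: L1_ig.
  rewrite -RintD; [|exact/igZ/L1_ig|exact: L1_ig].
  apply: eq_Rintegral => t _; rewrite (shpDr H) ?(shpZr H)//; last exact: (shDZ H).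
  by ring.
Qed.

Lemma isint_le u (k : R -> R) (K : R) (y : V) (g : R -> R) : L1 u -> measurable_fun setT k ->
  (forall t, `|k t| <= K) -> isint k u y -> ig leb g ->
  (forall t, `|k t| * hnorm (u t) <= g t) ->
  hnorm y <= \int[leb]_t g t.
Proof.
move=> Lu mk kK [Dy hy] ig_g kg; have Du := good_D Lu.1.
have g0 : 0 <= \int[leb]_t g t.
  by apply: Rintegral_ge0 => t _; apply: le_trans (kg t); rewrite mulr_ge0 ?hnorm_ge0.
apply: (hnorm_le_dual H) => // c Dc; rewrite hy// mulrC -RintZ//.
apply: le_trans (ler_norm _) _; apply: le_norm_Rint.
- by apply: measurable_funM => //; apply: good_meas => //; exact: Lu.1.
- exact: igZ.
move=> t; rewrite normrM; apply: le_trans (ler_wpM2l (hnorm_ge0 p c) (kg t)).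
rewrite mulrCA ler_wpM2l//.
by rewrite mulrC; apply: (sh_CS H).
Qed.

Lemma isint_lin u (k1 k2 : R -> R) (K1 K2 : R) y1 y2 (a : R) : L1 u -> measurable_fun setT k1 ->
  measurable_fun setT k2 -> (forall t, `|k1 t| <= K1) -> (forall t, `|k2 t| <= K2) ->
  isint k1 u y1 -> isint k2 u y2 ->
  isint (fun t => a * k1 t + k2 t) u (a *: y1 + y2).
Proof.
move=> Lu m1 m2 b1 b2 [D1 h1] [D2 h2]; split; first exact: (sh_DL H).
move=> c Dc; rewrite (sh_L H)// h1// h2// -RintZ; last exact: L1_ig.
rewrite -RintD; [|exact/igZ/L1_ig|exact: L1_ig].
by apply: eq_Rintegral => t _; ring.
Qed.

End GoodFunctions.


(** * Smooth bumps and mollification *)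

Section Derivatives.
Variable R : realType.

(** A quadratic bound on the remainder is easily propagated by algebra. It settles in one stroke the
    flat function at the origin, affine maps and quadratic forms along a curve. *)
Lemma is_derive_quad (V : normedModType R) (f : V -> R) (x v : V) (df C : R) :
  (forall h, `|f (h *: v + x) - f x - h * df| <= C * h ^+ 2) -> is_derive x v f df.
Proof.
move=> hC.
have key : (fun h => h^-1 *: (f (h *: v + x) - f x)) @ 0^' --> df.
  apply/cvgrPdist_lt => e e0.
  have C1 : 0 < `|C| + 1 by rewrite ltr_wpDl.
  exists (e / (`|C| + 1)); first by rewrite /= divr_gt0.
  move=> h /=; rewrite sub0r normrN ltr_pdivlMr// => he h0.
  rewrite distrC (_ : _ - df = h^-1 * (f (h *: v + x) - f x - h * df)); last first.
    by rewrite mulrBr mulKf.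
  rewrite normrM normfV ltr_pdivrMl ?normr_gt0//.
  apply: le_lt_trans (hC h) _; rewrite -real_normK ?num_real// expr2 mulrA mulrC.
  rewrite ltr_pM2l ?normr_gt0//; apply: le_lt_trans he; rewrite mulrC.
  by rewrite ler_wpM2l// (le_trans (ler_norm C))// lerDl.
by apply: DeriveDef; [apply/cvg_ex; exists df|apply/cvg_lim].
Qed.

Lemma is_derive1E (f : R -> R) (x df : R) : is_derive x 1 f df -> derive1 f x = df.
Proof. by move=> h; rewrite derive1E derive_val. Qed.

Lemma is_derive_cont (f : R -> R) (x df : R) : is_derive x 1 f df -> {for x, continuous f}.
Proof. by move=> h; apply: differentiable_continuous; apply/derivable1_diffP. Qed.

End Derivatives.

Section FlatFunctions.
Variable R : realType.
Implicit Types (p : {poly R}) (x y : R).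

(** The function [p(1/x) exp(-1/x)], cut to zero on the left; the polynomial factor makes the family
    stable under differentiation. *)
Definition flat p x : R := if 0 < x then p.[x^-1] * expR (- x^-1) else 0.

Lemma flat_le0 p x : x <= 0 -> flat p x = 0.
Proof. by rewrite /flat ltNge => ->. Qed.

(** Each induction step halves the rate: one half controls the polynomial of lower degree, the other
    the extra factor [y], by y <= (2/a) exp(a y / 2). *)
Lemma poly_le_expR p (a : R) : 0 < a ->
  exists C, forall y, 0 <= y -> `|p.[y]| <= C * expR (a * y).
Proof.
elim/poly_ind: p a => [|p c IH] a a0.
  by exists 0 => y _; rewrite horner0 normr0 mul0r.
have a20 : 0 < a / 2 by rewrite divr_gt0.
have [C hC] := IH _ a20.
exists (`|C| * (2 / a) + `|c|) => y y0; rewrite !hornerE.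
apply: (le_trans (ler_normD _ _)); rewrite mulrDl lerD//; last first.
  rewrite ler_peMr//; apply: le_trans (expR_ge1Dx _).
  by rewrite lerDl mulr_ge0// ltW.
have -> : a * y = a / 2 * y + a / 2 * y by field.
rewrite expRD normrM (ger0_norm y0).
have h1 : `|p.[y]| <= `|C| * expR (a / 2 * y).
  by apply: (le_trans (hC y y0)); rewrite ler_wpM2r ?expR_ge0 ?ler_norm.
have h2 : y <= 2 / a * expR (a / 2 * y).
  rewrite -ler_pdivrMl ?divr_gt0// invf_div.
  by apply: le_trans (expR_ge1Dx _); rewrite lerDr.
apply: (le_trans (ler_pM _ _ h1 h2)) => //.
by rewrite le_eqVlt; apply/orP; left; apply/eqP => /=; ring.
Qed.

(** The growth bound is applied to [p * 'X^2], whose extra square at [x^-1] becomes the factor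
    [x ^+ 2]. This gives the vanishing derivative at the origin. *)
Lemma flat_quad p : exists C, forall x, `|flat p x| <= C * x ^+ 2.
Proof.
have [C hC] := poly_le_expR (p * 'X^2) ltr01.
exists `|C| => x; rewrite /flat; case: ifPn => [x0|_]; last first.
  by rewrite normr0 mulr_ge0 ?sqr_ge0.
have := hC x^-1; rewrite invr_ge0 (ltW x0) => /(_ isT).
rewrite hornerM hornerXn mul1r normrM (ger0_norm (sqr_ge0 _)) => h.
rewrite normrM (ger0_norm (expR_ge0 _)).
rewrite -(ler_pM2r (x := x^-1 ^+ 2)) ?exprn_gt0 ?invr_gt0//.
have -> : `|C| * x ^+ 2 * x^-1 ^+ 2 = `|C| by field; rewrite gt_eqF.
have EE : expR (- x^-1) * expR x^-1 = 1 :> R by rewrite -expRD addNr expR0.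
rewrite -(ler_pM2r (expR_gt0 x^-1)).
have -> : `|p.[x^-1]| * expR (- x^-1) * x^-1 ^+ 2 * expR x^-1 =
  `|p.[x^-1]| * x^-1 ^+ 2 * (expR (- x^-1) * expR x^-1) by ring.
rewrite EE mulr1.
by apply: (le_trans h); rewrite ler_wpM2r ?expR_ge0 ?ler_norm.
Qed.

(** With y = 1/x one has dy/dx = -y^2: differentiating [p(y)] contributes [- p' y^2], and [exp(-y)]
    contributes [+ p y^2]. *)
Definition flat_der p : {poly R} := (p - p^`()) * 'X^2.

Lemma is_derive_flat p x : is_derive x 1 (flat p) (flat (flat_der p) x).
Proof.
have [x0|x0|->] := ltgtP x 0.
- rewrite (flat_le0 _ (ltW x0)).
  apply: (@near_eq_is_derive _ _ _ (fun=> 0)).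
  near=> y; rewrite flat_le0//; apply: ltW; near: y; exact: lt_nbhsl.
- pose g y := p.[y^-1] * expR (- y^-1).
  apply: (@near_eq_is_derive _ _ _ g).
    near=> y; rewrite /flat ifT//; near: y; exact: lt_nbhsr.
  have dV : is_derive x 1 (fun y : R => y^-1) (- x ^- 2 *: 1).
    by apply: (@is_deriveV _ id); rewrite ?gt_eqF.
  have dp : is_derive x 1 (horner p \o (fun y => y^-1)) (p^`().[x^-1] * (- x ^- 2 *: 1)).
    exact: is_derive1_comp.
  have dN : is_derive x 1 (fun y : R => - y^-1) (- (- x ^- 2 *: 1)) by exact: is_deriveN.
  have de : is_derive x 1 (expR \o (fun y => - y^-1)) (expR (- x^-1) * (- (- x ^- 2 *: 1))).
    exact: is_derive1_comp.
  apply: (is_derive_eq (is_deriveM dp de)).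
  rewrite /flat x0 /flat_der !hornerE /= /GRing.scale /= -exprVn.
  ring.
have [C hC] := flat_quad p.
rewrite flat_le0//; apply: (@is_derive_quad _ _ _ _ _ _ C) => h.
by rewrite addr0 mulr0 subr0 (flat_le0 p (lexx 0)) subr0 [_ *: _]mulr1.
Unshelve. all: by end_near. Qed.

(** A syntactic class whose derivatives are again in the class: smoothness of all orders follows by
    induction, and affine substitutions are absorbed in the base case. *)
Inductive smooth_expr : (R -> R) -> Prop :=
| smooth_flat p a b : smooth_expr (fun x => flat p (a * x + b))
| smooth_mul f g : smooth_expr f -> smooth_expr g -> smooth_expr (fun x => f x * g x)
| smooth_add f g : smooth_expr f -> smooth_expr g -> smooth_expr (fun x => f x + g x)
| smooth_scale k f : smooth_expr f -> smooth_expr (fun x => k * f x).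

Lemma smooth_expr_der f : smooth_expr f ->
  exists g, smooth_expr g /\ forall x, is_derive x 1 f (g x).
Proof.
elim=> [p a b|{}f g sf [f' [sf' df]] sg [g' [sg' dg]]|
    {}f g sf [f' [sf' df]] sg [g' [sg' dg]]|k {}f sf [f' [sf' df]]].
- exists (fun x => a * flat (flat_der p) (a * x + b)); split.
    by apply: smooth_scale; exact: smooth_flat.
  move=> x; have h : is_derive x 1 (fun x : R => a * x + b) a.
    apply: (@is_derive_quad _ _ _ _ _ _ 0) => h; rewrite [h *: 1]mulr1 mul0r.
    rewrite (_ : _ - h * a = 0) ?normr0//; ring.
  rewrite mulrC.
  exact: (is_derive1_comp (g := fun x => a * x + b) (is_derive_flat p _) h).
- exists (fun x => f x * g' x + g x * f' x); split.
    by apply: (smooth_add (smooth_mul sf sg') (smooth_mul sg sf')).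
  by move=> x; exact: is_deriveM.
- exists (fun x => f' x + g' x); split; first exact: smooth_add.
  by move=> x; exact: is_deriveD.
- exists (fun x => k * f' x); split; first exact: smooth_scale.
  by move=> x; exact: (@is_deriveZ _ _ _ f k).
Qed.

Lemma smooth_expr_derive1 f : smooth_expr f ->
  smooth_expr (derive1 f) /\ forall x, is_derive x 1 f (derive1 f x).
Proof.
move=> /smooth_expr_der[g [sg dg]].
have -> : derive1 f = g by apply/funext => x; exact: is_derive1E.
by [].
Qed.

Lemma smooth_expr_derive1n f n : smooth_expr f -> smooth_expr (derive1n n f).
Proof.
by move=> sf; elim: n => [|n IH] //; rewrite derive1nS; case: (smooth_expr_derive1 IH).
Qed.

Lemma smooth_expr_derivable f n t : smooth_expr f -> derivable (derive1n n f) t 1.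
Proof.
move=> /(smooth_expr_derive1n n)/smooth_expr_derive1[_ /(_ t) h].
exact: ex_derive.
Qed.

Lemma smooth_expr_cont f : smooth_expr f -> continuous f.
Proof. by move=> /smooth_expr_der[g [_ h]] x; exact: is_derive_cont (h x). Qed.

Lemma smooth_expr_comp f a b : smooth_expr f -> smooth_expr (fun x => f (a * x + b)).
Proof.
elim=> [p c d|{}f g _ sf _ sg|{}f g _ sf _ sg|k {}f _ sf].
- rewrite (_ : (fun x => _) = (fun x => flat p ((c * a) * x + (c * b + d)))).
    exact: smooth_flat.
  by apply/funext => x; congr flat; ring.
- exact: smooth_mul.
- exact: smooth_add.
- exact: smooth_scale.
Qed.

(* [bump n] increases to the indicator of (0, 1). *)
Definition bump n x : R := flat 1 (n.+1%:R * x) * flat 1 (n.+1%:R * (1 - x)).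

Lemma smooth_bump n : smooth_expr (bump n).
Proof.
apply: smooth_mul.
  rewrite (_ : (fun x => _) = (fun x => flat 1 (n.+1%:R * x + 0))).
    exact: smooth_flat.
  by apply/funext => x; rewrite addr0.
rewrite (_ : (fun x => _) = (fun x => flat 1 (- n.+1%:R * x + n.+1%:R))).
  exact: smooth_flat.
by apply/funext => x; congr flat; ring.
Qed.

Lemma flat1E x : 0 < x -> flat 1 x = expR (- x^-1).
Proof. by rewrite /flat => ->; rewrite hornerE mul1r. Qed.

Lemma flat1_ge0 x : 0 <= flat 1 x.
Proof. by rewrite /flat; case: ifPn => // x0; rewrite hornerE mul1r expR_ge0. Qed.

Lemma flat1_le1 x : flat 1 x <= 1.
Proof.
rewrite /flat; case: ifPn => // x0; rewrite hornerE mul1r -expR0 ler_expR.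
by rewrite oppr_le0 invr_ge0 ltW.
Qed.

Lemma bump_ge0 n x : 0 <= bump n x.
Proof. by rewrite mulr_ge0 ?flat1_ge0. Qed.

Lemma bump_le1 n x : bump n x <= 1.
Proof. by rewrite -[leRHS]mulr1 ler_pM ?flat1_ge0 ?flat1_le1. Qed.

Lemma bump_out n x : x <= 0 \/ 1 <= x -> bump n x = 0.
Proof.
rewrite /bump => -[x0|x1].
  by rewrite flat_le0 ?mul0r// pmulr_rle0.
by rewrite [X in _ * X]flat_le0 ?mulr0// pmulr_rle0 ?subr_le0.
Qed.

Lemma flat1_cvg x : 0 < x -> flat 1 (n.+1%:R * x) @[n --> \oo] --> (1 : R).
Proof.
move=> x0; apply: (@cvg_ext _ _ _ (fun n => expR (- (x^-1 * n.+1%:R^-1))) (expR 0)).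
- apply: continuous_cvg; first exact: continuous_expR.
  rewrite -[X in _ --> X]oppr0 -[X in _ --> - X](mulr0 x^-1).
  by apply: cvgN; apply: cvgM; [exact: cvg_cst|exact: cvg_harmonic].
- by move=> n; rewrite flat1E ?mulr_gt0// invfM mulrC.
- by rewrite expR0.
Qed.

Lemma bump_cvg x : 0 < x < 1 -> bump n x @[n --> \oo] --> (1 : R).
Proof.
move=> /andP[x0 x1]; rewrite -[X in _ --> X](mulr1 1).
by apply: cvgM; apply: flat1_cvg => //; rewrite subr_gt0.
Qed.

End FlatFunctions.


Section AffineSubstitution.
Variable R : realType.
Local Notation leb := (@lebesgue_measure R).

Lemma lipschitz_continuous (f : R -> R) (C : R) :
  (forall x y, `|f x - f y| <= C * `|x - y|) -> continuous f.
Proof.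
move=> fC x; apply/cvgrPdist_lt => e e0.
have C1 : 0 < `|C| + 1 by rewrite ltr_wpDl.
near=> y; apply: le_lt_trans (fC x y) _.
apply: (@le_lt_trans _ _ ((`|C| + 1) * `|x - y|)).
  by rewrite ler_wpM2r// (le_trans (ler_norm C))// lerDl.
rewrite mulrC -ltr_pdivlMr//; near: y.
by apply: cvgr_dist_lt; rewrite ?divr_gt0.
Unshelve. all: by end_near. Qed.

Lemma is_derive_affine (a b x : R) : is_derive x 1 (fun x => a * x + b) a.
Proof.
apply: (@is_derive_quad _ _ _ _ _ _ 0) => h; rewrite [h *: 1]mulr1 mul0r.
rewrite (_ : _ - h * a = 0) ?normr0//; ring.
Qed.

Lemma integral_affine (G : R -> R) (a b : R) : 0 < a -> continuous G ->
  (forall x, 0 <= G x) ->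
  (\int[leb]_x (a * G (a * x + b))%:E = \int[leb]_x (G x)%:E)%E.
Proof.
move=> a0 cG G0.
have dF : derive1 (fun x => a * x + b) = cst a.
  by apply/funext => x; apply: is_derive1E; exact: is_derive_affine.
rewrite (@increasing_ge0_integration_by_substitutionT _ (fun x => a * x + b) G)//.
- by rewrite dF; apply: eq_integral => x _; rewrite [in RHS]/GRing.mul /= mulrC.
- by move=> x y xy; rewrite ltrD2r ltr_pM2l.
- by rewrite dF => x; exact: cvg_cst.
- by rewrite dF; exact: is_cvg_cst.
- by rewrite dF; exact: is_cvg_cst.
- apply/cvgrNyPle => A; near=> x; rewrite -lerBrDr mulrC -ler_pdivlMr//.
- apply/cvgryPge => A; near=> x; rewrite -lerBlDr mulrC -ler_pdivrMr//.
Unshelve. all: by end_near. Qed.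

Lemma integral_oppr (G : R -> R) : continuous G -> (forall x, 0 <= G x) ->
  (\int[leb]_x (G (- x))%:E = \int[leb]_x (G x)%:E)%E.
Proof.
move=> cG G0.
have mG : measurable_fun setT (EFin \o G).
  by apply/measurable_EFinP; exact: continuous_measurable_fun.
transitivity (\int[pushforward leb (-%R : R -> measurableTypeR R)]_x (G x)%:E)%E.
  rewrite ge0_integral_pushforward//=.
  by move=> x _; rewrite lee_fin.
by apply: eq_measure_integral => A mA _; exact: lebesgue_measureN.
Qed.

End AffineSubstitution.

(** * Mollification of integrable Hilbert-valued curves *)

Section Mollification.
Variables (R : realType) (V : lmodType R) (D : set V) (p : V -> V -> R).
Hypothesis H : semihilbert D p.
Local Notation hnorm := (hnorm p).
Local Notation leb := (@lebesgue_measure R).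
Variables (rho : R -> R) (L M : R).
Hypothesis rho_lip : forall x y, `|rho x - rho y| <= L * `|x - y|.
Hypothesis rho_ge0 : forall x, 0 <= rho x.
Hypothesis rho_le : forall x, rho x <= M.
Hypothesis rho_supp : forall x, 2 <= `|x| -> rho x = 0.
Hypothesis rho_int : (\int[leb]_x (rho x)%:E = 1)%E.

Let rho_cont : continuous rho := lipschitz_continuous rho_lip.

(** [s] is the inverse width and [t] the centre. The kernel depends on [x - t], so a derivative in
    the centre is minus a derivative in the integration variable. *)
Definition ker (s t x : R) : R := s * rho (s * (x - t)).

Lemma ker_meas s t : measurable_fun setT (ker s t).
Proof.
apply: continuous_measurable_fun => x; apply: cvgM; first exact: cvg_cst.
apply: continuous_comp; last exact: rho_cont.
by apply: cvgM; [exact: cvg_cst|apply: cvgB => //; exact: cvg_cst].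
Qed.

Let M0 : 0 <= M := le_trans (rho_ge0 0) (rho_le 0).

Lemma ker_ge0 s t x : 0 < s -> 0 <= ker s t x.
Proof. by move=> s0; apply: mulr_ge0 => //; exact: ltW. Qed.

Lemma kerM_ge0 s t x y : 0 < s -> 0 <= y -> 0 <= ker s t x * y.
Proof. by move=> s0 y0; apply: mulr_ge0 => //; exact: ker_ge0. Qed.

Lemma ker_bd s t x : 0 < s -> `|ker s t x| <= s * M.
Proof. by move=> s0; rewrite ger0_norm ?ker_ge0// ler_pM2l. Qed.

Lemma ker_out s t x : 0 < s -> 2 / s <= `|x - t| -> ker s t x = 0.
Proof.
move=> s0 h; rewrite /ker rho_supp ?mulr0// normrM gtr0_norm// mulrC.
by rewrite -ler_pdivrMr.
Qed.

Lemma ker_int s t : 0 < s -> (\int[leb]_x (ker s t x)%:E = 1)%E.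
Proof.
move=> s0; rewrite -rho_int -(@integral_affine _ rho s (- (s * t)))//.
by apply: eq_integral => x _; rewrite /ker mulrBr.
Qed.

(** Integration over the centre reverses the argument of [rho], which is not assumed even; hence the
    reflection. *)
Lemma ker_int2 s x : 0 < s -> (\int[leb]_t (ker s t x)%:E = 1)%E.
Proof.
move=> s0; rewrite -rho_int -(integral_oppr rho_cont rho_ge0).
have cN : continuous (fun x => rho (- x)).
  by move=> y; apply: continuous_comp; [exact: opp_continuous|exact: rho_cont].
rewrite -(@integral_affine _ (fun x => rho (- x)) s (- (s * x)))//.
by apply: eq_integral => t _; rewrite /ker; congr (_ * rho _)%:E; ring.
Qed.

Lemma ker_ig s t : 0 < s -> ig leb (ker s t).
Proof.
move=> s0; apply: ge0_ig; [exact: ker_meas|by move=> x; exact: ker_ge0|].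
by rewrite ker_int ?ltry.
Qed.

Lemma ker_Rint s t : 0 < s -> \int[leb]_x ker s t x = 1.
Proof. by move=> s0; rewrite /Rintegral ker_int. Qed.

Lemma ker_lip s t t' x : 0 < s -> `|ker s t x - ker s t' x| <= s ^+ 2 * L * `|t - t'|.
Proof.
move=> s0; rewrite -mulrBr normrM gtr0_norm// expr2 -!mulrA ler_pM2l//.
apply: le_trans (rho_lip _ _) _; rewrite -mulrBr normrM gtr0_norm//.
by rewrite (_ : x - t - (x - t') = t' - t) ?[`|t' - t|]distrC ?[L * (s * _)]mulrCA//; ring.
Qed.

Variables (u : R -> V) (Lu : L1 D p u).
Let gu := Lu.1.
Let Du := good_D H gu.
Let g t := hnorm (u t).
Let ig_g : ig leb g := Lu.2.
Let g0 t : 0 <= g t. Proof. exact: hnorm_ge0. Qed.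
Hint Resolve g0 hnorm_ge0 : core.
Let mg : measurable_fun setT g. Proof. exact: ig_meas ig_g. Qed.

Lemma moll_lip s y t y' t' : 0 < s -> isint D p (ker s t) u y ->
  isint D p (ker s t') u y' ->
  hnorm (y - y') <= s ^+ 2 * L * (\int[leb]_x g x) * `|t - t'|.
Proof.
move=> s0 hy hy'.
have hyy : isint D p (fun x => -1 * ker s t' x + ker s t x) u (-1 *: y' + y).
  exact: (isint_lin H (-1) Lu (ker_meas s t') (ker_meas s t)
    (fun x => ker_bd t' x s0) (fun x => ker_bd t x s0) hy' hy).
have kE x : -1 * ker s t' x + ker s t x = ker s t x - ker s t' x.
  by rewrite mulN1r addrC.
rewrite (_ : y - y' = -1 *: y' + y); last by rewrite scaleN1r addrC.
rewrite mulrAC -RintZ//.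
apply: (isint_le H (k := fun x => -1 * ker s t' x + ker s t x)
  (K := s ^+ 2 * L * `|t - t'|) Lu _ _ hyy).
- apply: measurable_funD; last exact: ker_meas.
  by apply: measurable_funM; [exact: measurable_cst|exact: ker_meas].
- by move=> x; rewrite kE; exact: ker_lip.
- exact: igZ.
- by move=> x; rewrite kE; apply: ler_wpM2r; [exact: hnorm_ge0|exact: ker_lip].
Qed.

(** One quantity dominates two errors: that of averaging [u], and that of averaging its norm. *)
Definition moll_bound s t := \int[leb]_x (ker s t x * hnorm (u x - u t)).

Lemma diff_meas c : D c -> measurable_fun setT (fun x => hnorm (u x - c)).
Proof. exact: (good_hnorm_cst H gu). Qed.

Lemma diff_ig s t : 0 < s -> ig leb (fun x => ker s t x * hnorm (u x - u t)).
Proof.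
move=> s0; apply: (@ig_le _ _ _ leb (fun x => s * M * g x + g t * ker s t x)).
- by apply: measurable_funM; [exact: ker_meas|exact: diff_meas].
- by apply: igD; [exact: igZ|apply: igZ; exact: ker_ig].
move=> x; rewrite ger0_norm; last exact: kerM_ge0.
apply: (@le_trans _ _ (ker s t x * (g x + g t))).
  by rewrite ler_wpM2l ?ker_ge0//; exact: (hnormB H).
rewrite mulrDr [g t * _]mulrC lerD2r; apply: ler_wpM2r => //.
by apply: le_trans (ker_bd t x s0); exact: ler_norm.
Qed.

Lemma moll_dist s t y : 0 < s -> isint D p (ker s t) u y ->
  hnorm (y - u t) <= moll_bound s t.
Proof.
move=> s0 [Dy hy]; apply: (hnorm_le_dual H); first exact: (shDB H).
  by apply: Rintegral_ge0 => x _; apply: kerM_ge0.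
move=> c Dc; rewrite (shpBl H)// hy//.
have ig_k : ig leb (fun x => ker s t x * p (u x) c).
  by apply: (L1_ig H Lu _ _ Dc (K := s * M)); [exact: ker_meas|move=> x; exact: ker_bd].
rewrite -[p (u t) c]mulr1 -(ker_Rint t s0) -RintZ; last exact: ker_ig.
rewrite -RintB//; last by apply: igZ; exact: ker_ig.
rewrite mulrC -RintZ; last exact: diff_ig.
apply: le_trans (ler_norm _) _; apply: le_norm_Rint.
- apply: measurable_funB; first exact: ig_meas ig_k.
  by apply: measurable_funM; [exact: measurable_cst|exact: ker_meas].
- by apply: igZ; exact: diff_ig.
move=> x; rewrite mulrC -mulrBl normrM [`|ker _ _ _|]ger0_norm ?ker_ge0//.
rewrite mulrC mulrCA ler_wpM2l ?ker_ge0// -(shpBl H)// mulrC.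
by apply: (sh_CS H) => //; exact: (shDB H).
Qed.

(** The mollified norm is a majorant of the norm of the mollified curve whose total integral is
    exactly that of the norm of [u]. *)
Definition moll_norm s t := \int[leb]_x (ker s t x * g x).

Lemma moll_norm_ig0 s t : 0 < s -> ig leb (fun x => ker s t x * g x).
Proof.
move=> s0; apply: (L1_ig_norm H Lu _ (K := s * M)); first exact: ker_meas.
by move=> x; exact: ker_bd.
Qed.

Lemma moll_norm_dist s t : 0 < s -> `|moll_norm s t - g t| <= moll_bound s t.
Proof.
move=> s0; rewrite -[g t]mulr1 -(ker_Rint t s0) -RintZ; last exact: ker_ig.
rewrite -RintB; [|exact: moll_norm_ig0|by apply: igZ; exact: ker_ig].
apply: le_norm_Rint.
- apply: measurable_funB; first exact: ig_meas (moll_norm_ig0 t s0).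
  by apply: measurable_funM; [exact: measurable_cst|exact: ker_meas].
- exact: diff_ig.
move=> x; rewrite mulrC -mulrBl normrM [`|ker _ _ _|]ger0_norm ?ker_ge0// mulrC.
by rewrite ler_wpM2l ?ker_ge0//; exact: (hnorm_dist H).
Qed.

Let kg_meas2 s : measurable_fun setT (fun z : R * R => (ker s z.1 z.2 * g z.2)%:E).
Proof.
apply/measurable_EFinP; apply: measurable_funM.
  apply: measurable_funM; first exact: measurable_cst.
  apply: (@measurableT_comp _ _ _ _ _ _ rho).
    exact: continuous_measurable_fun.
  apply: measurable_funM; first exact: measurable_cst.
  by apply: measurable_funB; [exact: measurable_snd|exact: measurable_fst].
by apply: (@measurableT_comp _ _ _ _ _ _ g) => //; exact: measurable_snd.
Qed.

(** Tonelli and unit mass of the kernel in its centre. The equality of the integrals is what later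
    makes the uncontrolled part of the L^1 error cancel. *)
Lemma moll_norm_integral s : 0 < s ->
  ig leb (moll_norm s) /\ \int[leb]_t moll_norm s t = \int[leb]_t g t.
Proof.
move=> s0.
have kg0 z : (0 <= (ker s z.1 z.2 * g z.2)%:E)%E by rewrite lee_fin; exact: kerM_ge0.
have E t : (moll_norm s t)%:E = (\int[leb]_x (ker s t x * g x)%:E)%E.
  by rewrite EFin_Rint//; exact: moll_norm_ig0.
have I : (\int[leb]_t (moll_norm s t)%:E = \int[leb]_t (g t)%:E)%E.
  under eq_integral do rewrite E.
  rewrite (@fubini_tonelli _ _ _ _ R leb leb _ (kg_meas2 s) kg0).
  apply: eq_integral => x _ /=.
  under eq_integral do rewrite mulrC EFinM.
  rewrite ge0_integralZl//= ?ker_int2 ?mule1//.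
  - apply/measurable_EFinP; apply: measurable_funM; first exact: measurable_cst.
    apply: (@measurableT_comp _ _ _ _ _ _ rho).
      exact: continuous_measurable_fun.
    apply: measurable_funM; first exact: measurable_cst.
    by apply: measurable_funB => //; exact: measurable_cst.
  - by move=> t _; rewrite lee_fin ker_ge0.
  - by rewrite lee_fin.
have mm : measurable_fun setT (moll_norm s).
  apply/measurable_EFinP; rewrite (_ : EFin \o _ =
    fubini_F leb (fun z : R * R => (ker s z.1 z.2 * g z.2)%:E)).
    exact: (@measurable_fun_fubini_tonelli_F _ _ _ _ R leb _ (kg_meas2 s) kg0).
  by apply/funext => t; rewrite /= E.
split; last by rewrite /Rintegral I.
apply: ge0_ig => //; last by rewrite I -EFin_Rint// ltry.
move=> t; apply: Rintegral_ge0 => x _.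
exact: kerM_ge0.
Qed.

(* At a point that is a Lebesgue point of all the |u - x_j|, (x_j) dense in the
   range of u, the averages of |u - u t| vanish. *)
Lemma moll_bound_ae (s : nat -> R) : (forall n, 0 < s n) ->
  (s n)^-1 @[n --> \oo] --> (0 : R) ->
  {ae leb, forall t, moll_bound (s n) t @[n --> \oo] --> (0 : R)}.
Proof.
move=> s0 sV0; have [x [Dx xu]] := good_sep H gu.
pose phi j z := hnorm (u z - x j).
have mphi j : measurable_fun setT (phi j) by exact: diff_meas.
have phi_ge0 j z : 0 <= phi j z by exact: hnorm_ge0.
have icst K c : compact K -> leb.-integrable K (EFin \o cst c).
  move=> cK; apply: measurable_bounded_integrable.
  - exact: compact_measurable.
  - exact: compact_finite_measure.
  - exact: measurable_cst.
  - exact: bounded_cst.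
have lphi j : locally_integrable setT (phi j).
  split; [exact: mphi|exact: openT|move=> K _ cK].
  apply: (@le_lt_trans _ _ (\int[leb]_(z in K) (g z + hnorm (x j))%:E)%E).
    apply: ge0_le_integral => //.
    - exact: compact_measurable.
    - apply/measurable_EFinP; apply: measurableT_comp => //.
      exact: (measurable_funTS (mphi j)).
    - apply/measurable_EFinP; apply: measurable_funTS.
      by apply: measurable_funD => //; exact: measurable_cst.
    - by move=> z _; rewrite lee_fin ger0_norm//; exact: (hnormB H).
  have mK := compact_measurable cK.
  have : leb.-integrable K ((EFin \o g) \+ (EFin \o cst (hnorm (x j)))).
    apply: integrableD => //; first exact: integrableS ig_g.
    exact: icst.
  move=> hI; have E : (\int[leb]_(z in K) (g z + hnorm (x j))%:E =
     \int[leb]_(z in K) ((EFin \o g) \+ (EFin \o cst (hnorm (x j)))) z)%E.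
    by apply: eq_integral.
  rewrite E; exact: integrable_lty.
have hae : {ae leb, forall t, forall j, lebesgue_pt (phi j) t}.
  apply/ae_foralln => j; exact: lebesgue_differentiation.
apply: (ae_imp hae) => t ht; apply/cvg0P => e e0.
(* The error will be [4 * M] times a small average plus [2] times a small distance; each small
   quantity gets the share [e / (4 * M + 3)], with room for strictness. *)
have c0 : 0 < 4 * M + 3 by rewrite ltr_wpDl ?mulr_ge0.
have [|j hj] := xu t (e / (4 * M + 3)); first exact: divr_gt0.
have e1 : 0 < e / (4 * M + 3) by exact: divr_gt0.
have r0 n : 0 < 2 / s n by rewrite divr_gt0.
(* Insert [x j]: |u z - u t| <= |phi j z - phi j t| + 2 phi j t. The kernel is at most [s n * M] on
   an interval of length [4 / s n], which turns the first term into [4 * M] times an average; unit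
   mass handles the second. *)
have key n : moll_bound (s n) t <=
    4 * M * fine (davg (phi j) t (2 / s n)) + 2 * phi j t.
  pose B := ball t (2 / s n).
  have mB : measurable B by exact: measurable_ball.
  have dE : (4 * M * fine (davg (phi j) t (2 / s n)))%:E =
      (\int[leb]_(z in B) (s n * M * `|phi j z - phi j t|)%:E)%E.
    have mc : measurable_fun setT (fun z => phi j z - phi j t).
      by apply: measurable_funB => //; exact: measurable_cst.
    have I0 : (0 <= \int[leb]_(z in B) (`|phi j z - phi j t|)%:E)%E.
      by apply: integral_ge0 => z _; rewrite lee_fin.
    have Ifin : (\int[leb]_(z in B) (`|phi j z - phi j t|)%:E < +oo)%E.
      have [_ _ hK] := lphi j.
      have cB : compact (closed_ball t (2 / s n)) by exact: closed_ballR_compact.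
      have mC := compact_measurable cB.
      have iphi : leb.-integrable (closed_ball t (2 / s n)) (EFin \o phi j).
        apply/integrableP; split; last exact: hK.
        by apply/measurable_EFinP; exact: (measurable_funTS (mphi j)).
      have /integrableP[_] := @integrableB _ _ _ leb _ mC _ _ iphi (icst _ (phi j t) cB).
      apply: le_lt_trans; apply: ge0_subset_integral => //.
      - apply/measurable_EFinP; apply: measurableT_comp => //.
        exact: (measurable_funTS mc).
      - exact: subset_closed_ball.
    rewrite /davg /iavg lebesgue_measure_ball; last exact: ltW.
    rewrite -/B; rewrite -[X in _ = X](_ : ((s n * M)%:E *
      \int[leb]_(z in B) (`|phi j z - phi j t|)%:E)%E = _); last first.
      rewrite -ge0_integralZl//=.
      - apply/measurable_EFinP; apply: measurableT_comp => //.
        exact: (measurable_funTS mc).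
      - by rewrite lee_fin mulr_ge0// ltW.
    have -> : (\int[leb]_(y in B) `|((center (phi j t) \o phi j) y)%:E| =
       \int[leb]_(z in B) (`|phi j z - phi j t|)%:E)%E by apply: eq_integral.
    have If : (\int[leb]_(z in B) (`|phi j z - phi j t|)%:E)%E \is a fin_num.
      by rewrite ge0_fin_numE.
    rewrite -(fineK If); rewrite inver mulrn_eq0/= gt_eqF//=.
    rewrite -!EFinM /=; congr EFin; rewrite -mulr_natr; field.
    by rewrite gt_eqF.
  rewrite -lee_fin EFinD dE.
  have -> : (moll_bound (s n) t)%:E = (\int[leb]_z (ker (s n) t z * hnorm (u z - u t))%:E)%E.
    by rewrite EFin_Rint//; exact: diff_ig.
  have -> : (2 * phi j t)%:E = (\int[leb]_z (2 * phi j t * ker (s n) t z)%:E)%E.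
    rewrite -[LHS]mule1 -(ker_int t (s0 n)) -ge0_integralZl//.
    - by apply/measurable_EFinP; exact: ker_meas.
    - by move=> z _; rewrite lee_fin ker_ge0.
    - by rewrite lee_fin mulr_ge0.
  have mh : measurable_fun setT
      ((fun z : R => (s n * M * `|phi j z - phi j t|)%:E) \_ B).
    apply/(measurable_restrictT _ mB)/measurable_EFinP; apply: measurable_funTS.
    apply: measurable_funM; first exact: measurable_cst.
    apply: measurableT_comp => //; apply: measurable_funB.
      exact: mphi.
    exact: measurable_cst.
  rewrite [X in (_ <= X + _)%E]integral_mkcond -ge0_integralD//=; last 3 first.
  - by move=> z _; rewrite erestrict_ge0// => y _; rewrite lee_fin; do 2 (apply: mulr_ge0 => //); exact: ltW.
  - by move=> z _; rewrite lee_fin mulrC; apply: kerM_ge0 => //; exact: mulr_ge0.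
  - apply/measurable_EFinP; apply: measurable_funM; first exact: measurable_cst.
    exact: ker_meas.
  apply: ge0_le_integral => //.
  - by move=> z _; rewrite lee_fin; exact: kerM_ge0.
  - by apply/measurable_EFinP; exact: ig_meas (diff_ig t (s0 n)).
  - apply: emeasurable_funD.
      exact: mh.
    apply/measurable_EFinP; apply: measurable_funM; first exact: measurable_cst.
    exact: ker_meas.
  move=> z _; rewrite patchE.
  have h1 : hnorm (u z - u t) <= `|phi j z - phi j t| + 2 * phi j t.
    apply: le_trans (hnorm_tri H (w := x j) _ _ _) _ => //.
    rewrite (hnormBC H (u := x j))// -/(phi j z) -/(phi j t).
    have := ler_norm (phi j z - phi j t); lra.
  case: ifPn => zB.
    rewrite -EFinD lee_fin.
    have k0 := ker_ge0 t z (s0 n).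
    have k1 : ker (s n) t z <= s n * M.
      by apply: le_trans (ker_bd t z (s0 n)); exact: ler_norm.
    apply: le_trans (ler_wpM2l k0 h1) _.
    rewrite mulrDr lerD ?ler_wpM2r//.
    by rewrite mulrC.
  rewrite add0e lee_fin ker_out ?mul0r ?mulr0//.
  rewrite leNgt; apply/negP => h; move: zB; rewrite notin_setE; apply.
  by rewrite /B /ball /= distrC.
have hd : davg (phi j) t (2 / s n) @[n --> \oo] --> 0%E.
  have s2 : 2 / s n @[n --> \oo] --> (0 : R).
    by rewrite -[X in _ --> X](mulr0 2); apply: cvgM => //; exact: cvg_cst.
  have hs : 2 / s n @[n --> \oo] --> (0 : R)^'+.
    move=> A [d d0 dA]; have [N hN] := (cvg0P _).1 s2 d d0.
    exists N => // n /= Nn; apply: dA; last exact: r0.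
    by rewrite /= sub0r normrN; exact: hN.
  exact: (@cvg_comp _ _ _ (fun n => 2 / s n) (davg (phi j) t) _ _ _ hs (ht j)).
have [N hN] := (cvg0P _).1 (fine_cvg hd) _ e1.
exists N => n Nn; rewrite ger0_norm; last first.
  by apply: Rintegral_ge0 => z _; apply: kerM_ge0.
apply: le_lt_trans (key n) _.
have := hN n Nn => /=; move/ltr_normlP => -[_ h].
have h2 : 4 * M * fine (davg (phi j) t (2 / s n)) <= 4 * M * (e / (4 * M + 3)).
  by rewrite ler_wpM2l ?mulr_ge0// ltW.
apply: le_lt_trans (lerD h2 (lexx _)) _.
have h3 : phi j t < e / (4 * M + 3) by [].
have E : e = 4 * M * (e / (4 * M + 3)) + 3 * (e / (4 * M + 3)).
  by rewrite -mulrDl mulrCA divff ?mulr1// gt_eqF.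
rewrite [X in _ < X]E ltrD2l; lra.
Qed.

Section Sequence.
Variables (s : nat -> R) (U : nat -> R -> V).
Hypothesis s0 : forall n, 0 < s n.
Hypothesis sV0 : (s n)^-1 @[n --> \oo] --> (0 : R).
Hypothesis hU : forall n t, isint D p (ker (s n) t) u (U n t).

Let DU n t : D (U n t) := (hU n t).1.

Lemma moll_ae : {ae leb, forall t, hnorm (U n t - u t) @[n --> \oo] --> (0 : R)}.
Proof.
apply: (ae_imp (moll_bound_ae s0 sV0)) => t; apply: cvg0_le => n.
by rewrite ger0_norm ?hnorm_ge0//; exact: moll_dist.
Qed.

Lemma moll_meas_lip (f : R -> V) C : (forall t, D (f t)) ->
  (forall t t', hnorm (f t - f t') <= C * `|t - t'|) ->
  (forall c, D c -> continuous (fun t => p (f t) c)) /\ continuous (fun t => hnorm (f t)).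
Proof.
move=> Df fC; split=> [c Dc|].
  apply: (@lipschitz_continuous _ _ (C * hnorm c)) => x y.
  rewrite -(shpBl H)//; apply: le_trans (sh_CS H _ Dc) _; first exact: (shDB H).
  by rewrite mulrAC ler_wpM2r ?hnorm_ge0.
by apply: lipschitz_continuous => x y; apply: le_trans (fC x y); exact: (hnorm_dist H).
Qed.

Lemma moll_diff_meas n : measurable_fun setT (fun t => hnorm (U n t - u t)).
Proof.
have [c1 c2] := moll_meas_lip (DU n) (fun t t' => moll_lip (s0 n) (hU n t) (hU n t')).
apply: (weak_meas_hnorm H) => //.
  by move=> c Dc; apply: continuous_measurable_fun; exact: c1.
rewrite (_ : (fun t => _) = (fun t => hnorm (U n t) * hnorm (U n t))).
  by apply: measurable_funM; exact: continuous_measurable_fun.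
by apply/funext => t; rewrite -expr2 (hnorm_sqr H).
Qed.

Lemma moll_norm_le n t : hnorm (U n t) <= moll_norm (s n) t.
Proof.
apply: (isint_le H Lu (ker_meas (s n) t) (fun x => ker_bd t x (s0 n)) (hU n t)).
  exact: moll_norm_ig0.
by move=> x; rewrite ger0_norm ?ker_ge0.
Qed.

Lemma moll_diff_ig n : ig leb (fun t => hnorm (U n t - u t)).
Proof.
apply: (@ig_le _ _ _ leb (fun t => moll_norm (s n) t + g t)).
- exact: moll_diff_meas.
- by apply: igD => //; exact: (moll_norm_integral (s0 n)).1.
move=> t; rewrite ger0_norm ?hnorm_ge0//.
by apply: le_trans (hnormB H _ _) _ => //; rewrite lerD2r moll_norm_le.
Qed.

(** A Scheffe argument, since the errors [d n] have no common integrable majorant. From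
    [d n <= G n + g] one gets [d n <= min (d n) (2 g) + max (g - G n) 0 + (G n - g)]. The first two
    terms are dominated by multiples of [g] and tend to zero almost everywhere; the last has
    integral zero. *)
Lemma moll_L1 : \int[leb]_t hnorm (U n t - u t) @[n --> \oo] --> (0 : R).
Proof.
pose d n t := hnorm (U n t - u t); pose G n t := moll_norm (s n) t.
have d0 n t : 0 <= d n t by exact: hnorm_ge0.
have md n : measurable_fun setT (d n) by exact: moll_diff_meas.
have iG n : ig leb (G n) := (moll_norm_integral (s0 n)).1.
pose a n t := Num.min (d n t) (2 * g t).
pose b n t := Num.max (g t - G n t) 0.
have ma n : measurable_fun setT (a n).
  apply: measurable_minr => //; apply: measurable_funM => //; exact: measurable_cst.
have mb n : measurable_fun setT (b n).
  apply: measurable_maxr; last exact: measurable_cst.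
  by apply: measurable_funB => //; exact: ig_meas (iG n).
have G0 n t : 0 <= G n t.
  by apply: Rintegral_ge0 => x _; exact: kerM_ge0.
have ha n t : `|a n t| <= 2 * g t.
  rewrite ger0_norm ?ge_min ?lexx ?orbT//.
  by rewrite le_min d0 mulr_ge0.
have hb n t : `|b n t| <= g t.
  rewrite ger0_norm ?le_max ?lexx ?orbT//.
  by rewrite ge_max g0 lerBlDr lerDl G0.
have a_cvg : \int[leb]_t a n t @[n --> \oo] --> (0 : R).
  rewrite -(@Rint0 _ _ _ leb).
  apply: (@Rint_dct _ _ _ leb a (fun=> 0) (fun t => 2 * g t)) => //.
    exact: igZ.
  apply: (ae_imp moll_ae) => t; apply: cvg0_le => n.
  by rewrite ger0_norm ?ge_min ?lexx// le_min d0 mulr_ge0.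
have b_cvg : \int[leb]_t b n t @[n --> \oo] --> (0 : R).
  rewrite -(@Rint0 _ _ _ leb).
  apply: (@Rint_dct _ _ _ leb b (fun=> 0) g) => //.
  apply: (ae_imp (moll_bound_ae s0 sV0)) => t; apply: cvg0_le => n.
  rewrite ger0_norm ?le_max ?lexx ?orbT//.
  have := moll_norm_dist t (s0 n); rewrite -/(G n t) ler_norml => /andP[h1 h2].
  rewrite ge_max; apply/andP; split; first by move: h1; lra.
  by apply: Rintegral_ge0 => x _; apply: kerM_ge0.
have ia n : ig leb (a n) by exact: (@ig_le _ _ _ leb _ _ (ma n) (igZ 2 ig_g) (ha n)).
have ib n : ig leb (b n) by exact: (@ig_le _ _ _ leb _ _ (mb n) ig_g (hb n)).
apply: (@cvg0_le _ _ (fun n => 1 * \int[leb]_t a n t + 1 * \int[leb]_t b n t));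
  last exact: cvg0_lin.
move=> n; rewrite ger0_norm; last by apply: Rintegral_ge0 => t _.
rewrite !mul1r.
apply: (@le_trans _ _ (\int[leb]_t (a n t + b n t + (G n t - g t)))).
  apply: le_Rint; first exact: moll_diff_ig.
    by apply: igD; [exact: igD|exact: igB].
  move=> t; rewrite -/(d n t).
  have h : d n t <= G n t + g t.
    by apply: le_trans (hnormB H _ _) _ => //; rewrite lerD2r moll_norm_le.
  rewrite /a /b; have [h1|h1] := leP (d n t) (2 * g t);
  have [h2|h2] := leP (g t - G n t) 0; lra.
rewrite RintD; [|exact: igD|exact: igB].
rewrite RintB// (moll_norm_integral (s0 n)).2 subrr addr0 RintD//.
Qed.

End Sequence.
End Mollification.


(** * One-variable calculus: mean values, Taylor bounds, integrals of derivatives *)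

Section Calculus.
Variable R : realType.
Local Notation leb := (@lebesgue_measure R).
Implicit Types (f g : R -> R).

Lemma mvt_point f (df : R -> R) : (forall x : R, is_derive x 1 f (df x)) ->
  forall x y, exists c, [/\ Num.min x y <= c, c <= Num.max x y & f y - f x = df c * (y - x)].
Proof.
move=> hf; suff key x y : x <= y -> exists c, [/\ x <= c, c <= y & f y - f x = df c * (y - x)].
  move=> x y; have [xy|yx] := leP x y; first exact: key.
  have [c [h1 h2 h3]] := key _ _ (ltW yx); exists c; split => //.
  by rewrite -opprB h3 -mulrN opprB.
move=> xy; have [|c] := @MVT_segment _ f df x y xy (fun z _ => hf z).
- by apply: continuous_subspaceT => z; exact: is_derive_cont (hf z).
by rewrite in_itv /= => /andP[h1 h2] h3; exists c.
Qed.

Lemma der_bounded_lipschitz f (df : R -> R) C : (forall x : R, is_derive x 1 f (df x)) ->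
  (forall x, `|df x| <= C) -> forall x y, `|f x - f y| <= C * `|x - y|.
Proof.
move=> hf hC x y; have [c [_ _ E]] := mvt_point hf y x.
by rewrite E normrM ler_wpM2r.
Qed.

Lemma der_lipschitz_taylor f (df : R -> R) C : (forall x : R, is_derive x 1 f (df x)) ->
  (forall x y, `|df x - df y| <= C * `|x - y|) ->
  forall y d, `|f (y + d) - f y - d * df y| <= C * d ^+ 2.
Proof.
move=> hf hC y d; have [c [h1 h2 E]] := mvt_point hf y (y + d).
rewrite E (_ : _ - d * df y = d * (df c - df y)); last by ring.
rewrite normrM.
have C0 : 0 <= C.
  have := le_trans (normr_ge0 _) (hC 1 0); rewrite subr0 normr1 mulr1.
  exact.
have h3 : `|c - y| <= `|d|.
  move: h1 h2; rewrite ge_min le_max.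
  have := ler_norm d; have := ler_norm (- d); rewrite normrN ler_norml => a1 a2.
  by move=> /orP[?|?] /orP[?|?]; lra.
rewrite -real_normK ?num_real// expr2 mulrCA ler_wpM2l//.
by apply: le_trans (hC c y) _; rewrite ler_wpM2l.
Qed.

Lemma der_zero_outside f (df : R -> R) a b : (forall x : R, is_derive x 1 f (df x)) ->
  (forall x, x < a \/ b < x -> f x = 0) -> forall x, x < a \/ b < x -> df x = 0.
Proof.
move=> hf f0 x xab.
have h : is_derive x 1 f 0.
  apply: (@near_eq_is_derive _ _ _ (fun=> 0)).
  case: xab => [xa|bx].
    near=> y; rewrite f0//; left; near: y; exact: lt_nbhsl.
  near=> y; rewrite f0//; right; near: y; exact: lt_nbhsr.
have := derive_val (is_derive := h); have := derive_val (is_derive := hf x).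
by move=> -> ->.
Unshelve. all: by end_near. Qed.

Lemma cont_bounded_outside f a b : continuous f ->
  (forall x, x < a \/ b < x -> f x = 0) -> exists C, 0 <= C /\ forall x, `|f x| <= C.
Proof.
move=> cf f0; have [ab|ba] := leP a b; last first.
  exists 0; split => // x; rewrite f0 ?normr0//.
  by have [xb|bx] := leP x b; [left; apply: le_lt_trans ba|right].
have cn : {within `[a, b], continuous (fun x => `|f x|)}.
  by apply: continuous_subspaceT => x; apply: continuous_comp; [exact: cf|exact: norm_continuous].
have [c cab hc] := EVT_max ab cn.
exists `|f c|; split => // x.
have [xa|ax] := ltP x a; first by rewrite f0 ?normr0//; left.
have [bx|xb] := ltP b x; first by rewrite f0 ?normr0//; right.
by apply: hc; rewrite in_itv/= ax.
Qed.

(** The continuous integrand is asked to agree with the derivative on [[s, t]] only, because the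
    balance law identifies the two only at times whose kernel is admissible. *)
Lemma FTC_cont (F dF f : R -> R) s t : s <= t -> (forall x : R, is_derive x 1 F (dF x)) ->
  continuous f -> (forall x, s <= x <= t -> dF x = f x) ->
  F t - F s = \int[leb]_(x in `[s, t]) f x.
Proof.
move=> st hF cf E; move: st; rewrite le_eqVlt => /predU1P[<-|st].
  by rewrite subrr set_itv1 Rintegral_set1.
rewrite /Rintegral (@continuous_FTC2 _ f F s t st)//.
- by apply: continuous_subspaceT.
- split.
  + by move=> x _; have := hF x => h; exact: ex_derive.
  + by apply: cvg_at_right_filter; exact: is_derive_cont (hF s).
  + by apply: cvg_at_left_filter; exact: is_derive_cont (hF t).
- move=> x; rewrite in_itv/= => /andP[h1 h2].
  by rewrite (is_derive1E (hF x)) E// !ltW.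
Qed.

Lemma smooth_expr_kernel_bounds f a b : smooth_expr f ->
  (forall x, x < a \/ b < x -> f x = 0) ->
  exists C, [/\ 0 <= C, forall x, `|f x| <= C, forall x, `|derive1 f x| <= C,
    forall x y, `|f x - f y| <= C * `|x - y| &
    (forall x y, `|derive1 f x - derive1 f y| <= C * `|x - y|) /\
    forall y d, `|f (y + d) - f y - d * derive1 f y| <= C * d ^+ 2].
Proof.
move=> sf f0; have [sf1 df] := smooth_expr_derive1 sf.
have [sf2 df1] := smooth_expr_derive1 sf1.
have f10 := der_zero_outside df f0; have f20 := der_zero_outside df1 f10.
have [C0 [C00 h0]] := cont_bounded_outside (smooth_expr_cont sf) f0.
have [C1 [C10 h1]] := cont_bounded_outside (smooth_expr_cont sf1) f10.
have [C2 [C20 h2]] := cont_bounded_outside (smooth_expr_cont sf2) f20.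
have C0le : C0 <= C0 + C1 + C2 by lra.
have C1le : C1 <= C0 + C1 + C2 by lra.
have C2le : C2 <= C0 + C1 + C2 by lra.
have lip1 := der_bounded_lipschitz df h1.
have lip2 := der_bounded_lipschitz df1 h2.
have tay := der_lipschitz_taylor df lip2.
exists (C0 + C1 + C2); split.
- lra.
- by move=> x; exact: le_trans (h0 x) _.
- by move=> x; exact: le_trans (h1 x) _.
- by move=> x y; apply: le_trans (lip1 x y) _; rewrite ler_wpM2r.
- split=> x y; first by apply: le_trans (lip2 x y) _; rewrite ler_wpM2r.
  by apply: le_trans (tay x y) _; rewrite ler_wpM2r ?sqr_ge0.
Qed.

End Calculus.


(** * The energy balance in a Hilbert space *)

Section EnergyBalance.
Variables (R : realType) (V : lmodType R) (D : set V) (p : V -> V -> R).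
Hypothesis H : semihilbert D p.
Local Notation hnorm := (hnorm p).
Local Notation leb := (@lebesgue_measure R).

Record bounded_symmetric (A : V -> V) (C : R) : Prop := BoundedSymmetric {
  bs_D : forall u, D u -> D (A u);
  bs_linear : linear A;
  bs_sym : forall u v, D u -> D v -> p (A u) v = p u (A v);
  bs_bound : forall u, D u -> hnorm (A u) <= C * hnorm u }.

(** Differentiability in norm is encoded as a uniform second-order Taylor estimate, the form that
    [is_derive_quad] consumes. *)
Record smooth_curve (U U' : R -> V) (K : R) : Prop := SmoothCurve {
  sc_D : forall t, D (U t);
  sc_D' : forall t, D (U' t);
  sc_bd : forall t, hnorm (U t) <= K;
  sc_lip : forall t t', hnorm (U t - U t') <= K * `|t - t'|;
  sc_taylor : forall t d, hnorm (U (t + d) - U t - d *: U' t) <= K * d ^+ 2 }.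

Section Quadratic.
Variables (A : V -> V) (C : R) (hA : bounded_symmetric A C).

Let AD u v : A (u + v) = A u + A v.
Proof. by rewrite -{1}[u]scale1r (bs_linear hA) scale1r. Qed.
Let A0 : A 0 = 0.
Proof. by have /eqP := AD 0 0; rewrite addr0 -subr_eq subrr => /eqP <-. Qed.
Let AZ a u : A (a *: u) = a *: A u.
Proof. by rewrite -[a *: u]addr0 (bs_linear hA) A0 addr0. Qed.
Lemma bs_sub u v : A (u - v) = A u - A v.
Proof. by rewrite AD -scaleN1r AZ scaleN1r. Qed.

Lemma bs_form u v : D u -> D v -> `|p (A u) v| <= `|C| * hnorm u * hnorm v.
Proof.
move=> Du Dv; apply: le_trans (sh_CS H _ Dv) _; first exact: (bs_D hA).
rewrite ler_wpM2r ?hnorm_ge0//; apply: le_trans (bs_bound hA Du) _.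
by rewrite ler_wpM2r ?hnorm_ge0// ler_norm.
Qed.

Lemma quad_expand u v : D u -> D v ->
  p (A v) v = p (A u) u + 2 * p (A (v - u)) u + p (A (v - u)) (v - u).
Proof.
move=> Du Dv; have DAu := bs_D hA Du; have DAv := bs_D hA Dv.
rewrite bs_sub !(shpBl H) ?(shpBr H)//; last exact: (shDB H).
have : p (A v) u = p (A u) v by rewrite (bs_sym hA)// (sh_C H).
by move=> ->; ring.
Qed.

Lemma quad_derive U U' K (t : R) : smooth_curve U U' K ->
  is_derive t 1 (fun t : R => p (A (U t)) (U t)) (2 * p (A (U' t)) (U t)).
Proof.
move=> hU; have DU := sc_D hU; have DU' := sc_D' hU.
apply: (@is_derive_quad _ _ _ _ _ _ (`|C| * (2 * K * K + K ^+ 2))) => d.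
rewrite [d *: 1]mulr1 [d + t]addrC.
set v := U (t + d); set u := U t; set w := U' t.
have Dv : D v := DU _. have Du : D u := DU _. have Dw : D w := DU' _.
have DAu := bs_D hA Du; have DAv := bs_D hA Dv; have DAw := bs_D hA Dw.
(* The remainder splits into a term linear in the Taylor remainder of the curve and a term quadratic
   in its increment; both are of order [d ^+ 2]. *)
have -> : p (A v) v - p (A u) u - d * (2 * p (A w) u) =
    2 * p (A (v - u - d *: w)) u + p (A (v - u)) (v - u).
  rewrite (quad_expand Du Dv) (bs_sub (v - u)) AZ (shpBl H)//; last 2 first.
  - by apply: (bs_D hA); exact: (shDB H).
  - exact: (shDZ H).
  by rewrite (shpZl H)//; ring.
have h1 : `|2 * p (A (v - u - d *: w)) u| <= 2 * (`|C| * (K * d ^+ 2) * K).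
  rewrite normrM ger0_norm// ler_wpM2l//.
  apply: le_trans (bs_form _ Du) _.
    by apply: (shDB H); [exact: (shDB H)|exact: (shDZ H)].
  apply: ler_pM; rewrite ?mulr_ge0 ?hnorm_ge0//; last exact: (sc_bd hU).
  by rewrite ler_wpM2l//; exact: (sc_taylor hU).
have h2 : `|p (A (v - u)) (v - u)| <= `|C| * (K * `|d|) * (K * `|d|).
  have h : hnorm (v - u) <= K * `|d|.
    by have := sc_lip hU (t + d) t; rewrite (_ : t + d - t = d)//; ring.
  apply: le_trans (bs_form _ _) _; try exact: (shDB H).
  apply: ler_pM; rewrite ?mulr_ge0 ?hnorm_ge0//.
  by rewrite ler_wpM2l.
apply: le_trans (ler_normD _ _) _; apply: le_trans (lerD h1 h2) _.
have -> : d ^+ 2 = `|d| ^+ 2 by rewrite real_normK ?num_real.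
by rewrite le_eqVlt; apply/orP; left; apply/eqP; ring.
Qed.

End Quadratic.

Lemma form_continuous (U G : R -> V) K : (forall t, D (U t)) -> (forall t, D (G t)) ->
  (forall t, hnorm (U t) <= K) -> (forall t, hnorm (G t) <= K) ->
  (forall t t', hnorm (U t - U t') <= K * `|t - t'|) ->
  (forall t t', hnorm (G t - G t') <= K * `|t - t'|) ->
  continuous (fun t => p (G t) (U t)).
Proof.
move=> DU DG bU bG lU lG; apply: (@lipschitz_continuous _ _ (K * K + K * K)) => x y.
have -> : p (G x) (U x) - p (G y) (U y) =
    p (G x - G y) (U x) + p (G y) (U x - U y).
  by rewrite (shpBl H)// (shpBr H)//; ring.
apply: le_trans (ler_normD _ _) _; rewrite mulrDl; apply: lerD.
  apply: le_trans (sh_CS H _ _) _ => //; first exact: (shDB H).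
  by rewrite mulrAC; apply: ler_pM; rewrite ?hnorm_ge0.
apply: le_trans (sh_CS H _ _) _ => //; first exact: (shDB H).
by rewrite -mulrA; apply: ler_pM; rewrite ?hnorm_ge0.
Qed.

Section Kernel.
Variables (u : R -> V) (Lu : L1 D p u) (kap : R -> R) (a b : R).
Hypothesis skap : smooth_expr kap.
Hypothesis kap0 : forall x, x < a \/ b < x -> kap x = 0.

Lemma isint_le_cst (k : R -> R) (K : R) y : measurable_fun setT k -> (forall t, `|k t| <= K) ->
  isint D p k u y -> hnorm y <= K * \int[leb]_t hnorm (u t).
Proof.
move=> mk kK hy; rewrite -RintZ; last exact: Lu.2.
apply: (isint_le H Lu mk kK hy); first by apply: igZ; exact: Lu.2.
by move=> t; rewrite ler_wpM2r ?hnorm_ge0.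
Qed.

Let shift_meas (f : R -> R) (t : R) : continuous f -> measurable_fun setT (fun x : R => f (x - t)).
Proof.
move=> cf; apply: continuous_measurable_fun => x.
by apply: continuous_comp; [apply: cvgB => //; exact: cvg_cst|exact: cf].
Qed.

(** By linearity in the kernel, [U (t + d) - U t - d *: U' t] is the integral of [u] against the
    Taylor remainder of [kap] at [x - t], which is uniformly of order [d ^+ 2]. The minus sign in
    the kernel of [U'] comes from [t] entering through [x - t]. *)
Lemma kernel_curve (U U' : R -> V) :
  (forall t, isint D p (fun x => kap (x - t)) u (U t)) ->
  (forall t, isint D p (fun x => - derive1 kap (x - t)) u (U' t)) ->
  exists K, smooth_curve U U' K.
Proof.
move=> hU hU'; have [C [C0 kC kC1 kL [k1L kT]]] := smooth_expr_kernel_bounds skap kap0.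
have [skap1 _] := smooth_expr_derive1 skap.
have ck := smooth_expr_cont skap; have ck1 := smooth_expr_cont skap1.
have mk t := shift_meas t ck.
have mk1 t : measurable_fun setT (fun x : R => - derive1 kap (x - t)).
  by apply: measurableT_comp => //; exact: shift_meas.
have kC' t x : `|kap (x - t)| <= C by [].
have kC1' t x : `|- derive1 kap (x - t)| <= C by rewrite normrN.
exists (C * \int[leb]_t hnorm (u t)); split.
- by move=> t; case: (hU t).
- by move=> t; case: (hU' t).
- by move=> t; exact: isint_le_cst (mk t) (kC' t) (hU t).
- move=> t t'.
  have h := isint_lin H (-1) Lu (mk t') (mk t) (kC' t') (kC' t) (hU t') (hU t).
  rewrite (_ : U t - U t' = -1 *: U t' + U t); last by rewrite scaleN1r addrC.
  rewrite mulrAC; apply: (isint_le_cst _ _ h).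
    by apply: measurable_funD => //; apply: measurable_funM => //; exact: measurable_cst.
  move=> x; rewrite mulN1r addrC; apply: le_trans (kL _ _) _.
  by rewrite (_ : x - t - (x - t') = t' - t) ?[`|t' - t|]distrC//; ring.
- move=> t d.
  have h := isint_lin H (-1) Lu (mk t) (mk (t + d)) (kC' t) (kC' (t + d)) (hU t) (hU (t + d)).
  have mh : measurable_fun setT (fun x : R => -1 * kap (x - t) + kap (x - (t + d))).
    by apply: measurable_funD => //; apply: measurable_funM => //; exact: measurable_cst.
  have bh x : `|-1 * kap (x - t) + kap (x - (t + d))| <= C + C.
    apply: le_trans (ler_normD _ _) _; apply: lerD => //.
    by rewrite mulN1r normrN.
  have h' := isint_lin H (- d) Lu (mk1 t) mh (kC1' t) bh (hU' t) h.
  rewrite (_ : U (t + d) - U t - d *: U' t = - d *: U' t + (-1 *: U t + U (t + d))); last first.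
    by rewrite scaleN1r scaleNr addrC; congr (_ + _); rewrite addrC.
  rewrite mulrAC; apply: (isint_le_cst _ _ h').
    by apply: measurable_funD => //; apply: measurable_funM => //; exact: measurable_cst.
  move=> x; have := kT (x - t) (- d); rewrite sqrrN.
  have -> : kap (x - t - d) = kap (x - (t + d)) by congr kap; ring.
  by congr (`|_| <= _); ring.
Qed.

End Kernel.

Variables (A M : V -> V) (CA CM : R).
Hypothesis hA : bounded_symmetric A CA.
Hypothesis hM : bounded_symmetric M CM.

Definition energy_form u w := 2^-1 * (p (A u) u + p (M w) w).

Variables (E B F : R -> V) (LE : L1 D p E) (LB : L1 D p B) (LF : L1 D p F).

(** The interface with the field equations. [eta] is one scalar test function, and integrating
    against [- derive1 eta] produces the mollified time derivative. The relation contains no curl,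
    so it makes sense in any Hilbert space. *)
Definition balance (eta : R -> R) := forall U U' W W' G,
  isint D p eta E U -> isint D p (fun x => - derive1 eta x) E U' ->
  isint D p eta B W -> isint D p (fun x => - derive1 eta x) B W' ->
  isint D p eta F G ->
  p (A U') U + p (M W') W = p G U.

Lemma derive1_shift (kap : R -> R) (t x : R) : smooth_expr kap ->
  derive1 (fun x => kap (x - t)) x = derive1 kap (x - t).
Proof.
move=> sk; have [_ dk] := smooth_expr_derive1 sk.
apply: is_derive1E; have h := is_derive_affine 1 (- t) x.
have := is_derive1_comp (g := fun x => 1 * x - t) (dk _) h; rewrite mulr1 mul1r.
by rewrite (_ : kap \o _ = fun x => kap (x - t))//; apply/funext => y; rewrite /= mul1r.
Qed.

(** Symmetry of [A] and [M] makes the derivative of the energy equal to the left side of [balance];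
    it is then integrated in time. *)
Lemma energy_kernel (kap : R -> R) (a b lo hi : R) (U W G : R -> V) :
  smooth_expr kap -> (forall x, x < a \/ b < x -> kap x = 0) ->
  (forall t, lo <= t <= hi -> balance (fun x => kap (x - t))) ->
  (forall t, isint D p (fun x => kap (x - t)) E (U t)) ->
  (forall t, isint D p (fun x => kap (x - t)) B (W t)) ->
  (forall t, isint D p (fun x => kap (x - t)) F (G t)) ->
  continuous (fun t => p (G t) (U t)) /\
  forall s t, lo <= s -> s <= t -> t <= hi ->
    energy_form (U t) (W t) - energy_form (U s) (W s) =
    \int[leb]_(x in `[s, t]) p (G x) (U x).
Proof.
move=> sk k0 hb hU hW hG.
have [C [C0 kC kC1 kL [k1L kT]]] := smooth_expr_kernel_bounds sk k0.
have [sk1 _] := smooth_expr_derive1 sk; have ck1 := smooth_expr_cont sk1.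
have mk1 t : measurable_fun setT (fun x : R => - derive1 kap (x - t)).
  apply: measurableT_comp => //; apply: continuous_measurable_fun => x.
  by apply: continuous_comp; [apply: cvgB => //; exact: cvg_cst|exact: ck1].
have kC1' t x : `|- derive1 kap (x - t)| <= C by rewrite normrN.
have ex u : L1 D p u -> exists u' : R -> V,
    forall t, isint D p (fun x => - derive1 kap (x - t)) u (u' t).
  move=> Lu.
  have /choice[u' hu'] : forall t, exists y, isint D p (fun x => - derive1 kap (x - t)) u y.
    by move=> t; exact: (isint_exists H Lu (mk1 t) (kC1' t)).
  by exists u'.
have [U' hU'] := ex _ LE; have [W' hW'] := ex _ LB; have [G' hG'] := ex _ LF.
have [KU cU] := kernel_curve LE sk k0 hU hU'.
have [KW cW] := kernel_curve LB sk k0 hW hW'.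
have [KG cG] := kernel_curve LF sk k0 hG hG'.
have cGU : continuous (fun t => p (G t) (U t)).
  have KU0 : 0 <= KU := le_trans (hnorm_ge0 p _) (sc_bd cU 0).
  have KG0 : 0 <= KG := le_trans (hnorm_ge0 p _) (sc_bd cG 0).
  apply: (@form_continuous _ _ (KU + KG)) => //.
  - exact: (sc_D cU).
  - exact: (sc_D cG).
  - by move=> t; apply: le_trans (sc_bd cU t) _; rewrite lerDl.
  - by move=> t; apply: le_trans (sc_bd cG t) _; rewrite lerDr.
  - by move=> t t'; apply: le_trans (sc_lip cU t t') _; rewrite ler_wpM2r// lerDl.
  - by move=> t t'; apply: le_trans (sc_lip cG t t') _; rewrite ler_wpM2r// lerDr.
split=> // s t los st thi.
apply: (@FTC_cont _ (fun t => energy_form (U t) (W t))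
  (fun t => p (A (U' t)) (U t) + p (M (W' t)) (W t))) => //.
  move=> x; rewrite /energy_form.
  have d1 := quad_derive hA x cU; have d2 := quad_derive hM x cW.
  apply: (is_derive_eq (is_deriveZ 2^-1 (is_deriveD d1 d2))).
  by rewrite /GRing.scale /=; field.
move=> x /andP[sx xt].
apply: (hb x _ _ _ _ _ _ (hU x) _ (hW x) _ (hG x)).
- by rewrite (le_trans los)//= (le_trans xt).
- rewrite (_ : (fun _ => _) = (fun y => - derive1 kap (y - x)))//.
  by apply/funext => y; rewrite derive1_shift.
- rewrite (_ : (fun _ => _) = (fun y => - derive1 kap (y - x)))//.
  by apply/funext => y; rewrite derive1_shift.
Qed.

End EnergyBalance.


Section IntervalIntegrals.
Variable R : realType.
Local Notation leb := (@lebesgue_measure R).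

Lemma Rint_itvE (f : R -> R) s t :
  \int[leb]_(x in `[s, t]) f x = \int[leb]_x (\1_(`[s, t]%classic : set R) x * f x).
Proof.
rewrite Rintegral_mkcond; apply: eq_Rintegral => x _; rewrite patchE indicE.
by case: ifP; rewrite ?mul1r ?mul0r.
Qed.

Lemma itv_indic_meas (s t : R) : measurable_fun setT (\1_(`[s, t]%classic : set R) : R -> R).
Proof. exact: measurable_indic (measurable_itv _). Qed.

Lemma itv_indic_integral (s t : R) : s <= t ->
  (\int[leb]_x (\1_(`[s, t]%classic : set R) x)%:E = (t - s)%:E)%E.
Proof.
move=> st; have E : leb `[s, t]%classic = (t - s)%:E.
  rewrite lebesgue_measure_itv/= lte_fin; case: ltP => // ts.
  by rewrite (_ : t = s) ?subrr//; apply/eqP; rewrite eq_le ts.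
by rewrite -E integral_indic// setIT.
Qed.

Lemma itv_indic_ig (s t : R) : ig leb (\1_(`[s, t]%classic : set R)).
Proof.
apply: (@ge0_ig _ _ _ leb _ (itv_indic_meas s t)) => //.
have [st|ts] := leP s t; first by rewrite itv_indic_integral// ltry.
rewrite set_itv_ge ?bnd_simp -?ltNge// (eq_integral (fun=> 0%E)) ?integral0//.
by move=> x _; rewrite indic0.
Qed.

Lemma itv_indic_Rint (s t : R) : s <= t ->
  \int[leb]_x \1_(`[s, t]%classic : set R) x = t - s.
Proof. by move=> st; rewrite /Rintegral itv_indic_integral. Qed.

End IntervalIntegrals.

(** * Uniform convergence of the mollified fields on a time interval *)

Section LocalSolution.
Variables (R : realType) (V : lmodType R) (D : set V) (p : V -> V -> R).
Hypothesis H : semihilbert D p.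
Local Notation hnorm := (hnorm p).
Local Notation leb := (@lebesgue_measure R).
Variables (rho : R -> R) (L Mr : R).
Hypothesis rho_smooth : smooth_expr rho.
Hypothesis rho_lip : forall x y, `|rho x - rho y| <= L * `|x - y|.
Hypothesis rho_ge0 : forall x, 0 <= rho x.
Hypothesis rho_le : forall x, rho x <= Mr.
Hypothesis rho_supp : forall x, 2 <= `|x| -> rho x = 0.
Hypothesis rho_int : (\int[leb]_x (rho x)%:E = 1)%E.
Variable sq : nat -> R.
Hypothesis s0 : forall n, 0 < sq n.
Hypothesis sV0 : (sq n)^-1 @[n --> \oo] --> (0 : R).
Variables (A M : V -> V) (CA CM c : R).
Hypothesis hA : bounded_symmetric D p A CA.
Hypothesis hM : bounded_symmetric D p M CM.
Hypothesis c0 : 0 < c.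
Hypothesis cA : forall u, D u -> c * p u u <= p (A u) u.
Hypothesis cM : forall u, D u -> c * p u u <= p (M u) u.
Variables (E B F : R -> V) (LE : L1 D p E) (LB : L1 D p B) (LF : L1 D p F) (K : R).
Hypothesis bE : forall t, hnorm (E t) <= K.
Hypothesis bB : forall t, hnorm (B t) <= K.
Variables (T lo hi : R).
Hypothesis lohi : lo < hi.

Definition supported (eta : R -> R) := exists a b, [/\ 0 < a, b < T &
  forall x, x < a \/ b < x -> eta x = 0].

Hypothesis hsupp : forall n t, lo <= t <= hi -> supported (ker rho (sq n) t).
Hypothesis hbal : forall eta, smooth_expr eta -> supported eta ->
  balance D p A M E B F eta.

Local Notation en := (energy_form p A M).
Let K0 : 0 <= K := le_trans (hnorm_ge0 p _) (bE 0).

Let kap n (y : R) := sq n * rho (sq n * y).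
Let kapE n t x : ker rho (sq n) t x = kap n (x - t). Proof. by []. Qed.

Let kap_smooth n : smooth_expr (kap n).
Proof.
apply: smooth_scale; have := smooth_expr_comp (sq n) 0 rho_smooth.
by rewrite (_ : (fun x => _) = (fun x => rho (sq n * x)))//; apply/funext => x; rewrite addr0.
Qed.

Let kap_out n y : y < - (2 / sq n) \/ 2 / sq n < y -> kap n y = 0.
Proof.
move=> h; have -> : kap n y = ker rho (sq n) 0 y by rewrite kapE subr0.
apply: (ker_out rho_supp) => //; rewrite subr0.
have [y0|y0] := leP 0 y; [rewrite ger0_norm//|rewrite ltr0_norm//].
  case: h => h; last exact: ltW.
  have : 0 < 2 / sq n by rewrite divr_gt0.
  by move: h y0; lra.
case: h => h; first by move: h; lra.
have : 0 < 2 / sq n by rewrite divr_gt0.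
by move: h y0; lra.
Qed.

Let kmeas n t := ker_meas rho_lip (sq n) t.
Let kbd n t x := ker_bd rho_ge0 rho_le t x (s0 n).

Let rep u : L1 D p u -> exists U : nat -> R -> V,
  forall n t, isint D p (ker rho (sq n) t) u (U n t).
Proof.
move=> Lu; have h n : exists U : R -> V, forall t, isint D p (ker rho (sq n) t) u (U t).
  have /choice[U hU] : forall t, exists y, isint D p (ker rho (sq n) t) u y.
    by move=> t; exact: (isint_exists H Lu (kmeas n t) (kbd n t)).
  by exists U.
by have /choice[U hU] := h; exists U.
Qed.

(** The kernel is a probability density, so averaging does not raise the bound. *)
Let rep_bd u : L1 D p u -> (forall t, hnorm (u t) <= K) -> forall n t y,
  isint D p (ker rho (sq n) t) u y -> hnorm y <= K.
Proof.
move=> Lu bu n t y hy.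
have ik := ker_ig rho_lip rho_ge0 rho_int t (s0 n).
apply: le_trans (isint_le H Lu (kmeas n t) (kbd n t) hy (igZ K ik) _) _.
  by move=> x; rewrite ger0_norm ?(ker_ge0 rho_ge0)// mulrC; apply: ler_wpM2r => //;
    exact: (ker_ge0 rho_ge0).
by rewrite RintZ// (ker_Rint rho_lip rho_ge0 rho_int)// mulr1.
Qed.

Section Approximants.
Variables U W G : nat -> R -> V.
Hypothesis hU : forall n t, isint D p (ker rho (sq n) t) E (U n t).
Hypothesis hW : forall n t, isint D p (ker rho (sq n) t) B (W n t).
Hypothesis hG : forall n t, isint D p (ker rho (sq n) t) F (G n t).

Let DU n t : D (U n t) := (hU n t).1.
Let DW n t : D (W n t) := (hW n t).1.
Let DG n t : D (G n t) := (hG n t).1.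
Let DE t : D (E t) := good_D H LE.1 t.
Let DB t : D (B t) := good_D H LB.1 t.
Let DF t : D (F t) := good_D H LF.1 t.
Let bU n t : hnorm (U n t) <= K := rep_bd LE bE (hU n t).
Let bW n t : hnorm (W n t) <= K := rep_bd LB bB (hW n t).

Let dU n x := hnorm (U n x - E x).
Let dW n x := hnorm (W n x - B x).
Let dG n x := hnorm (G n x - F x).
(** The total L^1 error of the three mollifications: every estimate below is in terms of
    [om n + om m], uniformly in time. *)
Let om n := \int[leb]_x dU n x + \int[leb]_x dW n x + \int[leb]_x dG n x.

Let idU n : ig leb (dU n) := moll_diff_ig H rho_lip rho_ge0 rho_le rho_int LE s0 hU n.
Let idW n : ig leb (dW n) := moll_diff_ig H rho_lip rho_ge0 rho_le rho_int LB s0 hW n.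
Let idG n : ig leb (dG n) := moll_diff_ig H rho_lip rho_ge0 rho_le rho_int LF s0 hG n.

Let dU_int : \int[leb]_x dU n x @[n --> \oo] --> (0 : R) :=
  moll_L1 H rho_lip rho_ge0 rho_le rho_supp rho_int LE s0 sV0 hU.
Let dW_int : \int[leb]_x dW n x @[n --> \oo] --> (0 : R) :=
  moll_L1 H rho_lip rho_ge0 rho_le rho_supp rho_int LB s0 sV0 hW.
Let dG_int : \int[leb]_x dG n x @[n --> \oo] --> (0 : R) :=
  moll_L1 H rho_lip rho_ge0 rho_le rho_supp rho_int LF s0 sV0 hG.

Lemma om_cvg : om n @[n --> \oo] --> (0 : R).
Proof.
rewrite -[X in _ --> X](_ : 0 + 0 + 0 = 0); last by rewrite !addr0.
by apply: cvgD => //; apply: cvgD.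
Qed.

Let om_ge n : [/\ 0 <= \int[leb]_x dU n x, 0 <= \int[leb]_x dW n x & 0 <= \int[leb]_x dG n x].
Proof. by split; apply: Rintegral_ge0 => x _; exact: hnorm_ge0. Qed.

Lemma en_lower u w : D u -> D w -> c / 2 * (hnorm u ^+ 2 + hnorm w ^+ 2) <= en u w.
Proof.
move=> Du Dw; rewrite /energy_form !(hnorm_sqr H)//.
have := cA Du; have := cM Dw; lra.
Qed.

Lemma en_upper u w : D u -> D w ->
  en u w <= (`|CA| + `|CM|) * (hnorm u ^+ 2 + hnorm w ^+ 2).
Proof.
move=> Du Dw; rewrite /energy_form.
have h1 := le_trans (ler_norm _) (bs_form H hA Du Du).
have h2 := le_trans (ler_norm _) (bs_form H hM Dw Dw).
rewrite -mulrA -expr2 in h1; rewrite -mulrA -expr2 in h2.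
have a1 : 0 <= `|CA| * hnorm u ^+ 2 by rewrite mulr_ge0 ?sqr_ge0.
have a2 : 0 <= `|CM| * hnorm w ^+ 2 by rewrite mulr_ge0 ?sqr_ge0.
have a3 : 0 <= `|CM| * hnorm u ^+ 2 by rewrite mulr_ge0 ?sqr_ge0.
have a4 : 0 <= `|CA| * hnorm w ^+ 2 by rewrite mulr_ge0 ?sqr_ge0.
by rewrite mulrDl !mulrDr; move: h1 h2; lra.
Qed.

Let difE n m t : isint D p (fun x => -1 * kap m (x - t) + kap n (x - t)) E (-1 *: U m t + U n t).
Proof. exact: (isint_lin H (-1) LE (kmeas m t) (kmeas n t) (kbd m t) (kbd n t) (hU m t) (hU n t)). Qed.
Let difB n m t : isint D p (fun x => -1 * kap m (x - t) + kap n (x - t)) B (-1 *: W m t + W n t).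
Proof. exact: (isint_lin H (-1) LB (kmeas m t) (kmeas n t) (kbd m t) (kbd n t) (hW m t) (hW n t)). Qed.
Let difF n m t : isint D p (fun x => -1 * kap m (x - t) + kap n (x - t)) F (-1 *: G m t + G n t).
Proof. exact: (isint_lin H (-1) LF (kmeas m t) (kmeas n t) (kbd m t) (kbd n t) (hG m t) (hG n t)). Qed.

Let subE (y z : V) : -1 *: y + z = z - y.
Proof. by rewrite scaleN1r addrC. Qed.

(** The difference of two mollifications is the integral against the difference of two kernels, so
    it satisfies the balance law too. The energy change is then the integral of
    [(G n - G m, U n - U m)], where the second factor is at most [2 * K] and the first is small in
    L^1 because both terms approach [F]. *)
Let dif_balance n m s t : lo <= s -> s <= t -> t <= hi ->
  `|en (U n t - U m t) (W n t - W m t) - en (U n s - U m s) (W n s - W m s)|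
     <= 2 * K * (om n + om m).
Proof.
move=> los st thi.
pose ka y := -1 * kap m y + kap n y.
have ska : smooth_expr ka by apply: smooth_add => //; exact: smooth_scale.
have ka0 x : x < - (2 / sq n + 2 / sq m) \/ 2 / sq n + 2 / sq m < x -> ka x = 0.
  have p1 : 0 < 2 / sq n by rewrite divr_gt0.
  have p2 : 0 < 2 / sq m by rewrite divr_gt0.
  move=> h; rewrite /ka !kap_out ?mulr0 ?addr0//.
    by case: h => h; [left|right]; move: h p1 p2; lra.
  by case: h => h; [left|right]; move: h p1 p2; lra.
have hb z : lo <= z <= hi -> balance D p A M E B F (fun x => ka (x - z)).
  move=> zlh; apply: hbal.
    have := smooth_expr_comp 1 (- z) ska.
    by rewrite (_ : (fun x => _) = (fun x => ka (x - z)))//; apply/funext => x; rewrite mul1r.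
  have [a1 [b1 [a10 b1T h1]]] := hsupp n zlh; have [a2 [b2 [a20 b2T h2]]] := hsupp m zlh.
  exists (Num.min a1 a2), (Num.max b1 b2); split.
  - by rewrite lt_min a10.
  - by rewrite gt_max b1T.
  move=> x hx; rewrite /ka -!kapE h1 ?h2 ?mulr0 ?addr0//.
    by case: hx; [rewrite lt_min => /andP[_ ?]; left|rewrite gt_max => /andP[_ ?]; right].
  by case: hx; [rewrite lt_min => /andP[? _]; left|rewrite gt_max => /andP[? _]; right].
have [cf hI] := energy_kernel H hA hM LE LB LF ska ka0 hb (difE n m) (difB n m) (difF n m).
have := hI s t los st thi; rewrite !subE => ->.
rewrite Rint_itvE.
apply: le_trans (@le_norm_Rint _ _ _ leb _ (fun x => 2 * K * (dG n x + dG m x)) _ _ _) _.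
- apply: measurable_funM; first exact: itv_indic_meas.
  exact: continuous_measurable_fun.
- by apply: igZ; exact: igD.
- move=> x; rewrite !subE normrM.
  apply: (@le_trans _ _ `|p (G n x - G m x) (U n x - U m x)|).
    by rewrite ler_piMl// indicE; case: (_ \in _); rewrite ?normr1 ?normr0.
  apply: le_trans (sh_CS H _ _) _; try exact: (shDB H).
  rewrite mulrC; apply: ler_pM; rewrite ?hnorm_ge0//.
    apply: le_trans (hnormB H _ _) _ => //; have := bU n x; have := bU m x; lra.
  apply: le_trans (hnorm_tri H (w := F x) _ _ _) _ => //.
  by rewrite (hnormBC H (u := F x)).
rewrite RintZ; last exact: igD.
rewrite RintD// ler_wpM2l ?mulr_ge0//.
have [] := om_ge n; have [] := om_ge m; rewrite /om; lra.
Qed.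

(** The factor [2 / c] passes from energy to squared norms. In the bracket, [2 * K] is the energy
    change between two times, and the rest is the mean over [[lo, hi]] of the energy at the
    reference time. *)
Let Q : R := 2 / c * (2 * K + (`|CA| + `|CM|) * (2 * K) / (hi - lo)).

Let Q0 : 0 <= Q.
Proof.
have c1 : 0 <= 2 / c by rewrite divr_ge0// ltW.
rewrite /Q mulr_ge0// addr_ge0 ?mulr_ge0//.
by rewrite invr_ge0 subr_ge0 ltW.
Qed.

Let Q1 : 0 < Q + 1. Proof. by rewrite ltr_wpDl. Qed.

(** The energy of the difference at [t] exceeds that at any [x] by at most the error of
    [dif_balance]. No single [x] is known to be good, but the mean over [[lo, hi]] is bounded by L^1
    distances. *)
Lemma uniform_cauchy n m t : lo <= t <= hi ->
  hnorm (U n t - U m t) ^+ 2 + hnorm (W n t - W m t) ^+ 2 <= Q * (om n + om m).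
Proof.
move=> /andP[lot thi].
set e := en (U n t - U m t) (W n t - W m t).
pose g x := (`|CA| + `|CM|) * (2 * K) * ((dU n x + dU m x) + (dW n x + dW m x)).
have ig_g : ig leb g by apply: igZ; apply: igD; exact: igD.
(* One factor of the square is bounded by [2 * K]; the other is kept to the first power, so that
   convergence in L^1 is enough. *)
have sq_le (y z w : V) (a b : R) : D y -> D z -> D w -> hnorm y <= K -> hnorm z <= K ->
    hnorm (y - w) = a -> hnorm (z - w) = b -> hnorm (y - z) ^+ 2 <= 2 * K * (a + b).
  move=> Dy Dz Dw ly lz <- <-; rewrite expr2; apply: ler_pM; rewrite ?hnorm_ge0//.
    by apply: le_trans (hnormB H _ _) _ => //; move: ly lz; lra.
  by apply: le_trans (hnorm_tri H (w := w) _ _ _) _ => //; rewrite (hnormBC H (u := w)).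
have key x : lo <= x <= hi -> e - 2 * K * (om n + om m) <= g x.
  move=> /andP[lox xhi].
  have h1 : e - en (U n x - U m x) (W n x - W m x) <= 2 * K * (om n + om m).
    have [xt|tx] := leP x t.
      exact: le_trans (ler_norm _) (dif_balance n m lox xt thi).
    have := dif_balance n m lot (ltW tx) xhi; rewrite distrC.
    exact: le_trans (ler_norm _).
  have h2 : en (U n x - U m x) (W n x - W m x) <= g x.
    apply: le_trans (en_upper _ _) _; try exact: (shDB H).
    rewrite /g -mulrA ler_wpM2l ?addr_ge0// mulrDr lerD//.
      by apply: (sq_le _ _ (E x)).
    by apply: (sq_le _ _ (B x)).
  by move: h1 h2; lra.
have h1 : (e - 2 * K * (om n + om m)) * (hi - lo) <= \int[leb]_x g x.
  rewrite -(itv_indic_Rint (ltW lohi)) -RintZ; last exact: itv_indic_ig.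
  apply: le_Rint => //; first by apply: igZ; exact: itv_indic_ig.
  move=> x; rewrite indicE; have [xI|xI] := boolP (x \in _).
    by rewrite mulr1; apply: key; move/set_mem: xI; rewrite /= in_itv.
  rewrite mulr0 /g !mulr_ge0// !addr_ge0//; exact: hnorm_ge0.
have h2 : \int[leb]_x g x <= (`|CA| + `|CM|) * (2 * K) * (om n + om m).
  rewrite RintZ; last by apply: igD; exact: igD.
  rewrite RintD; [|exact: igD|exact: igD]; rewrite !RintD//.
  rewrite ler_wpM2l ?mulr_ge0 ?addr_ge0//.
  by have [] := om_ge n; have [] := om_ge m; rewrite /om; lra.
have hl : 0 < hi - lo by rewrite subr_gt0.
have h3 : e <= (2 * K + (`|CA| + `|CM|) * (2 * K) / (hi - lo)) * (om n + om m).
  have := le_trans h1 h2; rewrite -ler_pdivlMr// => h.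
  rewrite mulrDl -lerBlDl; apply: le_trans h _.
  by rewrite le_eqVlt; apply/orP; left; apply/eqP; field; rewrite gt_eqF.
have h4 := le_trans (en_lower (shDB H (DU n t) (DU m t)) (shDB H (DW n t) (DW m t))) h3.
set z := (X in X <= _); have -> : z = 2 / c * (c / 2 * z) by field; rewrite gt_eqF.
rewrite /Q -(mulrA (2 / c)); apply: ler_wpM2l => //.
by rewrite divr_ge0// ltW.
Qed.

Let dU_ae := moll_ae H rho_lip rho_ge0 rho_le rho_supp rho_int LE s0 sV0 hU.

(** Write [(G n, U n) - (F, E) = (G n - F, U n) + (F, U n - E)]. The first term is at most [K] times
    an L^1 error. In the second, [F] is only integrable, so convergence almost everywhere is used
    with the majorant [2 * K * hnorm (F x)]. *)
Lemma pGU_cvg s t :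
  \int[leb]_(x in `[s, t]) p (G n x) (U n x) @[n --> \oo] -->
  \int[leb]_(x in `[s, t]) p (F x) (E x).
Proof.
pose I x : R := \1_(`[s, t]%classic : set R) x.
have I1 x : `|I x| <= 1 by rewrite /I indicE; case: (_ \in _); rewrite ?normr1 ?normr0.
have mI : measurable_fun setT I := itv_indic_meas s t.
pose f n x := I x * p (F x) (U n x - E x).
have mFE : measurable_fun setT (fun x => p (F x) (E x)) := good_meas2 H LF.1 LE.1.
have cU n := moll_meas_lip H (DU n) (fun t t' => moll_lip H rho_lip rho_ge0 rho_le LE (s0 n) (hU n t) (hU n t')).
have cG n := moll_meas_lip H (DG n) (fun t t' => moll_lip H rho_lip rho_ge0 rho_le LF (s0 n) (hG n t) (hG n t')).
have mFU n : measurable_fun setT (fun x => p (F x) (U n x)).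
  rewrite (_ : (fun x => _) = (fun x => p (U n x) (F x))).
    apply: (good_pmeas H) => //; last exact: LF.1.
    by move=> d Dd; apply: continuous_measurable_fun; have [+ _] := cU n; apply.
  by apply/funext => x; rewrite (sh_C H).
have mf n : measurable_fun setT (f n).
  apply: measurable_funM => //.
  rewrite (_ : (fun x => _) = (fun x => p (F x) (U n x) - p (F x) (E x))).
    exact: measurable_funB.
  by apply/funext => x; rewrite (shpBr H).
have bf n x : `|f n x| <= 2 * K * hnorm (F x).
  rewrite /f normrM; apply: (@le_trans _ _ `|p (F x) (U n x - E x)|).
    by rewrite ler_piMl.
  apply: le_trans (sh_CS H _ _) _ => //; first exact: (shDB H).
  rewrite mulrC; apply: ler_wpM2r; first exact: hnorm_ge0.
  by apply: le_trans (hnormB H _ _) _ => //; have := bU n x; have := bE x; lra.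
have igf n : ig leb (f n).
  apply: (@ig_le _ _ _ leb _ _ (mf n) _ (bf n)); apply: igZ; exact: LF.2.
have f_cvg : \int[leb]_x f n x @[n --> \oo] --> (0 : R).
  rewrite -(@Rint0 _ _ _ leb).
  apply: (@Rint_dct _ _ _ leb f (fun=> 0) (fun x => 2 * K * hnorm (F x))) => //.
    by apply: igZ; exact: LF.2.
  apply: (ae_imp dU_ae) => x hx.
  apply: (@cvg0_le _ _ (fun n => hnorm (F x) * hnorm (U n x - E x) + 0 * hnorm (U n x - E x))).
    move=> n; rewrite mul0r addr0 /f normrM.
    apply: (@le_trans _ _ `|p (F x) (U n x - E x)|); first by rewrite ler_piMl.
    by apply: (sh_CS H) => //; exact: (shDB H).
  exact: cvg0_lin.
have igFE : ig leb (fun x => I x * p (F x) (E x)).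
  apply: (@ig_le _ _ _ leb (fun x => K * hnorm (F x))).
  - exact: measurable_funM.
  - by apply: igZ; exact: LF.2.
  move=> x; rewrite normrM; apply: (@le_trans _ _ `|p (F x) (E x)|).
    by rewrite ler_piMl.
  apply: le_trans (sh_CS H _ _) _ => //; rewrite mulrC.
  by apply: ler_wpM2r => //; exact: hnorm_ge0.
pose h n x := I x * p (G n x - F x) (U n x).
have mGU n : measurable_fun setT (fun x => I x * p (G n x) (U n x)).
  apply: measurable_funM => //; apply: continuous_measurable_fun.
  have lU := fun t t' => moll_lip H rho_lip rho_ge0 rho_le LE (s0 n) (hU n t) (hU n t').
  have lG := fun t t' => moll_lip H rho_lip rho_ge0 rho_le LF (s0 n) (hG n t) (hG n t').
  have bG x := isint_le_cst H LF (kmeas n x) (kbd n x) (hG n x).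
  set a1 := (X in forall t t', _ <= X * _) in lU.
  set a2 := (X in forall t t', _ <= X * _) in lG.
  set a3 := (X in forall x, _ <= X) in bG.
  apply: (@form_continuous _ _ _ _ H _ _ (`|a1| + `|a2| + `|a3| + K)) => //.
  - by move=> x; apply: le_trans (bU n x) _; rewrite lerDr !addr_ge0.
  - move=> x; apply: le_trans (bG x) _; have := ler_norm a3.
    have := normr_ge0 a1; have := normr_ge0 a2; move: K0; lra.
  - move=> x y; apply: le_trans (lU x y) _; rewrite ler_wpM2r//.
    have := ler_norm a1; have := normr_ge0 a2; have := normr_ge0 a3; move: K0; lra.
  - move=> x y; apply: le_trans (lG x y) _; rewrite ler_wpM2r//.
    have := ler_norm a2; have := normr_ge0 a1; have := normr_ge0 a3; move: K0; lra.
have hE n x : h n x = I x * p (G n x) (U n x) - (f n x + I x * p (F x) (E x)).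
  by rewrite /h /f (shpBl H)// (shpBr H)//; ring.
have mh n : measurable_fun setT (h n).
  rewrite (_ : h n = fun x => I x * p (G n x) (U n x) - (f n x + I x * p (F x) (E x))).
    apply: measurable_funB => //; apply: measurable_funD => //.
    exact: ig_meas igFE.
  by apply/funext => x; exact: hE.
have bh n x : `|h n x| <= K * dG n x.
  rewrite /h normrM; apply: (@le_trans _ _ `|p (G n x - F x) (U n x)|).
    by rewrite ler_piMl.
  apply: le_trans (sh_CS H _ _) _ => //; first exact: (shDB H).
  by rewrite mulrC; apply: ler_wpM2r => //; exact: hnorm_ge0.
have igh n : ig leb (h n) by apply: (@ig_le _ _ _ leb _ _ (mh n) _ (bh n)); exact: igZ.
have h_cvg : \int[leb]_x h n x @[n --> \oo] --> (0 : R).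
  apply: (@cvg0_le _ _ (fun n => K * \int[leb]_x dG n x + 0 * \int[leb]_x dG n x)).
    move=> n; rewrite mul0r addr0 -RintZ//; apply: (@le_norm_Rint _ _ _ leb) => //.
      exact: mh.
    exact: igZ.
  exact: cvg0_lin.
apply: (@cvg_ext _ _ _ (fun n => \int[leb]_x h n x + \int[leb]_x f n x +
  \int[leb]_x (I x * p (F x) (E x))) (0 + 0 + \int[leb]_x (I x * p (F x) (E x)))).
- by apply: cvgD; [exact: cvgD|exact: cvg_cst].
- move=> n; rewrite Rint_itvE -RintD// -RintD//; last exact: igD.
  by apply: eq_Rintegral => x _; rewrite hE /I; ring.
- by rewrite Rint_itvE !add0r.
Qed.

Lemma limit_exists (Y : nat -> R -> V) :
  (forall n t, D (Y n t)) ->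
  (forall n m t, lo <= t <= hi -> hnorm (Y n t - Y m t) ^+ 2 <= Q * (om n + om m)) ->
  exists y : R -> V, (forall t, D (y t)) /\
   forall t, lo <= t <= hi -> hnorm (Y n t - y t) @[n --> \oo] --> (0 : R) /\
     forall n, hnorm (Y n t - y t) ^+ 2 <= Q * om n.
Proof.
move=> DY hY.
have /choice[y hy] : forall t, exists y, D y /\
    (lo <= t <= hi -> hnorm (Y n t - y) @[n --> \oo] --> (0 : R)).
  move=> t; have [tI|tI] := boolP (lo <= t <= hi); last first.
    (* Outside [[lo, hi]] the value is arbitrary; [0] keeps the curve in [D]. *)
    by exists 0; split => //; exact: (sh_D0 H).
  have [|y [Dy hy]] := sh_complete H (fun n => DY n t); last by exists y.
  move=> e e0.
  have e1 : 0 < e ^+ 2 / (2 * (Q + 1)) by apply: divr_gt0; [exact: exprn_gt0|apply: mulr_gt0 => //; exact: Q1].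
  have [N hN] := (cvg0P _).1 om_cvg _ e1.
  exists N => n m Nn Nm; rewrite -/(hnorm _).
  rewrite -(ler_pXn2r (n := 2))// ?nnegrE ?hnorm_ge0 ?(ltW e0)//.
  apply: le_trans (hY n m t tI) _.
  have h1 := ltr_normlW (hN n Nn); have h2 := ltr_normlW (hN m Nm).
  have o0 : 0 <= om n + om m by have [] := om_ge n; have [] := om_ge m; rewrite /om; lra.
  apply: (@le_trans _ _ ((Q + 1) * (om n + om m))); first by rewrite ler_wpM2r ?lerDl.
  rewrite mulrC -ler_pdivlMr//.
  have -> : e ^+ 2 / (Q + 1) = e ^+ 2 / (2 * (Q + 1)) + e ^+ 2 / (2 * (Q + 1)).
    by field; rewrite gt_eqF.
  by apply: lerD; exact: ltW.
exists y; split=> [t|t tI]; first by case: (hy t).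
have [Dy /(_ tI) hyt] := hy t; split => // n.
(* Letting [m] tend to infinity in the Cauchy estimate keeps a bound that does not depend on [t];
   continuity of the limit rests on it. *)
have hlim : p (Y n t - Y m t) (Y n t - Y m t) @[m --> \oo] -->
    p (Y n t - y t) (Y n t - y t).
  have h m : hnorm (Y n t - Y m t - (Y n t - y t)) = hnorm (Y m t - y t).
    by rewrite opprB addrC addrA subrK (hnormBC H).
  have h' : hnorm (Y n t - Y m t - (Y n t - y t)) @[m --> \oo] --> (0 : R).
    by apply: (cvg_ext hyt).
  by apply: (sh_cvg_pp H) => //; [move=> m| move=> m|..]; exact: (shDB H).
have hb : Q * (om n + om m) @[m --> \oo] --> Q * (om n + 0).
  apply: cvgM; first exact: cvg_cst.
  by apply: cvgD; [exact: cvg_cst|exact: om_cvg].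
rewrite addr0 in hb; rewrite (hnorm_sqr H); last exact: (shDB H).
apply: (ler_cvg_to hlim hb); apply: nearW => m.
by rewrite -(hnorm_sqr H) ?hY//; exact: (shDB H).
Qed.

(** A uniform limit of Lipschitz curves; the Lipschitz constants [l n] may blow up, since only one
    index is used for each [e]. *)
Lemma limit_continuous (Y : nat -> R -> V) (y : R -> V) (l : nat -> R) :
  (forall n t, D (Y n t)) -> (forall t, D (y t)) ->
  (forall n t t', hnorm (Y n t - Y n t') <= l n * `|t - t'|) ->
  (forall t, lo <= t <= hi -> forall n, hnorm (Y n t - y t) ^+ 2 <= Q * om n) ->
  forall t e, lo <= t <= hi -> 0 < e -> exists d, 0 < d /\
    forall s, lo <= s <= hi -> `|s - t| < d -> hnorm (y s - y t) < e.
Proof.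
move=> DY Dy lY hY t e tI e0.
have e1 : 0 < (e / 3) ^+ 2 / (Q + 1) by apply: divr_gt0 => //; apply: exprn_gt0; exact: divr_gt0.
have [N hN] := (cvg0P _).1 om_cvg _ e1.
have h1 := ltr_normlW (hN N (leqnn _)).
have close s : lo <= s <= hi -> hnorm (Y N s - y s) < e / 3.
  move=> sI; rewrite -(ltr_pXn2r (n := 2))// ?nnegrE ?hnorm_ge0 ?divr_ge0 ?(ltW e0)//.
  apply: le_lt_trans (hY s sI N) _.
  have o0 : 0 <= om N by have [] := om_ge N; rewrite /om; lra.
  apply: (@le_lt_trans _ _ ((Q + 1) * om N)); first by rewrite ler_wpM2r ?lerDl.
  by rewrite mulrC -ltr_pdivlMr ?ltr_wpDl.
exists (e / 3 / (`|l N| + 1)); split; first by rewrite !divr_gt0// ltr_wpDl.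
move=> s sI sd; rewrite ltr_pdivlMr ?ltr_wpDl// in sd.
have h2 : hnorm (Y N s - Y N t) < e / 3.
  apply: le_lt_trans (lY N s t) _; apply: le_lt_trans sd; rewrite mulrC ler_wpM2l//.
  by rewrite (le_trans (ler_norm _))// lerDl.
apply: le_lt_trans (hnorm_tri H (w := Y N s) _ _ _) _ => //.
have := hnorm_tri H (DY N s) (Dy t) (DY N t).
rewrite (hnormBC H (u := y s))//; have := close s sI; have := close t tI; lra.
Qed.

End Approximants.

(** The right-hand side keeps the given [F] and [E]: these are the limits that the mollifications
    have in L^1, while [E'] is their uniform limit and agrees with [E] only almost everywhere. *)
Lemma local_solution : exists E' B' : R -> V,
  [/\ forall t, D (E' t) /\ D (B' t),
   forall t e, lo <= t <= hi -> 0 < e -> exists d, 0 < d /\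
    forall s, lo <= s <= hi -> `|s - t| < d ->
      hnorm (E' s - E' t) < e /\ hnorm (B' s - B' t) < e,
   {ae leb, forall t, lo <= t <= hi -> hnorm (E' t - E t) = 0 /\ hnorm (B' t - B t) = 0} &
   forall s t, lo <= s -> s <= t -> t <= hi ->
     en (E' t) (B' t) - en (E' s) (B' s) = \int[leb]_(x in `[s, t]) p (F x) (E x)].
Proof.
have [U hU] := rep LE; have [W hW] := rep LB; have [G hG] := rep LF.
have DU n t : D (U n t) := (hU n t).1; have DW n t : D (W n t) := (hW n t).1.
have DE t : D (E t) := good_D H LE.1 t; have DB t : D (B t) := good_D H LB.1 t.
have uc := uniform_cauchy hU hW hG.
have ucU n m t tI := le_trans (ler_wpDr (sqr_ge0 _) (lexx _)) (uc n m t tI).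
have ucW n m t tI := le_trans (ler_wpDl (sqr_ge0 _) (lexx _)) (uc n m t tI).
have [E' [DE' hE']] := limit_exists hU hW hG DU ucU.
have [B' [DB' hB']] := limit_exists hU hW hG DW ucW.
exists E', B'; split => //.
- move=> t e tI e0.
  have [d1 [d10 h1]] := limit_continuous hU hW hG DU DE'
    (fun n t t' => moll_lip H rho_lip rho_ge0 rho_le LE (s0 n) (hU n t) (hU n t'))
    (fun t tI => (hE' t tI).2) tI e0.
  have [d2 [d20 h2]] := limit_continuous hU hW hG DW DB'
    (fun n t t' => moll_lip H rho_lip rho_ge0 rho_le LB (s0 n) (hW n t) (hW n t'))
    (fun t tI => (hB' t tI).2) tI e0.
  exists (Num.min d1 d2); split; first by rewrite lt_min d10.
  by move=> s sI; rewrite lt_min => /andP[sd1 sd2]; split; [exact: h1|exact: h2].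
- apply: (ae_imp2 (moll_ae H rho_lip rho_ge0 rho_le rho_supp rho_int LE s0 sV0 hU)
    (moll_ae H rho_lip rho_ge0 rho_le rho_supp rho_int LB s0 sV0 hW)) => t hE hB tI.
  have [cE _] := hE' t tI; have [cB _] := hB' t tI; split.
    exact: (sh_lim_uniq H (s := fun n => U n t)).
  exact: (sh_lim_uniq H (s := fun n => W n t)).
- move=> s t los st thi.
  have tI : lo <= t <= hi by rewrite thi (le_trans los).
  have sI : lo <= s <= hi by rewrite los (le_trans st).
  have enc x : lo <= x <= hi -> en (U n x) (W n x) @[n --> \oo] --> en (E' x) (B' x).
    move=> xI; have [cE _] := hE' x xI; have [cB _] := hB' x xI.
    have opc (O : V -> V) C (hO : bounded_symmetric D p O C) (Y : nat -> V) y :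
        (forall n, D (Y n)) -> D y -> hnorm (Y n - y) @[n --> \oo] --> (0 : R) ->
        p (O (Y n)) (Y n) @[n --> \oo] --> p (O y) y.
      move=> DY Dy Yy; apply: (sh_cvg_pp H) => //.
      - by move=> n; exact: (bs_D hO).
      - exact: (bs_D hO).
      apply: (@cvg0_le _ _ (fun n => C * hnorm (Y n - y) + 0 * hnorm (Y n - y))).
        move=> n; rewrite mul0r addr0 -(bs_sub hO) ger0_norm ?hnorm_ge0//.
        by apply: (bs_bound hO); exact: (shDB H).
      exact: cvg0_lin.
    apply: cvgM; first exact: cvg_cst.
    by apply: cvgD; [exact: (opc _ _ hA)|exact: (opc _ _ hM)].
  have l1 := pGU_cvg hU hG (s := s) (t := t).
  have l2 : en (U n t) (W n t) - en (U n s) (W n s) @[n --> \oo] -->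
      en (E' t) (B' t) - en (E' s) (B' s).
    by apply: cvgB; exact: enc.
  suff E1 n : en (U n t) (W n t) - en (U n s) (W n s) =
      \int[leb]_(x in `[s, t]) p (G n x) (U n x).
    have l3 : en (U n t) (W n t) - en (U n s) (W n s) @[n --> \oo] -->
        \int[leb]_(x in `[s, t]) p (F x) (E x) by exact: (cvg_ext l1 E1).
    exact: (cvg_unique _ l2 l3).
  have hb z : lo <= z <= hi -> balance D p A M E B F (fun x => kap n (x - z)).
    move=> zI; apply: hbal; last exact: hsupp.
    have := smooth_expr_comp 1 (- z) (kap_smooth n).
    by rewrite (_ : (fun x => _) = (fun x => kap n (x - z)))//; apply/funext => x; rewrite mul1r.
  have [_ hI] := energy_kernel H hA hM LE LB LF (kap_smooth n) (@kap_out n) hb (hU n) (hW n) (hG n).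
  exact: hI.
Qed.

End LocalSolution.


(** * Choice of the mollifier and gluing of two time intervals *)

Section GlobalSolution.
Variable R : realType.
Local Notation leb := (@lebesgue_measure R).

(** The support lies in [[1, 2]], away from the origin: centred at time [0], a rescaled kernel
    starts at a strictly positive time, as the margin in [supported] demands. *)
Lemma mollifier_exists : exists (rho : R -> R) (C : R),
  [/\ smooth_expr rho, forall x y, `|rho x - rho y| <= C * `|x - y|,
     forall x, 0 <= rho x <= C, forall x, x <= 1 \/ 2 <= x -> rho x = 0 &
     (\int[leb]_x (rho x)%:E = 1)%E].
Proof.
pose b (x : R) := bump 0 (1 * x - 1).
have sb : smooth_expr b by exact: smooth_expr_comp (smooth_bump R 0).
have b0 x : x <= 1 \/ 2 <= x -> b x = 0.
  by rewrite /b mul1r => h; apply: bump_out; case: h => h; [left|right]; lra.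
have b_ge0 x : 0 <= b x by exact: bump_ge0.
have mb : measurable_fun setT b by apply: continuous_measurable_fun; exact: smooth_expr_cont.
have igb : ig leb b.
  apply: (@ig_le _ _ _ leb _ _ mb (itv_indic_ig 1 2)) => x.
  rewrite ger0_norm// indicE; have [xI|xI] := boolP (x \in _); first exact: bump_le1.
  rewrite b0//; move: xI; rewrite notin_setE /= in_itv/= => /negP.
  by rewrite negb_and -!ltNge => /orP[h|h]; [left|right]; exact: ltW.
pose m := \int[leb]_x b x.
have m0 : 0 < m.
  (* On [[5/4, 7/4]] both flat factors of the bump have argument at least 1/4, hence are at least
     [expR (- 4)]; the interval has length 1/2. *)
  have e0 : 0 < (expR (- 4)) ^+ 2 * 2^-1 :> R.
    by rewrite mulr_gt0// exprn_gt0// expR_gt0.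
  apply: lt_le_trans e0 _.
  have -> : 2^-1 = \int[leb]_x \1_(`[5 / 4, 7 / 4]%classic : set R) x :> R.
    by rewrite itv_indic_Rint; [field|lra].
  rewrite -RintZ; last exact: itv_indic_ig.
  apply: le_Rint => //; first by apply: igZ; exact: itv_indic_ig.
  move=> x; rewrite indicE; have [/set_mem|_] := boolP (x \in _); last by rewrite mulr0.
  rewrite /= in_itv/= mulr1 => /andP[x1 x2]; rewrite /b /bump !mul1r expr2.
  have h y : 4^-1 <= y -> expR (- 4) <= flat 1 y.
    move=> y4; have y0 : 0 < y by apply: lt_le_trans y4; rewrite invr_gt0.
    by rewrite flat1E// ler_expR lerN2 -(invrK 4) lef_pV2 ?posrE ?invr_gt0.
  by apply: ler_pM; rewrite ?expR_ge0//; apply: h; lra.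
have [C [C0 bC _ bL _]] := smooth_expr_kernel_bounds sb
  (fun x (h : x < 1 \/ 2 < x) => b0 x (match h with or_introl h => or_introl (ltW h)
    | or_intror h => or_intror (ltW h) end)).
have mi0 : 0 <= m^-1 by rewrite invr_ge0 ltW.
exists (fun x => m^-1 * b x), (m^-1 * C); split.
- exact: smooth_scale.
- by move=> x y; rewrite -mulrBr normrM ger0_norm// -mulrA ler_wpM2l.
- move=> x; rewrite mulr_ge0//= ler_wpM2l//.
  by apply: le_trans (bC x); exact: ler_norm.
- by move=> x h; rewrite b0 ?mulr0.
- rewrite -EFin_Rint; last exact: igZ.
  by rewrite RintZ// mulVf// gt_eqF.
Qed.

Variables (V : lmodType R) (D : set V) (p : V -> V -> R).
Hypothesis H : semihilbert D p.
Local Notation hnorm := (hnorm p).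
Variables (A M : V -> V) (CA CM c : R).
Hypothesis hA : bounded_symmetric D p A CA.
Hypothesis hM : bounded_symmetric D p M CM.
Hypothesis c0 : 0 < c.
Hypothesis cA : forall u, D u -> c * p u u <= p (A u) u.
Hypothesis cM : forall u, D u -> c * p u u <= p (M u) u.
Variables (E B F : R -> V) (LE : L1 D p E) (LB : L1 D p B) (LF : L1 D p F) (K : R).
Hypothesis bE : forall t, hnorm (E t) <= K.
Hypothesis bB : forall t, hnorm (B t) <= K.
Variable (T : R).
Hypothesis T0 : 0 < T.
Hypothesis hbal : forall eta, smooth_expr eta -> supported T eta ->
  balance D p A M E B F eta.

(** Since 2/7 < 1/3, kernels reach less than [T / 3] from their centre. Forward kernels centred in
    [[0, 2T/3]] thus end before [T], and backward ones centred in [[T/3, T]] start after [0]. *)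
Let sq n : R := (7 / T) * n.+1%:R.

Let sq0 n : 0 < sq n. Proof. by rewrite mulr_gt0// divr_gt0. Qed.

Let sqV n : 2 / sq n < T / 3 /\ 0 < 1 / sq n.
Proof.
split; last by rewrite divr_gt0.
rewrite ltr_pdivrMr// /sq mulrA.
have -> : T / 3 * (7 / T) = 7 / 3 by field; rewrite gt_eqF.
have : 1 <= n.+1%:R :> R by rewrite ler1n.
lra.
Qed.

Let sqV0 : (sq n)^-1 @[n --> \oo] --> (0 : R).
Proof.
apply: (@cvg_ext _ _ _ (fun n => (7 / T)^-1 * n.+1%:R^-1) ((7 / T)^-1 * 0)).
- by apply: cvgM; [exact: cvg_cst|exact: invS_cvg0].
- by move=> n; rewrite /sq invfM.
- by rewrite mulr0.
Qed.

Definition is_solution lo hi (E' B' : R -> V) :=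
  [/\ forall t, D (E' t) /\ D (B' t),
   forall t e, lo <= t <= hi -> 0 < e -> exists d, 0 < d /\
    forall s, lo <= s <= hi -> `|s - t| < d ->
      hnorm (E' s - E' t) < e /\ hnorm (B' s - B' t) < e,
   {ae leb, forall t, lo <= t <= hi -> hnorm (E' t - E t) = 0 /\ hnorm (B' t - B t) = 0} &
   forall s t, lo <= s -> s <= t -> t <= hi ->
     energy_form p A M (E' t) (B' t) - energy_form p A M (E' s) (B' s) =
     \int[leb]_(x in `[s, t]) p (F x) (E x)].

(* A kernel supported in (0, +oo) only sees the future, one supported in
   (-oo, 0) only the past; they settle the initial and the final times. *)
Let forward : exists E' B', is_solution 0 (2 * T / 3) E' B'.
Proof.
have [rho [C [rs rl rb ro ri]]] := mollifier_exists.
apply: (local_solution H rs rl (fun x => (andP (rb x)).1) (fun x => (andP (rb x)).2)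
  _ ri sq0 sqV0 hA hM c0 cA cM LE LB LF bE bB _ (T := T)) => //.
- move=> x; rewrite ler_normr => /orP[h|h]; apply: ro; first by right.
  by left; move: h; lra.
- by rewrite divr_gt0// mulr_gt0.
- move=> n t /andP[t0 tT]; have [h1 h2] := sqV n.
  exists (t + 1 / sq n), (t + 2 / sq n); split.
  + by rewrite ltr_wpDl.
  + by move: h1 tT; lra.
  move=> x h; rewrite /ker ro ?mulr0//.
  case: h => h; [left|right]; move: h.
    by rewrite -ltrBlDl ltr_pdivlMr// mulrC => /ltW.
  by rewrite -ltrBrDl ltr_pdivrMr// mulrC => /ltW.
Qed.

Let backward : exists E' B', is_solution (T / 3) T E' B'.
Proof.
have [rho [C [rs rl rb ro ri]]] := mollifier_exists.
have crho : continuous rho by exact: smooth_expr_cont.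
have rsN : smooth_expr (fun x => rho (- x)).
  have := smooth_expr_comp (-1) 0 rs.
  by rewrite (_ : (fun x => _) = (fun x => rho (- x)))//; apply/funext => x; rewrite mulN1r addr0.
have rlN x y : `|rho (- x) - rho (- y)| <= C * `|x - y|.
  by rewrite (_ : x - y = - (- x - - y)) ?normrN//; ring.
have riN : (\int[leb]_x (rho (- x))%:E = 1)%E.
  by rewrite integral_oppr// => x; have /andP[] := rb x.
apply: (local_solution H rsN rlN (fun x => (andP (rb (- x))).1) (fun x => (andP (rb (- x))).2)
  _ riN sq0 sqV0 hA hM c0 cA cM LE LB LF bE bB _ (T := T)) => //.
- move=> x; rewrite ler_normr => /orP[h|h]; apply: ro; last by right.
  by left; move: h; lra.
- by move: T0; lra.
- move=> n t /andP[t0 tT]; have [h1 h2] := sqV n.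
  exists (t - 2 / sq n), (t - 1 / sq n); split.
  + by move: h1 t0; lra.
  + by move: h2 tT; lra.
  move=> x h; rewrite /ker ro ?mulr0//.
  rewrite -mulrN opprB.
  case: h => h; [right|left]; move: h.
    by rewrite ltrBrDl -ltrBrDr ltr_pdivrMr// mulrC => /ltW.
  by rewrite ltrBlDl -ltrBlDr ltr_pdivlMr// mulrC => /ltW.
Qed.

(** The two local curves agree up to norm zero on the middle third, so switching from one to the
    other at [T / 2] keeps continuity, and an energy identity across the switch is the sum of
    two. *)
Lemma global_solution : exists E' B', is_solution 0 T E' B'.
Proof.
have [Ef [Bf [Df cf af ef]]] := forward.
have [Eb [Bb [Db cb ab eb]]] := backward.
have DE t : D (E t) := good_D H LE.1 t; have DB t : D (B t) := good_D H LB.1 t.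
have agree t : T / 3 <= t <= 2 * T / 3 ->
    hnorm (Ef t - Eb t) = 0 /\ hnorm (Bf t - Bb t) = 0.
  move=> /andP[t1 t2].
  suff key e : 0 < e -> hnorm (Ef t - Eb t) <= 0 + e /\ hnorm (Bf t - Bb t) <= 0 + e.
    split; apply/eqP; rewrite eq_le hnorm_ge0 andbT; apply/ler_addgt0Pr => e e0;
      by have [] := key e e0.
  move=> e0; have e2 : 0 < e / 2 by rewrite divr_gt0.
  have tf : 0 <= t <= 2 * T / 3 by move: T0 t1 t2; lra.
  have tb : T / 3 <= t <= T by move: T0 t1 t2; lra.
  have [d1 [d10 h1]] := cf t _ tf e2; have [d2 [d20 h2]] := cb t _ tb e2.
  pose lo := Num.max (T / 3) (t - Num.min d1 d2).
  pose hi := Num.min (2 * T / 3) (t + Num.min d1 d2).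
  have dm : 0 < Num.min d1 d2 by rewrite lt_min d10.
  have lh : lo < hi.
    rewrite /lo /hi gt_max !lt_min; apply/andP; split; apply/andP; split; move: T0 t1 t2 dm; lra.
  (* A nonempty open interval is not a null set, so near [t] there is a time at which both curves
     coincide with the given fields; continuity transports this to [t]. *)
  have [s [sI [sf sb]]] : exists s, `]lo, hi[%classic s /\
     ((0 <= s <= 2 * T / 3 -> hnorm (Ef s - E s) = 0 /\ hnorm (Bf s - B s) = 0) /\
      (T / 3 <= s <= T -> hnorm (Eb s - E s) = 0 /\ hnorm (Bb s - B s) = 0)).
    apply: contrapT => /forallNP hs.
    have [N [mN N0 hN]] : {ae leb, forall s : R, (0 <= s <= 2 * T / 3 ->
      hnorm (Ef s - E s) = 0 /\ hnorm (Bf s - B s) = 0) /\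
      (T / 3 <= s <= T -> hnorm (Eb s - E s) = 0 /\ hnorm (Bb s - B s) = 0)}.
      by apply: (ae_imp2 af ab) => s h3 h4; split.
    have sub : `]lo, hi[%classic `<=` N.
      by move=> s sI; apply: hN => /= h; apply: (hs s).
    have h : (leb `]lo, hi[%classic <= leb N)%E.
      by apply: (@le_measure _ _ _ leb) => //; rewrite inE//; exact: measurable_itv.
    have E1 : leb `]lo, hi[%classic = (hi - lo)%:E.
      by rewrite lebesgue_measure_itv/= lte_fin lh.
    have N1 : leb N = 0%E := N0.
    by move: h; rewrite E1 N1 lee_fin subr_le0 leNgt lh.
  move: sI; rewrite /= in_itv/= /lo /hi gt_max lt_min => /andP[/andP[s1 s2] /andP[s3 s4]].
  have sd : `|s - t| < Num.min d1 d2 by rewrite ltr_norml; apply/andP; split; move: s2 s4; lra.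
  move: (sd); rewrite lt_min => /andP[sd1 sd2].
  have sfI : 0 <= s <= 2 * T / 3 by move: T0 s1 s3; lra.
  have sbI : T / 3 <= s <= T by move: T0 s1 s3; lra.
  have [e1 b1] := h1 s sfI sd1; have [e3 b3] := h2 s sbI sd2.
  have [z1 z2] := sf sfI; have [z3 z4] := sb sbI.
  have tri (x y v w z : V) : D x -> D y -> D v -> D w -> D z ->
     hnorm (v - x) < e / 2 -> hnorm (w - y) < e / 2 -> hnorm (v - z) = 0 ->
     hnorm (w - z) = 0 -> hnorm (x - y) <= 0 + e.
    move=> Dx Dy Dv Dw Dz g1 g2 g3 g4.
    have := hnorm_tri H Dx Dy Dv; have := hnorm_tri H Dv Dy Dz; have := hnorm_tri H Dz Dy Dw.
    by rewrite (hnormBC H Dx Dv) (hnormBC H Dz Dw); move: g1 g2 g3 g4; lra.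
  have [DEft DBft] := Df t; have [DEfs DBfs] := Df s.
  have [DEbt DBbt] := Db t; have [DEbs DBbs] := Db s.
  by split; [exact: (tri _ _ (Ef s) (Eb s) (E s))|exact: (tri _ _ (Bf s) (Bb s) (B s))].
pose E' t := if t <= T / 2 then Ef t else Eb t.
pose B' t := if t <= T / 2 then Bf t else Bb t.
have D' t : D (E' t) /\ D (B' t) by rewrite /E' /B'; case: ifP.
have eqf t : 0 <= t <= 2 * T / 3 -> hnorm (E' t - Ef t) = 0 /\ hnorm (B' t - Bf t) = 0.
  move=> /andP[t1 t2]; rewrite /E' /B'; case: ifPn => th.
    by rewrite !subrr (hnorm0 H).
  have [] := agree t; first by rewrite t2 andbT; move: th; rewrite -ltNge; move: T0; lra.
  have [DEft DBft] := Df t; have [DEbt DBbt] := Db t.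
  by rewrite (hnormBC H DEft DEbt) (hnormBC H DBft DBbt).
have eqb t : T / 3 <= t <= T -> hnorm (E' t - Eb t) = 0 /\ hnorm (B' t - Bb t) = 0.
  move=> /andP[t1 t2]; rewrite /E' /B'; case: ifPn => th; last by rewrite !subrr (hnorm0 H).
  by have [] := agree t; first by rewrite t1/=; move: th T0; lra.
(* The energy depends only on classes modulo norm zero, because a bounded form kills differences of
   norm zero. *)
have energy_eq (x y z w : V) : D x -> D y -> D z -> D w -> hnorm (x - y) = 0 ->
    hnorm (z - w) = 0 -> energy_form p A M x z = energy_form p A M y w.
  move=> Dx Dy Dz Dw xy zw; rewrite /energy_form; congr (_ * (_ + _)).
    rewrite (quad_expand H hA Dy Dx).
    have := bs_form H hA (shDB H Dx Dy) Dy; have := bs_form H hA (shDB H Dx Dy) (shDB H Dx Dy).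
    rewrite xy !(mulr0, mul0r) !normr_le0 => /eqP -> /eqP ->.
    by rewrite mulr0 !addr0.
  rewrite (quad_expand H hM Dw Dz).
  have := bs_form H hM (shDB H Dz Dw) Dw; have := bs_form H hM (shDB H Dz Dw) (shDB H Dz Dw).
  rewrite zw !(mulr0, mul0r) !normr_le0 => /eqP -> /eqP ->.
  by rewrite mulr0 !addr0.
have zero_tri (x y v w : V) e : D x -> D y -> D v -> D w -> hnorm (x - v) = 0 ->
    hnorm (y - w) = 0 -> hnorm (v - w) < e -> hnorm (x - y) < e.
  move=> Dx Dy Dv Dw h1 h2 h3.
  have := hnorm_tri H Dx Dy Dv; have := hnorm_tri H Dv Dy Dw.
  by rewrite (hnormBC H Dw Dy) h1 h2; move: h3; lra.
exists E', B'; split => //.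
- move=> t e tI e0.
  have [DEft DBft] := Df t; have [DEbt DBbt] := Db t; have [DEt DBt] := D' t.
  have [th|th] := leP t (T / 2).
    have tf : 0 <= t <= 2 * T / 3 by move: tI th T0; lra.
    have [d [d0 hd]] := cf t e tf e0.
    (* [T / 6] is the distance from [T / 2] to [2 * T / 3] and to [T / 3]: nearby times stay where
       the chosen local curve is valid. *)
    exists (Num.min d (T / 6)); split; first by rewrite lt_min d0 divr_gt0.
    move=> s sI; rewrite lt_min => /andP[sd sT].
    have sf : 0 <= s <= 2 * T / 3.
      move: sT; rewrite ltr_norml => /andP[_]; move: sI th T0; lra.
    have [DEfs DBfs] := Df s; have [DEs DBs] := D' s.
    have [h1 h2] := hd s sf sd; have [z1 z2] := eqf s sf; have [z3 z4] := eqf t tf.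
    by split; [exact: zero_tri z1 z3 h1|exact: zero_tri z2 z4 h2].
  have tb : T / 3 <= t <= T by move: tI th T0; lra.
  have [d [d0 hd]] := cb t e tb e0.
  exists (Num.min d (T / 6)); split; first by rewrite lt_min d0 divr_gt0.
  move=> s sI; rewrite lt_min => /andP[sd sT].
  have sb : T / 3 <= s <= T.
    move: sT; rewrite ltr_norml => /andP[+ _]; move: sI th T0; lra.
  have [DEbs DBbs] := Db s; have [DEs DBs] := D' s.
  have [h1 h2] := hd s sb sd; have [z1 z2] := eqb s sb; have [z3 z4] := eqb t tb.
  by split; [exact: zero_tri z1 z3 h1|exact: zero_tri z2 z4 h2].
- apply: (ae_imp2 af ab) => t hf hb tI; rewrite /E' /B'; case: ifPn => th.
    by apply: hf; move: tI th T0; lra.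
  by apply: hb; move: tI th T0; rewrite -ltNge; lra.
- have step lo hi (Eg Bg : R -> V) s t : (forall t, D (Eg t) /\ D (Bg t)) ->
      (forall s t, lo <= s -> s <= t -> t <= hi ->
        energy_form p A M (Eg t) (Bg t) - energy_form p A M (Eg s) (Bg s) =
        \int[leb]_(x in `[s, t]) p (F x) (E x)) ->
      (forall t, lo <= t <= hi -> hnorm (E' t - Eg t) = 0 /\ hnorm (B' t - Bg t) = 0) ->
      lo <= s -> s <= t -> t <= hi ->
      energy_form p A M (E' t) (B' t) - energy_form p A M (E' s) (B' s) =
        \int[leb]_(x in `[s, t]) p (F x) (E x).
    move=> Dg eg qg los st thi; rewrite -eg//.
    have tI : lo <= t <= hi by rewrite thi (le_trans los).
    have sI : lo <= s <= hi by rewrite los (le_trans st).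
    have [d1 d2] := D' t; have [d3 d4] := D' s; have [d5 d6] := Dg t; have [d7 d8] := Dg s.
    have [qt1 qt2] := qg t tI; have [qs1 qs2] := qg s sI.
    by congr (_ - _); exact: energy_eq.
  move=> s t s0 st tT.
  have [th|th] := leP t (2 * T / 3); first exact: (step _ _ _ _ s t Df ef eqf).
  have [sh|sh] := leP (T / 3) s; first exact: (step _ _ _ _ s t Db eb eqb).
  have m1 : s <= T / 2 by move: sh T0; lra.
  have m2 : T / 2 <= t by move: th T0; lra.
  have h1 := step _ _ _ _ s (T / 2) Df ef eqf s0 m1 (ltac:(by move: T0; lra)).
  have h2 := step _ _ _ _ (T / 2) t Db eb eqb (ltac:(by move: T0; lra)) m2 tT.
  have igFE : ig leb (fun x => p (F x) (E x)).
    apply: (@ig_le _ _ _ leb (fun x => K * hnorm (F x))).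
    - exact: (good_meas2 H LF.1 LE.1).
    - by apply: igZ; exact: LF.2.
    move=> x; apply: le_trans (sh_CS H _ _) _ => //; first exact: (good_D H LF.1).
    by rewrite mulrC; apply: ler_wpM2r => //; exact: hnorm_ge0.
  have iI (a b : R) : leb.-integrable `[a, b]%classic (EFin \o (fun x => p (F x) (E x))).
    by apply: integrableS igFE => //; exact: measurable_itv.
  have := @Rintegral_itvB R _ (BLeft s) (BRight t) (T / 2) (iI s t) _ _.
  rewrite !bnd_simp => /(_ m1 m2).
  have -> : \int[leb]_(x in [set` Interval (BRight (T / 2)) (BRight t)]) p (F x) (E x) =
     \int[leb]_(x in `[T / 2, t]) p (F x) (E x).
    apply: (@Rintegral_itv_obnd_cbnd R); apply: integrableS (iI (T / 2) t) => //.
    by apply: subset_itv; rewrite bnd_simp.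
  move: h1 h2; lra.
Qed.

End GlobalSolution.


(** * The space of square-integrable fields *)

Section SquareIntegrable.
Context d (T : measurableType d) (R : realType) (mu : {measure set T -> \bar R}).
Implicit Types (f g : T -> R).

Definition l2 f := measurable_fun setT f /\ ig mu (fun x => f x ^+ 2).

Lemma Lfun2P f : f \in Lfun mu 2%:E <-> l2 f.
Proof.
have E : measurable_fun setT f ->
    (\int[mu]_x (`|(f x)%:E| `^ 2) = \int[mu]_x (f x ^+ 2)%:E)%E.
  by move=> _; apply: eq_integral => x _; rewrite /= powR_mulrn// real_normK ?num_real.
split.
  move=> /andP[]; rewrite !inE /= => mf; rewrite /finite_norm => foo; split => //.
  apply: ge0_ig => [|x|]; [exact: measurable_funX|exact: sqr_ge0|].
  by rewrite -E// -powR_Lnorm// poweR_lty.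
move=> [mf /integrable_lty]; rewrite -E// => foo.
apply/andP; rewrite !inE /=; split => //.
by rewrite /finite_norm unlock; apply: poweR_lty; exact: foo.
Qed.

Lemma l2M f g : l2 f -> l2 g -> ig mu (fun x => f x * g x).
Proof.
move=> [mf hf] [mg hg].
apply: (@ig_le _ _ _ mu (fun x => f x ^+ 2 + g x ^+ 2)).
- exact: measurable_funM.
- exact: igD.
move=> x; rewrite ler_norml; have := sqr_ge0 (f x + g x); have := sqr_ge0 (f x - g x).
have := sqr_ge0 (f x); have := sqr_ge0 (g x).
by move=> *; apply/andP; split; nra.
Qed.

Lemma l2_lin k f g : l2 f -> l2 g -> l2 (fun x => k * f x + g x).
Proof.
move=> [mf hf] [mg hg]; have m : measurable_fun setT (fun x => k * f x + g x).
  by apply: measurable_funD => //; apply: measurable_funM => //; exact: measurable_cst.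
split=> //; apply: (@ig_le _ _ _ mu (fun x => (2 * k ^+ 2) * f x ^+ 2 + 2 * g x ^+ 2)).
- exact: measurable_funX.
- by apply: igD; exact: igZ.
move=> x; rewrite ger0_norm ?sqr_ge0//; have := sqr_ge0 (k * f x - g x); nra.
Qed.

Lemma l2_0 : l2 (fun=> 0).
Proof.
split; first exact: measurable_cst.
rewrite (_ : (fun _ => _) = fun=> 0); first exact: ig0.
by apply/funext => x; rewrite expr0n.
Qed.

Lemma l2_mul_bounded f g C : measurable_fun setT g -> (forall x, `|g x| <= C) -> l2 f ->
  l2 (fun x => g x * f x).
Proof.
move=> mg gC [mf hf]; have m : measurable_fun setT (fun x => g x * f x).
  exact: measurable_funM.
split=> //; apply: (@ig_le _ _ _ mu (fun x => C ^+ 2 * f x ^+ 2)).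
- exact: measurable_funX.
- exact: igZ.
move=> x; rewrite ger0_norm ?sqr_ge0// exprMn ler_wpM2r ?sqr_ge0//.
by rewrite -(real_normK (num_real (g x))) ler_pXn2r// nnegrE// (le_trans _ (gC x)).
Qed.

Lemma fatou_bound (h : nat -> T -> R) f (c : R) :
  (forall n, measurable_fun setT (h n)) -> (forall n x, 0 <= h n x) ->
  (forall x, h n x @[n --> \oo] --> f x) ->
  (forall n, (\int[mu]_x (h n x)%:E <= c%:E)%E) -> (\int[mu]_x (f x)%:E <= c%:E)%E.
Proof.
move=> mh h0 hf hc.
have -> : (\int[mu]_x (f x)%:E = \int[mu]_x limn_einf (fun n => (h n x)%:E))%E.
  apply: eq_integral => x _.
  have hx : (h n x)%:E @[n --> \oo] --> (f x)%:E.
    by apply: cvg_EFin; [exact: nearW|exact: hf].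
  by rewrite (cvg_limn_einf_sup hx).1.
apply: (le_trans (fatou mu measurableT _ _)).
- by move=> n; apply/measurable_EFinP.
- by move=> n x _; rewrite lee_fin.
rewrite limn_einf_lim; apply: lime_le; first exact: is_cvg_einfs.
apply: nearW => n; apply: (le_trans _ (hc n)); apply: ereal_inf_lbound.
by exists n => //=.
Qed.

(** Weighting the squared increments by [4 ^+ k] leaves integrals at most [2^-1 ^+ k], with finite
    sum. So the weighted series is finite almost everywhere, which makes the increments
    geometrically small there. *)
Lemma ae_cvg_fast (f : nat -> T -> R) : (forall n, l2 (f n)) ->
  (forall k, \int[mu]_x (f k.+1 x - f k x) ^+ 2 <= (8 ^+ k)^-1) ->
  {ae mu, forall x, cvgn (f ^~ x)}.
Proof.
move=> lf f8; pose dif k x := f k.+1 x - f k x.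
have ld k : l2 (dif k).
  rewrite (_ : dif k = fun x => -1 * f k x + f k.+1 x); first exact: l2_lin.
  by apply/funext => x; rewrite mulN1r addrC.
pose a k x : \bar R := (4 ^+ k * dif k x ^+ 2)%:E.
have ma k : measurable_fun setT (a k).
  by apply/measurable_EFinP; apply: measurable_funM;
    [exact: measurable_cst|apply: measurable_funX; exact: (ld k).1].
have a0 k x : (0 <= a k x)%E.
  by rewrite lee_fin; apply: mulr_ge0; [exact: exprn_ge0|exact: sqr_ge0].
pose S x : \bar R := (\sum_(0 <= k <oo) a k x)%E.
have mS : measurable_fun setT S.
  exact: (@ge0_emeasurable_sum _ _ _ setT a xpredT (fun k x _ _ => a0 k x) (fun k _ => ma k)).
have S0 x : (0 <= S x)%E by apply: nneseries_ge0.
have iS : mu.-integrable setT S.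
  apply/integrableP; split=> //.
  under eq_integral do rewrite gee0_abs//.
  rewrite integral_nneseries//.
  apply: (@le_lt_trans _ _ 2%:E); last exact: ltry.
  have ik k : (\int[mu]_x a k x <= (2^-1 ^+ k)%:E)%E.
    rewrite -EFin_Rint; last by apply: igZ; exact: (ld k).2.
    rewrite lee_fin RintZ; last exact: (ld k).2.
    apply: (le_trans (ler_wpM2l _ (f8 k))); first by rewrite exprn_ge0.
    rewrite le_eqVlt; apply/orP; left; apply/eqP.
    by rewrite -exprVn -exprMn; congr (_ ^+ _); field.
  apply: lime_le.
    by apply: is_cvg_nneseries => n _ _; exact: integral_ge0.
  apply: nearW => n.
  apply: (@le_trans _ _ (\sum_(0 <= k < n) (2^-1 ^+ k)%:E)%E).
    by apply: lee_sum => k _.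
  rewrite sumEFin lee_fin.
  have -> : \sum_(0 <= k < n) 2^-1 ^+ k = 2 - 2 * 2^-1 ^+ n :> R.
    elim: n => [|n IH]; first by rewrite big_nil expr0; lra.
    by rewrite big_nat_recr//= IH exprS; field.
  by rewrite gerBl mulr_ge0// exprn_ge0// invr_ge0.
have := integrable_ae measurableT iS; apply: filterS => x /(_ I) Sx.
pose s := fine (S x); have sE : S x = s%:E by rewrite fineK.
have s0 : 0 <= s by rewrite -lee_fin -sE.
(* The bound [s <= (s + 1) ^+ 2] avoids taking a square root of the sum. *)
have dk k : `|dif k x| <= (s + 1) * 2^-1 ^+ k.
  have : (a k x <= S x)%E.
    apply: le_trans (nneseries_lim_ge k.+1 (fun n _ _ => a0 n x)).
    by rewrite big_nat_recr//= leeDr// sume_ge0.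
  rewrite sE lee_fin => h.
  have p2 : 0 <= 2^-1 ^+ k :> R by rewrite exprn_ge0// invr_ge0.
  rewrite -(ler_pXn2r (n := 2))// ?nnegrE ?mulr_ge0 ?addr_ge0//.
  rewrite real_normK ?num_real// exprMn.
  have -> : dif k x ^+ 2 = 4 ^+ k * dif k x ^+ 2 * (2^-1 ^+ k) ^+ 2.
    rewrite mulrAC -exprM mulnC exprM -exprMn.
    by rewrite (_ : 4 * 2^-1 ^+ 2 = 1 :> R) ?expr1n ?mul1r//; field.
  rewrite ler_wpM2r ?sqr_ge0//; apply: (le_trans h).
  have := sqr_ge0 s; rewrite sqrrD1; move: s0; rewrite mulr2n; lra.
have cd : cvgn (series (fun k => dif k x)).
  apply: normed_cvg.
  apply: (@series_le_cvg _ _ (geometric (s + 1) 2^-1)).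
  - by move=> k /=.
  - by move=> k; rewrite /geometric /= mulr_ge0 ?addr_ge0// exprn_ge0// invr_ge0.
  - exact: dk.
  - by apply: is_cvg_geometric_series; rewrite ger0_norm ?invr_ge0// invf_lt1// ltr1n.
have -> : f ^~ x = (fun k => f 0%N x + series (fun k => dif k x) k).
  apply/funext => k; rewrite /series /= telescope_sumr//.
  by rewrite addrC subrK.
by apply: is_cvgD => //; exact: is_cvg_cst.
Qed.

(** Riesz-Fischer. The last clause lets limits of functions that vanish off the domain vanish there
    as well. *)
Lemma l2_complete (f : nat -> T -> R) : (forall n, l2 (f n)) ->
  (forall e, 0 < e -> exists N, forall n m, (N <= n)%N -> (N <= m)%N ->
     \int[mu]_x (f n x - f m x) ^+ 2 <= e) ->
  exists g, [/\ l2 g, \int[mu]_x (f n x - g x) ^+ 2 @[n --> \oo] --> (0 : R) &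
    forall x, (forall n, f n x = 0) -> g x = 0].
Proof.
move=> lf fC.
have lB u v : l2 u -> l2 v -> l2 (fun x => u x - v x).
  move=> lu lv; rewrite (_ : (fun x => _) = fun x => -1 * v x + u x); first exact: l2_lin.
  by apply/funext => x; rewrite mulN1r addrC.
have /choice[N hN] : forall k, exists N, forall n m, (N <= n)%N -> (N <= m)%N ->
     \int[mu]_x (f n x - f m x) ^+ 2 <= (8 ^+ k)^-1.
  by move=> k; apply: fC; rewrite invr_gt0 exprn_gt0.
(* Running maxima make the chosen indices nondecreasing, so consecutive terms both lie beyond
   [N k]. *)
pose n_ k := (\max_(j < k.+1) maxn (N j) j)%N.
have Nn0 k : (maxn (N k) k <= n_ k)%N by rewrite /n_ big_ord_recr /= leq_maxr.
have Nn k : (N k <= n_ k)%N := leq_trans (leq_maxl _ _) (Nn0 k).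
have kn k : (k <= n_ k)%N := leq_trans (leq_maxr _ _) (Nn0 k).
have nS k : (n_ k <= n_ k.+1)%N.
  by rewrite /n_ [in leqRHS]big_ord_recr /= leq_maxl.
pose fk k := f (n_ k).
have lfk k : l2 (fk k) by exact: lf.
have [|M [mM M0 hM]] := ae_cvg_fast lfk.
  by move=> k; apply: hN; [exact: leq_trans (Nn k) (nS k)|exact: Nn].
have mMc : measurable (~` M) by exact: measurableC.
(* Cutting off the null set makes the sequence converge at every point, so its limit [g] is Borel
   measurable. *)
pose h k x : R := \1_(~` M) x * fk k x.
have mh k : measurable_fun setT (h k).
  by apply: measurable_funM; [exact: measurable_indic|exact: (lfk k).1].
pose g x := limn (h ^~ x).
have hg x : h k x @[k --> \oo] --> g x.
  rewrite /g /h indicE; have [xM|xM] := boolP (x \in ~` M).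
    have : cvgn (fk ^~ x) by apply: contrapT => hx; move: xM => /set_mem; apply; exact: hM.
    move=> c; have -> : (fun k => 1 * fk k x) = fk ^~ x by apply/funext => k; rewrite mul1r.
    exact: c.
  have -> : (fun k => 0 * fk k x) = (fun=> 0) by apply/funext => k; rewrite mul0r.
  by rewrite lim_cst//; exact: cvg_cst.
have mg : measurable_fun setT g.
  by apply: (@measurable_fun_cvg _ _ _ _ h) => // x _; exact: hg.
have fh k : {ae mu, forall x, fk k x = h k x}.
  exists M; split => // x /= nx; apply: contrapT => xM; apply: nx.
  by rewrite /h indicE mem_set// mul1r.
have bound n c N0 : (forall m, (N0 <= m)%N -> \int[mu]_x (f n x - f m x) ^+ 2 <= c) ->
    (\int[mu]_x ((f n x - g x) ^+ 2)%:E <= c%:E)%E.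
  move=> hN0.
  apply: (@fatou_bound (fun k x => (f n x - h (k + N0)%N x) ^+ 2)).
  - move=> k; apply: measurable_funX; apply: measurable_funB => //; exact: (lf n).1.
  - by move=> k x; exact: sqr_ge0.
  - move=> x; have hx : h (k + N0)%N x @[k --> \oo] --> g x.
      by have := hg x; rewrite -(cvg_shiftn N0).
    rewrite expr2; under eq_fun do rewrite expr2.
    by apply: cvgM; apply: cvgB => //; exact: cvg_cst.
  - move=> k.
    rewrite (@ae_eq_integral_nonmeas _ _ _ mu setT _
      (fun x => ((f n x - fk (k + N0)%N x) ^+ 2)%:E)); last first.
      by apply: (ae_imp (fh (k + N0)%N)) => x -> _.
    rewrite -EFin_Rint; last exact: (lB _ _ (lf n) (lfk _)).2.
    by rewrite lee_fin hN0// (leq_trans (leq_addl k N0)).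
have lg : l2 g.
  have [N0 hN0] := fC 1 ltr01.
  have ld : l2 (fun x => f N0 x - g x).
    split; first by apply: measurable_funB => //; exact: (lf N0).1.
    apply: ge0_ig => [|x|].
    - by apply: measurable_funX; apply: measurable_funB => //; exact: (lf N0).1.
    - exact: sqr_ge0.
    - by apply: le_lt_trans (bound N0 1 N0 _) (ltry _) => m hm; exact: hN0.
  rewrite (_ : g = fun x => f N0 x - (f N0 x - g x)); first exact: lB.
  by apply/funext => x; rewrite subKr.
have g0 x : (forall n, f n x = 0) -> g x = 0.
  move=> f0; rewrite /g /h (_ : (fun k => _) = fun=> 0) ?lim_cst//.
  by apply/funext => k; rewrite /fk f0 mulr0.
exists g; split=> //; apply/cvg0P => e e0.
have e2 : 0 < e / 2 by rewrite divr_gt0.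
have [N0 hN0] := fC _ e2; exists N0 => n hn.
rewrite ger0_norm; last by apply: Rintegral_ge0 => x _; exact: sqr_ge0.
apply: (@le_lt_trans _ _ (e / 2)); last by lra.
rewrite -lee_fin EFin_Rint; last exact: (lB _ _ (lf n) lg).2.
by apply: (bound n _ N0) => m hm; exact: hN0.
Qed.

End SquareIntegrable.


Section FieldSpace.
Variables (R : realType) (Om : set (pt R)).
Implicit Types (v w : field R) (A : tensor R).

Definition comp v (i : 'I_3) : pt R -> R := (fun x => v x i 0) \_ Om.

Lemma domP v : dom (L2 Om) v <-> forall i, l2 leb3 (comp v i).
Proof. by split=> h i; have := h i => /(Lfun2P leb3). Qed.

Lemma compE v i x : comp v i x = \1_Om x * v x i 0.
Proof.
by rewrite /comp patchE indicE; case: ifP => _; rewrite ?mul1r ?mul0r.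
Qed.

Lemma comp_lin a v w i : comp (a *: v + w) i = fun x => a * comp v i x + comp w i x.
Proof.
apply/funext => x; rewrite !compE (_ : (a *: v + w) x i 0 = a * v x i 0 + w x i 0).
  by ring.
by rewrite [LHS]mxE mxE.
Qed.

Lemma ip_sum v w : dom (L2 Om) v -> dom (L2 Om) w ->
  ip Om v w = \sum_i \int[leb3]_x (comp v i x * comp w i x).
Proof.
move=> /domP hv /domP hw; rewrite /ip Rintegral_mkcond.
rewrite (@eq_Rintegral _ _ _ leb3 setT (fun x => \sum_i comp v i x * comp w i x)).
  rewrite !big_ord_recl !big_ord0 !addr0 -RintD; [|exact: l2M|exact: l2M].
  rewrite -RintD; [|exact: l2M|apply: igD; exact: l2M].
  by apply: eq_Rintegral => x _; rewrite !big_ord_recl big_ord0 addr0.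
move=> x _; rewrite patchE; case: ifPn => xOm; rewrite /dot ?mxE.
  by apply: eq_bigr => i _; rewrite !mxE !compE indicE xOm !mul1r.
by rewrite big1// => i _; rewrite compE indicE (negbTE xOm) !mul0r.
Qed.

Lemma dom_lin a v w : dom (L2 Om) v -> dom (L2 Om) w -> dom (L2 Om) (a *: v + w).
Proof.
by move=> /domP hv /domP hw; apply/domP => i; rewrite comp_lin; exact: l2_lin.
Qed.

Lemma dom0 : dom (L2 Om) 0.
Proof.
apply/domP => i; rewrite (_ : comp 0 i = fun=> 0); first exact: l2_0.
by apply/funext => x; rewrite compE [X in _ * X]mxE mulr0.
Qed.

Lemma L2_semihilbert : semihilbert (dom (L2 Om)) (ip Om).
Proof.
have lin a u v w : dom (L2 Om) u -> dom (L2 Om) v -> dom (L2 Om) w ->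
    ip Om (a *: u + v) w = a * ip Om u w + ip Om v w.
  move=> hu hv hw; rewrite !ip_sum//; last exact: dom_lin.
  rewrite mulr_sumr -big_split/=; apply: eq_bigr => i _.
  move/domP: hu => /(_ i) hu; move/domP: hv => /(_ i) hv; move/domP: hw => /(_ i) hw.
  rewrite -RintZ; last exact: l2M.
  rewrite -RintD; [|by apply: igZ; exact: l2M|exact: l2M].
  by rewrite comp_lin; apply: eq_Rintegral => x _; ring.
have subD u v : dom (L2 Om) u -> dom (L2 Om) v -> dom (L2 Om) (u - v).
  by move=> hu hv; rewrite addrC -scaleN1r; exact: dom_lin.
have ge0 u : dom (L2 Om) u -> 0 <= ip Om u u.
  by move=> hu; rewrite ip_sum// sumr_ge0// => i _; apply: Rintegral_ge0 => x _; exact: sqr_ge0.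
have sub2 u v i : \int[leb3]_x (comp (u - v) i x * comp (u - v) i x) =
    \int[leb3]_x (comp u i x - comp v i x) ^+ 2.
  apply: eq_Rintegral => x _; rewrite addrC -scaleN1r comp_lin expr2; ring.
split=> //.
- exact: dom0.
- exact: dom_lin.
- move=> u v hu hv; rewrite !ip_sum//; apply: eq_bigr => i _.
  by apply: eq_Rintegral => x _; rewrite mulrC.
move=> u hu hC.
have /choice[g hg] : forall i, exists g, [/\ l2 leb3 g,
    \int[leb3]_x (comp (u n) i x - g x) ^+ 2 @[n --> \oo] --> (0 : R) &
    forall x, (forall n, comp (u n) i x = 0) -> g x = 0].
  move=> i; apply: l2_complete; first by move=> n; move/domP: (hu n).
  move=> e e0; have [|N hN] := hC (Num.sqrt e); first by rewrite sqrtr_gt0.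
  exists N => n m hn hm; have := hN n m hn hm.
  rewrite ler_sqrt; last exact: ltW.
  apply: le_trans; rewrite ip_sum; [|exact: subD|exact: subD].
  rewrite (bigD1 i)//= sub2 lerDl sumr_ge0// => j _.
  by apply: Rintegral_ge0 => x _; exact: sqr_ge0.
pose v : field R := fun x => \col_i g i x.
(* All terms vanish off [Om], hence so does [g i], and restricting it to [Om] changes nothing. *)
have gE i : comp v i = g i.
  apply/funext => x; rewrite compE mxE indicE; have [|xOm] := boolP (x \in Om).
    by rewrite mul1r.
  rewrite mul0r; have [_ _ ->//] := hg i => n.
  by rewrite compE indicE (negbTE xOm) mul0r.
have hv : dom (L2 Om) v by apply/domP => i; rewrite gE; have [] := hg i.
exists v; split => //.
rewrite -sqrtr0; apply: continuous_cvg; first exact: sqrt_continuous.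
rewrite (_ : (fun n => _) = fun n => \sum_i \int[leb3]_x (comp (u n) i x - g i x) ^+ 2).
  rewrite -[X in _ --> X](_ : \sum_(i < 3) 0 = 0); last by rewrite big1.
  apply: cvg_big => [|i _]; first exact: add_continuous.
  by have [] := hg i.
apply/funext => n; rewrite ip_sum; [|exact: subD|exact: subD].
by apply: eq_bigr => i _; rewrite sub2 gE.
Qed.

End FieldSpace.

(** * Test functions and the fundamental lemma *)

Section Boxes.
Variable R : realType.
Local Notation T1 := (measurableTypeR R).
Local Notation T3 := (T1 * T1 * T1)%type.
Implicit Types (a b : R) (x : pt R) (U : set (pt R)).

Definition obox (lo hi : pt R) : set (pt R) :=
  (`]lo.1.1, hi.1.1[%classic `*` `]lo.1.2, hi.1.2[%classic) `*` `]lo.2, hi.2[%classic.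
Definition cbox (lo hi : pt R) : set (pt R) :=
  (`[lo.1.1, hi.1.1]%classic `*` `[lo.1.2, hi.1.2]%classic) `*` `[lo.2, hi.2]%classic.

Lemma measurable_obox lo hi : measurable (obox lo hi : set T3).
Proof.
have mI (a b : R) : measurable (`]a, b[%classic : set T1) by exact: measurable_itv.
by apply: measurableX; [apply: measurableX|]; exact: mI.
Qed.

Lemma compact_cbox lo hi : compact (cbox lo hi).
Proof. by do !apply: compact_setX; exact: segment_compact. Qed.

Definition qpt (q : rat * rat * rat) : pt R := (ratr q.1.1, ratr q.1.2, ratr q.2).

Lemma rat_near (c r : R) : 0 < r -> exists q : rat * rat,
  [/\ ratr q.1 < c, c < ratr q.2, c - r < ratr q.1 & ratr q.2 < c + r].
Proof.
move=> r0; have [|q /itvP hq] := @rat_in_itvoo R (c - r) c; first lra.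
have [|q' /itvP hq'] := @rat_in_itvoo R c (c + r); first lra.
by exists (q, q'); split; rewrite /= ?hq ?hq'.
Qed.

Lemma open_box U x : open U -> U x -> exists lo hi,
  obox (qpt lo) (qpt hi) x /\ cbox (qpt lo) (qpt hi) `<=` U.
Proof.
move=> oU Ux; have /nbhs_ballP[r /= r0 hr] : nbhs x U by exact: open_nbhs_nbhs.
have [[a a'] /= [a1 a2 a3 a4]] := rat_near x.1.1 r0.
have [[b b'] /= [b1 b2 b3 b4]] := rat_near x.1.2 r0.
have [[c c'] /= [c1 c2 c3 c4]] := rat_near x.2 r0.
exists (a, b, c), (a', b', c'); split.
  by split; [split|]; rewrite /= in_itv/= ?a1 ?b1 ?c1.
move=> y [[/=]]; rewrite !in_itv/= => /andP[ya1 ya2] /andP[yb1 yb2] /andP[yc1 yc2].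
by apply: hr; split; [split|]; rewrite /ball/= ltr_distlC; apply/andP; split; lra.
Qed.

(** Rational corners make the union countable. This yields measurability of open sets for the
    product sigma-algebra, and later lets null sets found box by box add up to one null set. *)
Lemma open_union U : open U ->
  U = \bigcup_(k in [set k : (rat * rat * rat) * (rat * rat * rat) |
      cbox (qpt k.1) (qpt k.2) `<=` U]) obox (qpt k.1) (qpt k.2).
Proof.
move=> oU; apply/seteqP; split=> [x Ux|x [k hk]].
  by have [lo [hi [h1 h2]]] := open_box oU Ux; exists (lo, hi).
move=> [[]] /=; rewrite !in_itv/= => /andP[? ?] /andP[? ?] /andP[? ?].
by apply: hk; split; [split|]; rewrite /= in_itv/= !ltW.
Qed.

Lemma open_measurable3 U : open U -> measurable (U : set T3).
Proof.
move=> oU; rewrite (open_union oU); rewrite bigcup_mkcond; apply: countable_bigcupT_measurable => [|k].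
  exact: countableP.
by case: ifP => _; [exact: measurable_obox|exact: measurable0].
Qed.

Lemma continuous_measurable3 (f : pt R -> R) : continuous f ->
  measurable_fun (setT : set T3) f.
Proof.
move=> /continuousP cf; apply: (measurability _ (RGenOInfty.measurableE R)).
move=> _ [_ [a ->]] <-; rewrite setTI; apply: open_measurable3.
by apply: cf; rewrite set_itvE; exact: open_gt.
Qed.

End Boxes.

(** * Functions whose integrals vanish on a generating family *)

Section ZeroIntegral.
Context d (T : measurableType d) (R : realType) (mu : {measure set T -> \bar R}).
Context d' (T' : measurableType d').
Local Open Scope ereal_scope.

(** The sets over which the integral vanishes form a Dynkin system. The map [pi] allows the argument
    to run on one coordinate while the others stay frozen in [D]. *)
Lemma zero_integral_sigma (pi : T -> T') (G : set (set T')) (D : set T) (g : T -> \bar R) :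
  @measurable _ T' = <<s G>> -> setI_closed G -> measurable_fun setT pi ->
  measurable D -> mu.-integrable D g -> \int[mu]_(x in D) g x = 0 ->
  (forall A, G A -> \int[mu]_(x in D `&` pi @^-1` A) g x = 0) ->
  forall A, measurable A -> \int[mu]_(x in D `&` pi @^-1` A) g x = 0.
Proof.
move=> GE GI mpi mD gi D0 G0 A; rewrite {1}GE.
have mpA B : measurable B -> measurable (D `&` pi @^-1` B).
  by move=> mB; apply: measurableI => //; rewrite -[X in measurable X]setTI; exact: mpi.
have iS B : measurable B -> mu.-integrable (D `&` pi @^-1` B) g.
  by move=> mB; apply: (integrableS mD (mpA _ mB) _ gi); exact: subIsetl.
apply: (dynkin_induction GE GI _ G0).
- by rewrite preimage_setT setIT.
- move=> S mS S0; have mC := measurableC mS.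
  have : \int[mu]_(x in (D `&` pi @^-1` S) `|` (D `&` pi @^-1` ~` S)) g x = 0.
    by rewrite -setIUr -preimage_setU setUv preimage_setT setIT.
  rewrite integral_setU; [by rewrite S0 add0e|exact: mpA|exact: mpA| |].
  + rewrite -setIUr -preimage_setU setUv preimage_setT setIT.
    exact: (measurable_int mu gi).
  + apply/disj_setPS => x [[_ /= h1] [_ h2]]; exact: h2.
- move=> F mF tF F0; rewrite preimage_bigcup setI_bigcupr integral_bigcup.
  + by apply: eseries0 => k _ _; exact: F0.
  + move/trivIsetP : tF => tF; apply/trivIsetP => i j _ _ ij.
    by rewrite setIACA setIid -preimage_setI tF// preimage_set0 setI0.
  + by move=> k; exact: mpA.
  + by rewrite -setI_bigcupr -preimage_bigcup; apply: iS; exact: bigcup_measurable.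
Qed.

End ZeroIntegral.

Section ZeroOnBoxes.
Variable R : realType.
Local Notation T1 := (measurableTypeR R).
Local Notation T3 := (T1 * T1 * T1)%type.
Variable mu : {measure set T3 -> \bar R}.
Local Open Scope ereal_scope.

Lemma rays_setI_closed : setI_closed (@RGenOInfty.G R).
Proof.
move=> _ _ [a ->] [b ->]; exists (Num.max a b).
by apply/seteqP; split=> x /=; rewrite !in_itv/= !andbT gt_max => /andP.
Qed.

Lemma rectangles_setI_closed d1 d2 (T1 : measurableType d1) (T2 : measurableType d2) :
  setI_closed [set A `*` B | A in @measurable _ T1 & B in @measurable _ T2].
Proof.
move=> _ _ [A mA [B mB <-]] [A' mA' [B' mB' <-]]; rewrite -setXI.
by exists (A `&` A'); [exact: measurableI|exists (B `&` B') => //; exact: measurableI].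
Qed.

(** Boxes that share the upper corner are intersections of the large box with rays. Replacing the
    rays by Borel sets one coordinate at a time gives all rectangles; two more rounds, one for each
    level of the nested product, give all measurable sets. *)
Lemma zero_on_boxes lo hi (g : T3 -> \bar R) : mu.-integrable (obox lo hi) g ->
  (forall lo', (lo.1.1 <= lo'.1.1)%R -> (lo.1.2 <= lo'.1.2)%R -> (lo.2 <= lo'.2)%R ->
     \int[mu]_(x in obox lo' hi) g x = 0) ->
  forall A, measurable A -> A `<=` obox lo hi -> \int[mu]_(x in A) g x = 0.
Proof.
move=> gi h.
have mQ := measurable_obox lo hi.
have rayE : @measurable _ T1 = <<s @RGenOInfty.G R >> by exact: RGenOInfty.measurableE.
have ray (pi : T3 -> T1) (c : R) D : measurable_fun setT pi -> measurable D ->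
    D `<=` obox lo hi -> (forall x, obox lo hi x -> c < pi x)%R ->
    (forall a : R, (c <= a)%R -> \int[mu]_(x in D `&` pi @^-1` `]a, +oo[%classic) g x = 0) ->
    forall A, measurable A -> \int[mu]_(x in D `&` pi @^-1` A) g x = 0.
  move=> mpi mD DQ cpi ha.
  (* A ray starting to the left of the box cuts nothing off, so only corners inside the box have to
     be tested. *)
  have hc (a : R) : (a <= c)%R -> D `&` pi @^-1` `]a, +oo[%classic = D.
    move=> ac; apply/setIidl => x Dx.
    by rewrite /= in_itv/= andbT (le_lt_trans ac)// cpi//; exact: DQ.
  apply: (zero_integral_sigma rayE rays_setI_closed mpi mD).
  - exact: (integrableS mQ mD DQ gi).
  - by rewrite -(hc _ (lexx c)) ha.
  - move=> _ [a ->]; have [ac|ca] := leP a c; last by rewrite ha// ltW.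
    by rewrite hc// -(hc _ (lexx c)) ha.
have mp1 : measurable_fun setT (fun x : T3 => x.1.1).
  by apply: (measurableT_comp measurable_fst); exact: measurable_fst.
have mp2 : measurable_fun setT (fun x : T3 => x.1.2).
  by apply: (measurableT_comp measurable_snd); exact: measurable_fst.
have mp3 : measurable_fun setT (fun x : T3 => x.2) by exact: measurable_snd.
have mpre (pi : T3 -> T1) D A : measurable_fun setT pi -> measurable D -> measurable A ->
    measurable (D `&` pi @^-1` A).
  by move=> mpi mD mA; apply: measurableI => //; rewrite -[X in measurable X]setTI; exact: mpi.
have Q1 x : obox lo hi x -> (lo.1.1 < x.1.1)%R by move=> [[]]; rewrite /= in_itv/= => /andP[].
have Q2 x : obox lo hi x -> (lo.1.2 < x.1.2)%R by move=> [[]]; rewrite /= !in_itv/= => _ /andP[].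
have Q3 x : obox lo hi x -> (lo.2 < x.2)%R by move=> [_]; rewrite /= !in_itv/= => /andP[].
pose S (A B C : set T1) : set T3 := [set x | [/\ obox lo hi x, A x.1.1, B x.1.2 & C x.2]].
have mS A B C : measurable A -> measurable B -> measurable C -> measurable (S A B C).
  move=> mA mB mC; rewrite (_ : S A B C = obox lo hi `&` (fun x : T3 => x.1.1 : T1) @^-1` A
      `&` (fun x : T3 => x.1.2 : T1) @^-1` B `&` (fun x : T3 => x.2 : T1) @^-1` C).
    exact: mpre mp3 (mpre _ _ _ mp2 (mpre _ _ _ mp1 mQ mA) mB) mC.
  by apply/seteqP; split=> x; [move=> []|move=> [[[]]]].
have SQ A B C : S A B C `<=` obox lo hi by move=> x [].
have mray (a : R) : measurable (`]a, +oo[%classic : set T1) by exact: measurable_itv.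
have h1 (a b c : R) : (lo.1.1 <= a)%R -> (lo.1.2 <= b)%R -> (lo.2 <= c)%R ->
    \int[mu]_(x in S `]a, +oo[%classic `]b, +oo[%classic `]c, +oo[%classic) g x = 0.
  move=> la lb lc; rewrite -(h (a, b, c))//; congr integral.
  apply/seteqP; split=> x; rewrite /S /obox /= !in_itv/= !andbT.
    by move=> [[[/andP[_ ->] /andP[_ ->]] /andP[_ ->]] -> -> ->].
  move=> [[/andP[a1 ->] /andP[b1 ->]] /andP[c1 ->]]; rewrite a1 b1 c1.
  by rewrite (le_lt_trans la a1) (le_lt_trans lb b1) (le_lt_trans lc c1).
have h2 A B C : measurable A -> measurable B -> measurable C ->
    \int[mu]_(x in S A B C) g x = 0.
  move=> mA mB mC.
  have E1 A' : S A' B C = S setT B C `&` (fun x : T3 => x.1.1 : T1) @^-1` A'.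
    by apply/seteqP; split=> x; [move=> []|move=> [[]]].
  rewrite E1; apply: (ray _ lo.1.1 _ mp1 (mS _ _ _ measurableT mB mC) _ Q1 _ _ mA) => [//|a la].
  rewrite -E1.
  have E2 B' : S `]a, +oo[%classic B' C =
      S `]a, +oo[%classic setT C `&` (fun x : T3 => x.1.2 : T1) @^-1` B'.
    by apply/seteqP; split=> x; [move=> []|move=> [[]]].
  rewrite E2; apply: (ray _ lo.1.2 _ mp2 (mS _ _ _ (mray a) measurableT mC) _ Q2 _ _ mB) => [//|b lb].
  rewrite -E2.
  have E3 C' : S `]a, +oo[%classic `]b, +oo[%classic C' =
      S `]a, +oo[%classic `]b, +oo[%classic setT `&` (fun x : T3 => x.2 : T1) @^-1` C'.
    by apply/seteqP; split=> x; [move=> []|move=> [[]]].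
  rewrite E3; apply: (ray _ lo.2 _ mp3 (mS _ _ _ (mray a) (mray b) measurableT) _ Q3 _ _ mC) => [//|c lc].
  by rewrite -E3 h1.
have h3 A (C : set T1) : measurable A -> measurable C ->
    \int[mu]_(x in S setT setT C `&` (fun x : T3 => x.1 : T1 * T1) @^-1` A) g x = 0.
  move=> mA mC; move: A mA.
  have mSC := mS _ _ _ measurableT measurableT mC.
  apply: (@zero_integral_sigma _ _ _ mu _ (T1 * T1)%type _ _ _ _
    (measurable_prod_measurableType _ _) (@rectangles_setI_closed _ _ T1 T1)) => //.
  - exact: measurable_fst.
  - exact: (integrableS mQ mSC (@SQ _ _ _) gi).
  - exact: h2.
  - move=> _ [A mA [B mB <-]]; rewrite -(h2 _ _ _ mA mB mC); congr integral.
    by apply/seteqP; split=> x; [move=> [[? _ _ ?] []]|move=> []].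
move=> A mA AQ.
rewrite (_ : A = S setT setT setT `&` id @^-1` A); last first.
  by apply/seteqP; split=> x; [move=> Ax; split=> //; split=> //; exact: AQ|move=> []].
have mST := mS _ _ _ measurableT measurableT measurableT.
move: {AQ} A mA.
apply: (@zero_integral_sigma _ _ _ mu _ (T1 * T1 * T1)%type _ _ _ _
    (measurable_prod_measurableType _ _) (@rectangles_setI_closed _ _ (T1 * T1)%type T1)) => //.
- exact: (integrableS mQ mST (@SQ _ _ _) gi).
- exact: h2.
- move=> _ [A mA [B mB <-]]; rewrite -(h3 _ _ mA mB); congr integral.
  by apply/seteqP; split=> x; [move=> [[? _ _ _] []]|move=> [[]]].
Qed.

End ZeroOnBoxes.

Section DirectionalDerivatives.
Variables (R : realType) (V : normedModType R).
Implicit Types (f : V -> R) (x v : V).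

(** Reduces partial derivatives to one variable, both for product functions and for integration
    along a coordinate line. *)
Lemma is_derive_line f x v (t df : R) : is_derive (t *: v + x) v f df <->
  is_derive t 1 (fun h : R => f (h *: v + x)) df.
Proof.
have E (h : R) : f (h *: v + (t *: v + x)) = f ((h *: 1 + t) *: v + x).
  by rewrite addrA -scalerDl [h *: 1]mulr1.
split=> -[d1 d2]; split.
- move: d1; rewrite /derivable; set g1 := (X in X @ _) => h; set g2 := (X in X @ _).
  by rewrite (_ : g2 = g1)//; apply/funext => h'; rewrite /g1 /g2 /= E.
- rewrite -d2 /derive; congr (lim _); set g1 := (X in X @ _ = _); set g2 := (X in _ = X @ _).
  by rewrite (_ : g1 = g2)//; apply/funext => h'; rewrite /g1 /g2 /= E.
- move: d1; rewrite /derivable; set g1 := (X in X @ _) => h; set g2 := (X in X @ _).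
  by rewrite (_ : g2 = g1)//; apply/funext => h'; rewrite /g1 /g2 /= E.
- rewrite -d2 /derive; congr (lim _); set g1 := (X in X @ _ = _); set g2 := (X in _ = X @ _).
  by rewrite (_ : g1 = g2)//; apply/funext => h'; rewrite /g1 /g2 /= E.
Qed.

End DirectionalDerivatives.

(** * Test functions of product form on boxes *)

Section ProductTestFunctions.
Variable R : realType.
Implicit Types (a b c : R -> R) (x : pt R).

Definition prod3 a b c x : R := a x.1.1 * b x.1.2 * c x.2.

Lemma continuous_prod3 a b c : continuous a -> continuous b -> continuous c ->
  continuous (prod3 a b c).
Proof.
move=> ca cb cc x; apply: cvgM; [apply: cvgM|].
- apply: (@continuous_comp _ _ _ (fun x : pt R => x.1.1) a); last exact: ca.
  by apply: (@continuous_comp _ _ _ (fun x : pt R => x.1) fst); exact: cvg_fst.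
- apply: (@continuous_comp _ _ _ (fun x : pt R => x.1.2) b); last exact: cb.
  by apply: (@continuous_comp _ _ _ (fun x : pt R => x.1) snd); [exact: cvg_fst|exact: cvg_snd].
- by apply: (@continuous_comp _ _ _ (fun x : pt R => x.2) c); [exact: cvg_snd|exact: cc].
Qed.

Lemma is_derive_prod3 a b c (j : 'I_3) x : smooth_expr a -> smooth_expr b -> smooth_expr c ->
  is_derive x (Defs.basis j) (prod3 a b c)
    (if j == 0 then prod3 (derive1 a) b c x
     else if j == 1 then prod3 a (derive1 b) c x else prod3 a b (derive1 c) x).
Proof.
move=> sa sb sc.
have lin (f : R -> R) (k y : R) : smooth_expr f ->
    is_derive (0 : R) 1 (fun h : R => f (h * k + y)) (k * derive1 f y).
  move=> /smooth_expr_derive1[_ /(_ y) df].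
  have A : is_derive (0 : R) 1 (fun h : R => h * k + y) k.
    rewrite (_ : (fun h => _) = fun h => k * h + y); first exact: is_derive_affine.
    by apply/funext => h; rewrite mulrC.
  have df' : is_derive ((0 : R) * k + y) 1 f (derive1 f y) by rewrite mul0r add0r.
  by rewrite mulrC; exact: (@is_derive1_comp _ f (fun h => h * k + y) 0 _ _ df' A).
have -> : x = (0 : R) *: Defs.basis j + x by rewrite scale0r add0r.
apply/is_derive_line; pose k i : R := ((j : nat) == i)%:R.
have := is_deriveM (is_deriveM (lin a (k 0%N) x.1.1 sa) (lin b (k 1%N) x.1.2 sb))
  (lin c (k 2%N) x.2 sc).
set g := (X in is_derive _ _ X _); set g' := (X in _ -> is_derive _ _ X _).
have -> : g = g' by apply/funext.
move=> h; apply: (is_derive_eq h).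
rewrite scale0r add0r !mul0r !add0r /prod3 /k /GRing.scale /=.
have mE (u v : R -> R) : (u * v) 0 = u 0 * v 0 by [].
rewrite mE !mul0r !add0r.
by case: j {g g' h k} => [[|[|[|//]]] ?] /=; ring.
Qed.

(** A partial derivative changes one factor only and stays in the class, so iterated partial
    derivatives of every order exist and are continuous. *)
Lemma smooth_prod3 a b c (s : seq 'I_3) : smooth_expr a -> smooth_expr b -> smooth_expr c ->
  exists a' b' c', [/\ smooth_expr a', smooth_expr b', smooth_expr c' &
    foldr partial (prod3 a b c) s = prod3 a' b' c'].
Proof.
move=> sa sb sc; elim: s => [|j s [a' [b' [c' [sa' sb' sc' E]]]]]; first by exists a, b, c.
have [sa1 _] := smooth_expr_derive1 sa'; have [sb1 _] := smooth_expr_derive1 sb'.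
have [sc1 _] := smooth_expr_derive1 sc'.
pose pr1 := if j == 0 then derive1 a' else a'.
pose pr2 := if j == 1 then derive1 b' else b'.
pose pr3 := if (j != 0) && (j != 1) then derive1 c' else c'.
exists pr1, pr2, pr3; split; rewrite /pr1 /pr2 /pr3; do ?by case: ifP.
apply/funext => x /=; rewrite E /partial.
have h := is_derive_prod3 j x sa' sb' sc'; rewrite (derive_val (is_derive := h)).
by case: (eqVneq j 0) => [->//|j0]; case: ifP.
Qed.

Definition sbump n (lo hi t : R) : R := bump n ((hi - lo)^-1 * t + - ((hi - lo)^-1 * lo)).

Lemma sbumpE n lo hi t : sbump n lo hi t = bump n ((hi - lo)^-1 * (t - lo)).
Proof. by rewrite /sbump mulrBr. Qed.

Lemma smooth_sbump n lo hi : smooth_expr (sbump n lo hi).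
Proof. by apply: smooth_expr_comp; exact: smooth_bump. Qed.

Lemma sbump_out n lo hi t : lo < hi -> t \notin `]lo, hi[ -> sbump n lo hi t = 0.
Proof.
move=> lh; rewrite in_itv/= negb_and -!leNgt => h.
have l0 : 0 < hi - lo by rewrite subr_gt0.
rewrite sbumpE bump_out//; case/orP: h => h; [left|right].
  by rewrite pmulr_rle0 ?invr_gt0// subr_le0.
by rewrite mulrC ler_pdivlMr// mul1r lerB.
Qed.

Lemma sbump_cvg lo hi t : t \in `]lo, hi[ -> sbump n lo hi t @[n --> \oo] --> (1 : R).
Proof.
rewrite in_itv/= => /andP[h1 h2]; have l0 : 0 < hi - lo by lra.
under eq_fun do rewrite sbumpE.
apply: bump_cvg; apply/andP; split.
  by apply: mulr_gt0; rewrite ?invr_gt0// subr_gt0.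
by rewrite mulrC ltr_pdivrMr// mul1r; lra.
Qed.

Definition box_bump n (lo hi : pt R) : pt R -> R :=
  prod3 (sbump n lo.1.1 hi.1.1) (sbump n lo.1.2 hi.1.2) (sbump n lo.2 hi.2).

Definition box_lt (lo hi : pt R) := [/\ lo.1.1 < hi.1.1, lo.1.2 < hi.1.2 & lo.2 < hi.2].

Lemma box_bump_out n lo hi x : box_lt lo hi -> ~ obox lo hi x -> box_bump n lo hi x = 0.
Proof.
move=> [l1 l2 l3] xQ; rewrite /box_bump /prod3.
have [h1|h1] := boolP (x.1.1 \in `]lo.1.1, hi.1.1[); last by rewrite sbump_out// !mul0r.
have [h2|h2] := boolP (x.1.2 \in `]lo.1.2, hi.1.2[).
  have [h3|h3] := boolP (x.2 \in `]lo.2, hi.2[); last by rewrite (sbump_out _ l3)// mulr0.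
  by case: xQ.
by rewrite (sbump_out _ l2)// mulr0 mul0r.
Qed.

Lemma box_bump_01 n lo hi x : 0 <= box_bump n lo hi x <= 1.
Proof.
have ge0 l h t : 0 <= sbump n l h t by exact: bump_ge0.
have le1 l h t : sbump n l h t <= 1 by exact: bump_le1.
rewrite /box_bump /prod3; apply/andP; split; first by do 2!apply: mulr_ge0 => //.
by apply: mulr_ile1 => //; [exact: mulr_ge0|exact: mulr_ile1].
Qed.

Lemma box_bump_cvg lo hi x : obox lo hi x -> box_bump n lo hi x @[n --> \oo] --> (1 : R).
Proof.
move=> [[h1 h2] h3]; rewrite [X in _ --> X](_ : 1 = 1 * 1 * 1); last by rewrite !mulr1.
by apply: cvgM; [apply: cvgM|]; exact: sbump_cvg.
Qed.

Lemma box_bump_test Om n lo hi : box_lt lo hi -> cbox lo hi `<=` Om ->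
  test_function Om (box_bump n lo hi).
Proof.
move=> lh QOm; split=> [s f|].
  rewrite /f; have [a [b [c [sa sb sc ->]]]] := smooth_prod3 s (smooth_sbump n lo.1.1 hi.1.1)
    (smooth_sbump n lo.1.2 hi.1.2) (smooth_sbump n lo.2 hi.2).
  split; first by apply: continuous_prod3; exact: smooth_expr_cont.
  by move=> j x; have h := is_derive_prod3 j x sa sb sc; exact: ex_derive.
exists (cbox lo hi); split=> //; first exact: compact_cbox.
move=> x hx; apply: box_bump_out => // -[[/itvP h1 /itvP h2] /itvP h3]; apply: hx.
by split; [split|]; rewrite /= in_itv/= ?h1 ?h2 ?h3.
Qed.

End ProductTestFunctions.

Section FundamentalLemma.
Variables (R : realType) (Om : set (pt R)).
Hypothesis oOm : open Om.
Local Notation leb := (@lebesgue_measure R).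
Local Notation T3 := (measurableTypeR R * measurableTypeR R * measurableTypeR R)%type.

Lemma obox_indic_l2 (lo hi : pt R) : l2 leb3 (\1_(obox lo hi) : pt R -> R).
Proof.
have mQ := measurable_obox lo hi.
have m1 := @measurable_indic _ _ R setT _ mQ.
split=> //; rewrite (_ : (fun x => _) = \1_(obox lo hi)); last first.
  by apply/funext => x; rewrite indicE; case: (_ \in _); rewrite ?expr1n ?expr0n.
apply: ge0_ig => //.
rewrite integral_indic// setIT.
have mI (a b : R) : measurable (`]a, b[%classic : set R) by exact: measurable_itv.
have fI (a b : R) : (leb (`]a, b[%classic : set R) < +oo)%E.
  have -> : leb (`]a, b[%classic : set R) = (if (a < b)%R then (b - a)%:E else 0)%E.
    by have := @lebesgue_measure_itv R `]a, b[; rewrite /= lte_fin EFinB.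
  by case: ifP; rewrite ltry.
rewrite /obox; set I1 := [set` _]; set I2 := [set` _]; set I3 := [set` _].
apply: (@le_lt_trans _ _ (leb I1 * leb I2 * leb I3)%E).
  rewrite le_eqVlt; apply/orP; left; apply/eqP; etransitivity; first by apply: product_measure1E; [apply: measurableX|]; exact: mI.
  by congr (_ * _)%E; apply: product_measure1E; exact: mI.
have ge0 I : (0 <= leb I)%E by exact: measure_ge0.
have fin I : (leb I < +oo)%E -> leb I \is a fin_num by move=> h; rewrite ge0_fin_numE.
have h1 := fin _ (fI lo.1.1 hi.1.1); have h2 := fin _ (fI lo.1.2 hi.1.2).
apply: lte_mul_pinfty; [by apply: mule_ge0; exact: ge0| |exact: fI].
by apply: fin_numM; [exact: h1|exact: h2].
Qed.

(** Box bumps tend to the indicator of their box under the integrable majorant [|g|] restricted to a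
    fixed box. The integral of [g] thus vanishes on boxes, then on every measurable subset, so [g]
    is null on each box; countably many boxes exhaust [Om]. *)
Lemma fundamental_lemma (g : pt R -> R) : l2 leb3 g ->
  (forall phi, test_function Om phi -> \int[leb3]_x (g x * phi x) = 0) ->
  {ae leb3, forall x, Om x -> g x = 0}.
Proof.
move=> lg h; have mg := lg.1.
have box lo hi : cbox lo hi `<=` Om -> {ae leb3, forall x, obox lo hi x -> g x = 0}.
  move=> QOm; have mQ := measurable_obox lo hi.
  have ig1 : ig leb3 (fun x => `|g x| * \1_(obox lo hi) x).
    apply: l2M (obox_indic_l2 _ _); split; first exact: measurableT_comp.
    by move: lg.2; apply: eq_integrable => // x _; rewrite /= real_normK ?num_real.
  have igQ : leb3.-integrable (obox lo hi) (EFin \o g).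
    apply: (iffRL (@integrable_mkcond _ _ _ leb3 _ _ mQ)).
    have : ig leb3 (fun x => g x * \1_(obox lo hi) x) by exact: l2M (obox_indic_l2 _ _).
    apply: eq_integrable => // x _; rewrite /= patchE indicE.
    by case: (_ \in _); rewrite ?mulr1 ?mulr0.
  have hz (A : set T3) : measurable A -> A `<=` obox lo hi -> (\int[leb3]_(x in A) (g x)%:E = 0)%E.
    apply: (zero_on_boxes igQ) => lo' l1 l2 l3.
    have [lh|nlh] := pselect (box_lt lo' hi); last first.
      rewrite (_ : obox lo' hi = set0) ?integral_set0//; apply/seteqP; split=> // x.
      move=> [[]] /=; rewrite !in_itv/= => /andP[? ?] /andP[? ?] /andP[? ?].
      by apply: nlh; split; eapply lt_trans; eauto.
    have sub1 : obox lo' hi `<=` obox lo hi.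
      move=> x; rewrite /obox /= !in_itv/= => -[[/andP[h1 ->] /andP[h2 ->]] /andP[h3 ->]].
      by rewrite (le_lt_trans l1 h1) (le_lt_trans l2 h2) (le_lt_trans l3 h3).
    have sub2 : cbox lo' hi `<=` Om.
      apply: subset_trans QOm => x; rewrite /cbox /= !in_itv/=.
      move=> -[[/andP[h1 ->] /andP[h2 ->]] /andP[h3 ->]].
      by rewrite (le_trans l1 h1) (le_trans l2 h2) (le_trans l3 h3).
    have mQ' := measurable_obox lo' hi.
    have tst n := box_bump_test n lh sub2.
    have mb n : measurable_fun (setT : set T3) (box_bump n lo' hi).
      by apply: continuous_measurable3; have [/(_ [::])[]] := tst n.
    have : \int[leb3]_x (g x * box_bump n lo' hi x) @[n --> \oo] -->
        \int[leb3]_x (g x * \1_(obox lo' hi) x).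
      apply: (Rint_dct _ _ ig1).
      - by move=> n; exact: measurable_funM.
      - by apply: measurable_funM => //; exact: measurable_indic.
      - move=> n x; rewrite normrM ler_wpM2l// indicE.
        have /andP[b0 b1] := box_bump_01 n lo' hi x.
        rewrite ger0_norm//; have [//|/negP nx] := boolP (x \in obox lo hi).
        rewrite box_bump_out// => xQ; apply: nx; apply/mem_set; exact: sub1.
      - apply: aeW => x; apply: cvgM; first exact: cvg_cst.
        rewrite indicE; have [/set_mem xQ|/negP nx] := boolP (x \in obox lo' hi).
          exact: box_bump_cvg.
        rewrite (_ : (fun n => _) = fun=> 0); first exact: cvg_cst.
        by apply/funext => n; rewrite box_bump_out// => xQ; apply: nx; exact/mem_set.
    rewrite (_ : (fun n => _) = fun=> 0); last by apply/funext => n; exact: h.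
    move=> /(cvg_unique (@norm_hausdorff _ _) (cvg_cst (0 : R))) /esym E.
    have : (\int[leb3]_x (g x * \1_(obox lo' hi) x))%:E = 0%E by rewrite E.
    rewrite EFin_Rint; last by exact: l2M (obox_indic_l2 _ _).
    move=> E'; rewrite integral_mkcond; apply: etrans E'; apply: eq_integral => x _.
    by rewrite patchE indicE /=; case: (_ \in _); rewrite ?mulr1 ?mulr0.
  have ha : ae_eq leb3 (obox lo hi) (EFin \o g) (cst 0%E).
    apply: (@integral_ae_eq _ _ _ leb3 _ mQ (cst 0%E) (EFin \o g) igQ (measurable_cst _)).
    by move=> A AQ mA; rewrite integral0; exact: hz.
  by apply: (ae_imp ha) => x E Q; have [] := E Q.
have : {ae leb3, forall x, forall n : nat, forall k, unpickle n = Some k ->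
    cbox (qpt R k.1) (qpt R k.2) `<=` Om -> obox (qpt R k.1) (qpt R k.2) x -> g x = 0}.
  apply: ae_foralln => n.
  case E : (unpickle n) => [k|]; last by apply: aeW => x k.
  have [hk|hk] := pselect (cbox (qpt R k.1) (qpt R k.2) `<=` Om).
    by apply: (ae_imp (box _ _ hk)) => x hx k' [<-] _.
  by apply: aeW => x k' [<-].
move=> ha; apply: (ae_imp ha) => x hx; rewrite {1}(open_union oOm) => -[k /= hk xk].
exact: (hx (pickle k) k (pickleK k)).
Qed.

End FundamentalLemma.

(** * Bounded coercive tensors *)

Section PointwiseMatrices.
Variable R : realType.
Implicit Types (A : 'M[R]_3) (xi eta : 'cV[R]_3).

Lemma dot_sum xi eta : dot xi eta = \sum_i xi i 0 * eta i 0.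
Proof. by rewrite /dot mxE; apply: eq_bigr => i _; rewrite mxE. Qed.

Lemma dotC xi eta : dot xi eta = dot eta xi.
Proof. by rewrite !dot_sum; apply: eq_bigr => i _; rewrite mulrC. Qed.

Lemma dot_ge0 xi : 0 <= dot xi xi.
Proof. by rewrite dot_sum sumr_ge0// => i _; rewrite -expr2 sqr_ge0. Qed.

Lemma dotZl a xi eta : dot (a *: xi) eta = a * dot xi eta.
Proof. by rewrite !dot_sum mulr_sumr; apply: eq_bigr => i _; rewrite mxE mulrA. Qed.

Lemma dot_eq0 xi : dot xi xi <= 0 -> xi = 0.
Proof.
move=> h; have h0 : dot xi xi = 0 by apply/eqP; rewrite eq_le h dot_ge0.
move: h0; rewrite dot_sum => /eqP; rewrite psumr_eq0 => [/allP E|i _]; last by rewrite -expr2 sqr_ge0.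
apply/matrixP => i j; rewrite ord1 mxE.
by have := E i (mem_index_enum i); rewrite /= mulf_eq0 orbb => /eqP.
Qed.

Lemma dot_sym A xi eta : A^T = A -> dot (A *m xi) eta = dot xi (A *m eta).
Proof. by move=> sA; rewrite /dot trmx_mul sA mulmxA. Qed.

(** Three rows, each contributing C^2 (x + y + z)^2 <= 3 C^2 (x^2 + y^2 + z^2), give the factor 9
    C^2. *)
Lemma dot_mulmx_le A (C : R) xi : (forall i j, `|A i j| <= C) ->
  dot (A *m xi) (A *m xi) <= (3 * C) ^+ 2 * dot xi xi.
Proof.
move=> AC; have C0 : 0 <= C := le_trans (normr_ge0 _) (AC 0 0).
have E i : (A *m xi) i 0 * (A *m xi) i 0 <= 3 * C ^+ 2 * dot xi xi.
  have -> : (A *m xi) i 0 * (A *m xi) i 0 = `|(A *m xi) i 0| ^+ 2.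
    by rewrite real_normK ?num_real// expr2.
  apply: (@le_trans _ _ ((\sum_j C * `|xi j 0|) ^+ 2)).
    rewrite ler_pXn2r// ?nnegrE ?sumr_ge0//; last by move=> j _; apply: mulr_ge0.
    rewrite mxE; apply: le_trans (ler_norm_sum _ _ _) _; apply: ler_sum => j _.
    by rewrite normrM ler_wpM2r.
  rewrite dot_sum !big_ord_recl !big_ord0 -!expr2.
  rewrite -[xi ord0 0 ^+ 2]real_normK ?num_real//.
  rewrite -[xi (lift ord0 ord0) 0 ^+ 2]real_normK ?num_real//.
  rewrite -[xi (lift ord0 (lift ord0 ord0)) 0 ^+ 2]real_normK ?num_real//.
  set x := `|_|; set y := `|_|; set z := `|_|.
  have := sqr_ge0 (x - y); have := sqr_ge0 (y - z); have := sqr_ge0 (x - z).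
  have := sqr_ge0 C; move=> c2 xz yz xy.
  rewrite (_ : (_ + _) ^+ 2 = C ^+ 2 * (x + y + z) ^+ 2); last by ring.
  rewrite [leRHS](_ : _ = C ^+ 2 * (3 * (x ^+ 2 + y ^+ 2 + z ^+ 2))); last by ring.
  apply: ler_wpM2l => //; nra.
rewrite [leLHS]dot_sum; apply: le_trans (ler_sum _ (fun i _ => E i)) _.
rewrite sumr_const card_ord -mulr_natl; rewrite le_eqVlt; apply/orP; left; apply/eqP; ring.
Qed.

Lemma coercive_unitmx A (a : R) : 0 < a ->
  (forall xi, a * dot xi xi <= dot xi (A *m xi)) -> A \in unitmx.
Proof.
move=> a0 hA; rewrite -row_free_unit -kermx_eq0; apply/eqP/row_matrixP => i.
rewrite row0; apply: trmx_inj; rewrite trmx0; apply: dot_eq0.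
have := hA (row i (kermx A))^T; rewrite {2}/dot trmxK mulmxA -row_mul mulmx_ker row0 mul0mx mxE.
by rewrite pmulr_rle0.
Qed.

(** With [xi = A^-1 eta], the form at [eta] equals (xi, A xi) >= a |xi|^2, while |eta|^2 <= (3 C)^2
    |xi|^2. The [+ 1] keeps the denominator positive. *)
Lemma inv_coercive A (a C : R) : 0 < a -> (forall i j, `|A i j| <= C) ->
  (forall xi, a * dot xi xi <= dot xi (A *m xi)) ->
  forall eta, a / ((3 * C) ^+ 2 + 1) * dot eta eta <= dot eta (invmx A *m eta).
Proof.
move=> a0 AC hA eta; have uA := coercive_unitmx a0 hA.
have E : eta = A *m (invmx A *m eta) by rewrite mulmxA mulmxV// mul1mx.
set xi := invmx A *m eta in E *; rewrite {3}E dotC; apply: le_trans (hA xi).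
have K0 : 0 < (3 * C) ^+ 2 + 1 by rewrite ltr_wpDl ?sqr_ge0.
rewrite -mulrA ler_pM2l// mulrC ler_pdivrMr// mulrC {1 2}E.
by apply: le_trans (dot_mulmx_le xi AC) _; rewrite ler_wpM2r ?dot_ge0// lerDl.
Qed.

(** If [xi] is column [j] of the inverse, then a |xi|^2 <= (xi, A xi) = xi_j. First xi_j <= 1/a,
    then |xi|^2 <= 1/a^2. *)
Lemma inv_bound A (a : R) : 0 < a ->
  (forall xi, a * dot xi xi <= dot xi (A *m xi)) -> forall i j, `|invmx A i j| <= a^-1.
Proof.
move=> a0 hA i j; have uA := coercive_unitmx a0 hA.
pose e : 'cV[R]_3 := delta_mx j 0; pose xi := invmx A *m e.
have xiE k : xi k 0 = invmx A k j.
  by rewrite /xi /e mxE (bigD1 j)//= big1 ?addr0 ?mxE ?eqxx ?mulr1// => l lj; rewrite !mxE (negbTE lj) mulr0.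
have h : a * dot xi xi <= xi j 0.
  apply: le_trans (hA xi) _; rewrite mulmxA mulmxV// mul1mx dot_sum (bigD1 j)//=.
  by rewrite big1 ?addr0 ?mxE ?eqxx ?mulr1// => l lj; rewrite [e _ _]mxE (negbTE lj) mulr0.
have s k : xi k 0 ^+ 2 <= dot xi xi.
  rewrite dot_sum (bigD1 k)//= -expr2 lerDl sumr_ge0// => l _; rewrite -expr2; exact: sqr_ge0.
have xj : xi j 0 <= a^-1.
  have := le_trans (ler_wpM2l (ltW a0) (s j)) h; rewrite expr2 mulrA => hj.
  have [x0|x0] := leP (xi j 0) 0; first by rewrite (le_trans x0)// invr_ge0 ltW.
  by rewrite -(ler_pM2l a0) mulfV ?gt_eqF// -(ler_pM2r x0) mul1r.
have : xi i 0 ^+ 2 <= a^-1 ^+ 2.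
  apply: le_trans (s i) _; rewrite expr2 -(ler_pM2l a0) mulrA mulfV ?gt_eqF// mul1r.
  exact: le_trans h xj.
by rewrite -xiE -[xi i 0 ^+ 2]real_normK ?num_real// ler_pXn2r// ?nnegrE// invr_ge0 ltW.
Qed.

Lemma sqrtmxP A : A^T = A -> psd A ->
  [/\ (sqrtmx A)^T = sqrtmx A, psd (sqrtmx A) & sqrtmx A *m sqrtmx A = A].
Proof.
move=> sA pA; rewrite /sqrtmx; have [S hS] := sqrt_exists sA pA.
by case: xgetP => [S' _|/(_ S)//].
Qed.

Lemma sqrtmx_dot A xi : A^T = A -> psd A ->
  dot (sqrtmx A *m xi) (sqrtmx A *m xi) = dot (A *m xi) xi.
Proof.
move=> sA pA; have [sS _ SS] := sqrtmxP sA pA.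
by rewrite (dot_sym _ _ sS) mulmxA SS (dot_sym _ _ sA).
Qed.

Lemma coercive_psd A (a : R) : 0 <= a ->
  (forall xi, a * dot xi xi <= dot xi (A *m xi)) -> psd A.
Proof. by move=> a0 h xi; apply: le_trans (h xi); apply: mulr_ge0 => //; exact: dot_ge0. Qed.

End PointwiseMatrices.

Section MatrixMeasurability.
Context d (T : measurableType d) (R : realType).

Lemma measurable_inv (f : T -> R) : measurable_fun setT f ->
  measurable_fun setT (fun x => (f x)^-1).
Proof.
move=> mf; rewrite (_ : (fun x => _) = fun x => f x * (f x ^+ 2) `^ (-1)).
  apply: measurable_funM => //; apply: (measurableT_comp (@measurable_powR R (-1))).
  exact: measurable_funX.
apply/funext => x; rewrite powR_inv1 ?sqr_ge0//.
have [->|f0] := eqVneq (f x) 0; first by rewrite invr0 mul0r.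
by rewrite expr2 invfM mulrA mulfV// mul1r.
Qed.

Lemma measurable_det n (A : T -> 'M[R]_n) : (forall i j, measurable_fun setT (fun x => A x i j)) ->
  measurable_fun setT (fun x => \det (A x)).
Proof.
move=> mA; rewrite /determinant; apply: measurable_sum => s.
apply: measurable_funM; first exact: measurable_cst.
by apply: measurable_prod => i _; exact: mA.
Qed.

Lemma measurable_invmx n (A : T -> 'M[R]_n) : (forall i j, measurable_fun setT (fun x => A x i j)) ->
  forall i j, measurable_fun setT (fun x => invmx (A x) i j).
Proof.
move=> mA i j; have md := measurable_det mA.
(* [invmx] returns the matrix itself when it is singular, so measurability is proved by cases on the
   determinant. *)
rewrite (_ : (fun x => _) = fun x => if \det (A x) == 0 then A x i j
    else (\det (A x))^-1 * cofactor (A x) j i); last first.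
  apply/funext => x; rewrite /invmx unitmxE unitfE.
  by case: eqP => //= _; rewrite !mxE.
apply: measurable_fun_ifT => //.
  by apply: measurable_fun_eqr => //; exact: measurable_cst.
apply: measurable_funM; first exact: measurable_inv.
rewrite /cofactor; apply: measurable_funM; first exact: measurable_cst.
apply: measurable_det => k l.
rewrite (_ : (fun x => _) = fun x => A x (lift j k) (lift i l)); first exact: mA.
by apply/funext => x; rewrite !mxE.
Qed.

Variable mu : {measure set T -> \bar R}.

Lemma Linfty_bounded (g : T -> R) : g \in Lfun mu +oo%E ->
  measurable_fun setT g /\ exists C, {ae mu, forall x, `|g x| <= C}.
Proof.
move=> /andP[]; rewrite !inE /= => mg; rewrite /finite_norm unlock /Lnorm.body => foo; split=> //.
(* On a space of measure zero the norm is fixed by convention and carries no information, but there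
   every bound holds almost everywhere. *)
move: foo; case: ifPn => [m0 foo|m0 _]; last first.
  exists 0; exists setT; split => //; apply/eqP; rewrite eq_le measure_ge0 andbT leNgt.
  exact: m0.
have h0 : (0 <= ess_sup mu (abse \o (EFin \o g)))%E.
  by apply: ess_sup_gee => //; apply: aeW => x; exact: abse_ge0.
exists (fine (ess_sup mu (abse \o (EFin \o g)))).
apply: (ae_imp (ess_sup_ge mu (abse \o (EFin \o g)))) => x /= h.
by rewrite -lee_fin fineK// ge0_fin_numE.
Qed.

Lemma l2_ae_le (f g : T -> R) C : measurable_fun setT f -> l2 mu g ->
  {ae mu, forall x, `|f x| <= C * `|g x|} -> l2 mu f.
Proof.
move=> mf lg h; split=> //; apply: ge0_ig; [exact: measurable_funX|by move=> x; exact: sqr_ge0|].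
have ig2 : ig mu (fun x => C ^+ 2 * g x ^+ 2) by apply: igZ; exact: lg.2.
apply: le_lt_trans (_ : (\int[mu]_x (C ^+ 2 * g x ^+ 2)%:E < +oo)%E); last first.
  by rewrite -EFin_Rint// ltry.
apply: ge0_ae_le_integral_nonmeas => [x _|x _|].
- by rewrite lee_fin sqr_ge0.
- by rewrite lee_fin; apply: mulr_ge0; exact: sqr_ge0.
apply: (ae_imp h) => x hx _; rewrite lee_fin -[f x ^+ 2]real_normK ?num_real//.
rewrite -[g x ^+ 2]real_normK ?num_real// -exprMn ler_pXn2r// ?nnegrE//.
exact: le_trans hx.
Qed.

Lemma le_Rint_ae f g : ig mu f -> ig mu g -> {ae mu, forall x, f x <= g x} ->
  \int[mu]_x f x <= \int[mu]_x g x.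
Proof.
move=> hf hg h; rewrite -subr_ge0 -RintB//.
rewrite (@Rint_ae_eq _ _ _ mu _ (fun x => `|g x - f x|)).
  by apply: Rintegral_ge0.
by apply: (ae_imp h) => x hx; rewrite ger0_norm ?subr_ge0.
Qed.

End MatrixMeasurability.

Section Tensors.
Variables (R : realType) (Om : set (pt R)).
Local Notation T3 := (measurableTypeR R * measurableTypeR R * measurableTypeR R)%type.
Hypothesis mOm : measurable (Om : set T3).
Implicit Types (u v w : field R) (A : tensor R).
Local Notation D := (dom (L2 Om)).
Local Notation p := (ip Om).

Lemma ae_dom_le (u v u' v' : field R) : D u -> D v -> D u' -> D v' ->
  {ae leb3, forall x, Om x -> dot (u x) (v x) <= dot (u' x) (v' x)} -> p u v <= p u' v'.
Proof.
have E w w' : D w -> D w' -> ig leb3 ((fun x => dot (w x) (w' x)) \_ Om).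
  move=> /domP hw /domP hw'.
  rewrite (_ : _ \_ _ = fun x => \sum_i comp Om w i x * comp Om w' i x).
    rewrite (_ : (fun x => _) = fun x => comp Om w 0 x * comp Om w' 0 x +
      (comp Om w 1 x * comp Om w' 1 x + comp Om w 2%:R x * comp Om w' 2%:R x)).
      by apply: igD; [|apply: igD]; exact: l2M.
    apply/funext => x; rewrite !big_ord_recl big_ord0 addr0.
    by do 2![congr (_ + _)]; congr (comp _ _ _ _ * comp _ _ _ _); apply: val_inj.
  apply/funext => x; rewrite patchE dot_sum; case: ifPn => xOm.
    by apply: eq_bigr => i _; rewrite !compE indicE xOm !mul1r.
  by rewrite big1// => i _; rewrite compE indicE (negbTE xOm) !mul0r.
move=> hu hv hu' hv' h; rewrite /ip Rintegral_mkcond [leRHS]Rintegral_mkcond; apply: le_Rint_ae; [exact: E|exact: E|].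
by apply: (ae_imp h) => x hx; rewrite !patchE; case: ifPn => [/set_mem|//].
Qed.

Lemma ae_dom_eq (u v u' v' : field R) :
  {ae leb3, forall x, Om x -> dot (u x) (v x) = dot (u' x) (v' x)} -> p u v = p u' v'.
Proof. by move=> h; rewrite /ip; exact: ae_eq_Rintegral_nonmeas. Qed.

Definition bounded_tensor A C := (forall i j, measurable_fun (setT : set T3) ((fun x => A x i j) \_ Om)) /\
  {ae leb3, forall x, Om x -> forall i j, `|A x i j| <= C}.

Lemma in_Linfty_bounded A : in_Linfty Om A -> exists C, 0 <= C /\ bounded_tensor A C.
Proof.
move=> hA; have /choice[C hC] : forall ij : 'I_3 * 'I_3, exists C,
    {ae leb3, forall x, `|((fun x => A x ij.1 ij.2) \_ Om) x| <= C}.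
  by move=> [i j]; have [_] := Linfty_bounded (hA i j).
exists (\sum_ij `|C ij|); split; first exact: sumr_ge0.
split; first by move=> i j; have [] := Linfty_bounded (hA i j).
have : {ae leb3, forall x, forall ij : 'I_3 * 'I_3, `|((fun x => A x ij.1 ij.2) \_ Om) x| <= C ij}.
  have : {ae leb3, forall x, forall n : nat, forall ij : 'I_3 * 'I_3, unpickle n = Some ij ->
      `|((fun x => A x ij.1 ij.2) \_ Om) x| <= C ij}.
    apply: ae_foralln => n; case E : (unpickle n) => [ij|]; last by apply: aeW => x ij.
    by apply: (ae_imp (hC ij)) => x hx ij' [<-].
  by move=> h; apply: (ae_imp h) => x hx ij; exact: (hx (pickle ij) ij (pickleK ij)).
move=> h; apply: (ae_imp h) => x hx Omx i j; have := hx (i, j); rewrite patchE mem_set//= => /le_trans; apply.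
by rewrite (bigD1 (i, j))//= (le_trans (ler_norm _))// lerDl sumr_ge0.
Qed.

Lemma tensor_linear A : linear (tensor_app A).
Proof.
move=> a u v; apply/funext => x.
rewrite /tensor_app (_ : (a *: u + v) x = a *: u x + v x)// mulmxDr -scalemxAr.
by [].
Qed.

Lemma tensor_dom A C v : bounded_tensor A C -> D v -> D (tensor_app A v).
Proof.
move=> [mA bA] /domP hv; apply/domP => i.
have E : comp Om (tensor_app A v) i = fun x => \sum_j ((fun x => A x i j) \_ Om) x * comp Om v j x.
  apply/funext => x; rewrite compE indicE [X in _ * X]mxE mulr_sumr; apply: eq_bigr => j _.
  by rewrite compE patchE indicE; case: (_ \in _); rewrite ?mul1r ?mul0r.
have l2t j : l2 leb3 (fun x => ((fun x => A x i j) \_ Om) x * comp Om v j x).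
  apply: (@l2_ae_le _ _ _ leb3 _ (comp Om v j) C) => //.
    by apply: measurable_funM; [exact: mA|exact: (hv j).1].
  apply: (ae_imp bA) => x hx; rewrite normrM patchE; case: ifPn => [/set_mem xOm|xOm].
    by rewrite ler_wpM2r// hx.
  by rewrite compE indicE (negbTE xOm) mul0r normr0 !mulr0.
rewrite E (_ : (fun x => _) = fun x => 1 * (((fun x => A x i 0) \_ Om) x * comp Om v 0 x) +
   (1 * (((fun x => A x i 1) \_ Om) x * comp Om v 1 x) + ((fun x => A x i 2%:R) \_ Om) x * comp Om v 2%:R x)).
  by apply: l2_lin => //; exact: l2_lin.
apply/funext => x; rewrite !mul1r !big_ord_recl big_ord0 addr0.
have -> : lift ord0 ord0 = 1 :> 'I_3 by exact: val_inj.
by have -> : lift ord0 (lift ord0 ord0) = 2%:R :> 'I_3 by exact: val_inj.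
Qed.

Lemma tensor_bounded_symmetric A C : 0 <= C -> bounded_tensor A C -> symmetric_tensor Om A ->
  bounded_symmetric D p (tensor_app A) (3 * C).
Proof.
move=> C0 bA sA; have H := L2_semihilbert Om.
split; [by move=> u; exact: tensor_dom bA|exact: tensor_linear| |].
  move=> u v Du Dv; apply: ae_dom_eq; apply: (ae_imp sA) => x hx Omx.
  exact: dot_sym (hx Omx).
move=> u Du; have DA := tensor_dom bA Du.
have C3 : 0 <= 3 * C by apply: mulr_ge0.
have Du' : D ((3 * C) *: u) by exact: (shDZ H).
have : p (tensor_app A u) (tensor_app A u) <= p ((3 * C) *: u) ((3 * C) *: u).
  apply: ae_dom_le => //; apply: (ae_imp bA.2) => x hx Omx.
  rewrite (_ : ((3 * C) *: u) x = (3 * C) *: u x)// dotZl dotC dotZl mulrA -expr2.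
  exact: dot_mulmx_le (hx Omx).
rewrite -(ler_sqrt _ (sh_ge0 H Du')) => /le_trans; apply.
by have := hnormZ H (3 * C) Du; rewrite /hnorm => ->; rewrite ger0_norm.
Qed.

Lemma tensor_coercive A C a u : bounded_tensor A C -> coercive Om a A -> D u ->
  a * p u u <= p (tensor_app A u) u.
Proof.
move=> bA cA Du; have H := L2_semihilbert Om; rewrite -(shpZl H)//.
apply: ae_dom_le => //; [exact: (shDZ H)|exact: tensor_dom bA Du|].
apply: (ae_imp cA) => x hx Omx; rewrite (_ : (a *: u) x = a *: u x)// dotZl [leRHS]dotC.
exact: hx.
Qed.

Lemma inv_tensor_bounded A C a : 0 < a -> bounded_tensor A C -> coercive Om a A ->
  bounded_tensor (inv_tensor A) a^-1.
Proof.
move=> a0 [mA bA] cA; split=> [i j|]; last first.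
  by apply: (ae_imp cA) => x hx Omx i j; exact: inv_bound (hx Omx) _ _.
(* The entries are measurable only after extension by zero; the inverse of the extended matrix is
   then cut to [Om], where it is the inverse of [A]. *)
pose At (x : T3) : 'M[R]_3 := \matrix_(k, l) ((fun x => A x k l) \_ Om) x.
rewrite (_ : _ \_ _ = fun x : T3 => \1_Om x * invmx (At x) i j).
  apply: measurable_funM; first exact: (@measurable_indic _ _ R setT _ mOm).
  apply: measurable_invmx => k l; rewrite (_ : (fun x => _) = (fun x => A x k l) \_ Om); first exact: mA.
  by apply/funext => x; rewrite mxE.
apply/funext => x; rewrite patchE indicE; case: ifPn => xOm; last by rewrite mul0r.
rewrite mul1r /inv_tensor; congr (invmx _ i j).
by apply/matrixP => k l; rewrite mxE patchE xOm.
Qed.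

Lemma inv_tensor_symmetric A : symmetric_tensor Om A -> symmetric_tensor Om (inv_tensor A).
Proof. by move=> sA; apply: (ae_imp sA) => x hx Omx; rewrite /inv_tensor trmx_inv hx. Qed.

Lemma inv_tensor_coercive A C a : 0 < a -> bounded_tensor A C -> coercive Om a A ->
  coercive Om (a / ((3 * C) ^+ 2 + 1)) (inv_tensor A).
Proof.
move=> a0 [_ bA] cA; apply: (ae_imp2 bA cA) => x hx hx' Omx.
exact: inv_coercive (hx Omx) (hx' Omx).
Qed.

Lemma L2nrm_sqrt_tensor A C a u : 0 <= a -> bounded_tensor A C -> coercive Om a A ->
  symmetric_tensor Om A -> D u ->
  L2nrm Om (tensor_app (sqrt_tensor A) u) ^+ 2 = p (tensor_app A u) u.
Proof.
move=> a0 bA cA sA Du; rewrite /L2nrm.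
have -> : p (tensor_app (sqrt_tensor A) u) (tensor_app (sqrt_tensor A) u) = p (tensor_app A u) u.
  apply: ae_dom_eq; apply: (ae_imp2 cA sA) => x hx hx' Omx.
  exact: (sqrtmx_dot _ (hx' Omx) (coercive_psd a0 (hx Omx))).
rewrite sqr_sqrtr//; apply: le_trans (tensor_coercive bA cA Du).
by apply: mulr_ge0 => //; exact: (sh_ge0 (L2_semihilbert Om)).
Qed.

End Tensors.

(** * Weak curl *)

(* The library proves this, but keeps the instance local to a section. *)
Lemma lebesgue2_sigma_finite (R : realType) :
  sigma_finite setT ((@lebesgue_measure R \x @lebesgue_measure R)%E).
Proof.
have /sigma_finiteP[F [FT Fn Foo]] := sigma_finiteT (@lebesgue_measure R).
exists (fun n => F n `*` F n) => [|n].
  apply/seteqP; split=> // -[x y] _.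
  have [[n _ nx] [m _ my]] : (\bigcup_i F i) x /\ (\bigcup_i F i) y by rewrite -FT.
  exists (maxn n m) => //; split=> /=.
    by have /subsetPset := Fn _ _ (leq_maxl n m); exact.
  by have /subsetPset := Fn _ _ (leq_maxr n m); exact.
have [mF oo] := Foo n; split; first exact: measurableX.
apply: (@le_lt_trans _ _ (lebesgue_measure (F n) * lebesgue_measure (F n))%E).
  by rewrite le_eqVlt; apply/orP; left; apply/eqP; exact: product_measure1E.
by apply: lte_mul_pinfty => //; rewrite ge0_fin_numE.
Qed.

Definition lebesgue2 (R : realType) : set (measurableTypeR R * measurableTypeR R) -> \bar R :=
  (@lebesgue_measure R \x @lebesgue_measure R)%E.

HB.instance Definition _ (R : realType) :=
  Measure.copy (@lebesgue2 R) (@lebesgue_measure R \x @lebesgue_measure R)%E.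

HB.instance Definition _ (R : realType) :=
  Measure_isSigmaFinite.Build _ _ _ (@lebesgue2 R) (lebesgue2_sigma_finite R).

(** * Compactly supported functions and integration by parts *)

Section IntegrationByParts.
Variable R : realType.
Local Notation T1 := (measurableTypeR R).
Local Notation T3 := (T1 * T1 * T1)%type.
Local Notation leb := (@lebesgue_measure R).
Implicit Types (g : pt R -> R) (x : pt R) (Om K : set (pt R)).

Lemma partial_zero_off (j : 'I_3) g K : compact K -> (forall x, ~ K x -> g x = 0) ->
  forall x, ~ K x -> partial j g x = 0.
Proof.
move=> cK g0 x nKx; rewrite /partial (near_eq_derive (g := cst 0)); first exact: derive_cst.
have oK : open (~` K) by apply: closed_openC; apply: compact_closed => //; exact: norm_hausdorff.
by apply: filterS (open_nbhs_nbhs (conj oK nKx)) => y; exact: g0.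
Qed.

Lemma compact_in_cube K : compact K -> exists M, 0 < M /\
  forall x, K x -> [/\ `|x.1.1| <= M, `|x.1.2| <= M & `|x.2| <= M].
Proof.
move=> /compact_bounded[M [_ hM]]; exists (`|M| + 1); split; first by rewrite ltr_wpDl.
move=> x Kx; have := hM (`|M| + 1) _ x Kx; rewrite (le_lt_trans (ler_norm M)) ?ltrDl// => /(_ isT).
by rewrite /= !prod_normE/= !ge_max => /andP[/andP[h1 h2] h3]; split.
Qed.

Lemma compact_support_bounded g K : compact K -> continuous g ->
  (forall x, ~ K x -> g x = 0) -> exists C, 0 <= C /\ forall x, `|g x| <= C.
Proof.
move=> cK cg g0.
have /compact_bounded[M [_ hM]] : compact (g @` K).
  by apply: continuous_compact => //; exact: continuous_subspaceT.
exists (`|M| + 1); split; first exact: addr_ge0.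
move=> x; have [Kx|nKx] := pselect (K x); last by rewrite g0// normr0 addr_ge0.
apply: (hM (`|M| + 1)); last by exists x.
by rewrite (le_lt_trans (ler_norm M))// ltrDl.
Qed.

Lemma compact_support_l2 g K : compact K -> continuous g ->
  (forall x, ~ K x -> g x = 0) -> l2 leb3 g.
Proof.
move=> cK cg g0; have [C [C0 gC]] := compact_support_bounded cK cg g0.
have [M [M0 KM]] := compact_in_cube cK.
pose lo : pt R := (- (M + 1), - (M + 1), - (M + 1)); pose hi : pt R := (M + 1, M + 1, M + 1).
have mg := continuous_measurable3 cg.
rewrite (_ : g = fun x => g x * \1_(obox lo hi) x).
  exact: l2_mul_bounded mg gC (obox_indic_l2 lo hi).
apply/funext => x; rewrite indicE; have [xQ|/negP xQ] := boolP (x \in obox lo hi); first by rewrite mulr1.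
rewrite mulr0 g0// => /KM[]; rewrite !ler_norml => /andP[h1 h2] /andP[h3 h4] /andP[h5 h6].
by apply: xQ; apply/mem_set; rewrite /obox /= !in_itv/=; split; [split|]; apply/andP; split; lra.
Qed.

Lemma compact_support_ig g K : compact K -> continuous g ->
  (forall x, ~ K x -> g x = 0) -> ig leb3 g.
Proof.
move=> cK cg g0; have lg := compact_support_l2 cK cg g0.
have [M [M0 KM]] := compact_in_cube cK.
pose lo : pt R := (- (M + 1), - (M + 1), - (M + 1)); pose hi : pt R := (M + 1, M + 1, M + 1).
rewrite (_ : g = fun x => g x * \1_(obox lo hi) x); first exact: l2M (obox_indic_l2 lo hi).
apply/funext => x; rewrite indicE; have [xQ|/negP xQ] := boolP (x \in obox lo hi); first by rewrite mulr1.
rewrite mulr0 g0// => /KM[]; rewrite !ler_norml => /andP[h1 h2] /andP[h3 h4] /andP[h5 h6].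
by apply: xQ; apply/mem_set; rewrite /obox /= !in_itv/=; split; [split|]; apply/andP; split; lra.
Qed.

Lemma integral_derivative0 (k k' : R -> R) M : 0 < M -> (forall t : R, is_derive t 1 k (k' t)) ->
  continuous k' -> (forall t, M < `|t| -> k t = 0) -> (\int[leb]_t (k' t)%:E = 0)%E.
Proof.
move=> M0 hk ck k0.
have z t : t < - M \/ M < t -> k t = 0.
  by move=> h; apply: k0; rewrite ltr_normr; apply/orP; case: h; [right; lra|left].
have z' := der_zero_outside hk z.
have st : - (M + 1) <= M + 1 by lra.
have : k (M + 1) - k (- (M + 1)) = \int[leb]_(x in `[- (M + 1), M + 1]) k' x.
  by apply: FTC_cont.
rewrite !z ?subrr; [|left; lra|right; lra].
rewrite Rint_itvE => E.
have fin : (\int[leb]_t (k' t)%:E)%E \is a fin_num.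
  have [C [C0 hC]] := cont_bounded_outside ck z'.
  have : ig leb k'.
    apply: (@ig_le _ _ _ leb (fun t => C * \1_(`[- (M + 1), M + 1]%classic : set R) t)).
    - exact: continuous_measurable_fun.
    - by apply: igZ; exact: itv_indic_ig.
    move=> t; rewrite indicE; have [_|tI] := boolP (t \in _); first by rewrite mulr1.
    rewrite z' ?normr0 ?mulr0//; move/negP: tI => tI.
    have [h|h] := ltP t (- M); [by left|right; rewrite ltNge; apply/negP => h'].
    by apply: tI; apply/mem_set; rewrite /= in_itv/=; apply/andP; split; lra.
  exact: integrable_fin_num.
rewrite -(fineK fin); congr EFin; rewrite [RHS]E; apply: eq_Rintegral => t _.
rewrite indicE; have [_|tI] := boolP (t \in _); first by rewrite mul1r.
rewrite mul0r z'//; move/negP: tI => tI.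
have [h|h] := ltP t (- M); [by left|right; rewrite ltNge; apply/negP => h'].
by apply: tI; apply/mem_set; rewrite /= in_itv/=; apply/andP; split; lra.
Qed.

Lemma line_integral0 (j : 'I_3) g K x : compact K -> (forall x, ~ K x -> g x = 0) ->
  (forall x, derivable g x (Defs.basis j)) -> continuous (partial j g) ->
  (\int[leb]_t (partial j g (t *: Defs.basis j + x))%:E = 0)%E.
Proof.
move=> cK g0 dg cg; have [M [M0 KM]] := compact_in_cube cK.
pose M' := M + `|x.1.1| + `|x.1.2| + `|x.2|.
apply: (@integral_derivative0 (fun t => g (t *: Defs.basis j + x)) _ M').
- by rewrite /M' -!addrA ltr_pwDl// !addr_ge0.
- by move=> t; apply: (iffLR (is_derive_line g x _ t _)); exact: derivableP.
- move=> t; apply: continuous_comp; last exact: cg.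
  by apply: cvgD; [apply: cvgZr_tmp|exact: cvg_cst].
move=> t ht; apply: g0 => /KM; rewrite /Defs.basis /=.
have nt (a : R) : `|t * 1 + a| <= M -> `|t| <= M + `|a|.
  rewrite mulr1 => h; rewrite -[t](addrK a) (le_trans (ler_normB _ _))//; exact: lerD.
have := normr_ge0 x.1.1; have := normr_ge0 x.1.2; have := normr_ge0 x.2 => h1 h2 h3.
case: j {dg cg} => [[|[|[|//]]] hj] /= [] a1 a2 a3.
- by have := nt _ a1; move: ht; rewrite /M'; lra.
- by have := nt _ a2; move: ht; rewrite /M'; lra.
- by have := nt _ a3; move: ht; rewrite /M'; lra.
Qed.

(** Along each line in direction [j] the integral is zero. The three cases differ only in the order
    of the iterated integrals that puts coordinate [j] innermost in the nested product. *)
Lemma integral_partial0 (j : 'I_3) g K : compact K -> (forall x, ~ K x -> g x = 0) ->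
  (forall x, derivable g x (Defs.basis j)) -> continuous (partial j g) ->
  \int[leb3]_x partial j g x = 0.
Proof.
move=> cK g0 dg cg; have line x := @line_integral0 j g K x cK g0 dg cg.
pose h : T3 -> \bar R := EFin \o partial j g.
have ih0 := compact_support_ig cK cg (@partial_zero_off j g K cK g0).
have ih : leb3.-integrable setT h := ih0.
suff E : (\int[leb3]_x h x = 0)%E by rewrite /Rintegral [X in fine X]E.
have base2 (t a b : R) : t *: Defs.basis 2%:R + (a, b, 0) = (a, b, t) :> pt R.
  by rewrite [LHS](_ : _ = (t * 0 + a, t * 0 + b, t * 1 + 0))// !mulr0 !add0r mulr1 addr0.
have base1 (t a c : R) : t *: Defs.basis 1 + (a, 0, c) = (a, t, c) :> pt R.
  by rewrite [LHS](_ : _ = (t * 0 + a, t * 1 + 0, t * 0 + c))// !mulr0 !add0r mulr1 addr0.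
have base0 (t b c : R) : t *: Defs.basis 0 + (0, b, c) = (t, b, c) :> pt R.
  by rewrite [LHS](_ : _ = (t * 1 + 0, t * 0 + b, t * 0 + c))// !mulr0 !add0r mulr1 addr0.
have [j2|j2] := eqVneq j 2%:R.
  refine (etrans (esym (@integral12_prod_meas1 _ _ _ _ R (@lebesgue2 R) leb h ih)) _).
  apply: (@integral0_eq _ _ _ (@lebesgue2 R)) => -[a b] _.
  rewrite -(line (a, b, 0)); apply: eq_integral => t _.
  by have -> : t *: Defs.basis j + (a, b, 0) = (a, b, t) by rewrite j2 base2.
refine (etrans (esym (@integral21_prod_meas1 _ _ _ _ R (@lebesgue2 R) leb h ih)) _).
rewrite (@ae_eq_integral_nonmeas _ _ _ leb setT _ (cst 0%E)) ?integral0//.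
apply: (ae_imp (@ae_integrable2 _ _ _ _ R (@lebesgue2 R) leb h ih)) => c ic _.
have [j1|j1] := eqVneq j 1.
  refine (etrans (esym (@integral12_prod_meas1 _ _ _ _ R leb leb _ ic)) _).
  apply: (@integral0_eq _ _ _ leb) => a _.
  rewrite -(line (a, 0, c)); apply: eq_integral => t _.
  by have -> : t *: Defs.basis j + (a, 0, c) = (a, t, c) by rewrite j1 base1.
refine (etrans (esym (@integral21_prod_meas1 _ _ _ _ R leb leb _ ic)) _).
apply: (@integral0_eq _ _ _ leb) => b _.
rewrite -(line (0, b, c)); apply: eq_integral => t _.
have j0 : j = 0 by clear -j1 j2; apply: val_inj; case: j j1 j2 => [[|[|[|//]]] //].
by have -> : t *: Defs.basis j + (0, b, c) = (t, b, c) by rewrite j0 base0.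
Qed.

Lemma test_cont Om g : test_function Om g -> continuous g.
Proof. by move=> [/(_ [::])[]]. Qed.

Lemma test_partial Om g j : test_function Om g -> test_function Om (partial j g).
Proof.
move=> [hs [K [cK KOm g0]]]; split; last first.
  by exists K; split=> //; exact: partial_zero_off.
by move=> s f; have := hs (rcons s j); rewrite foldr_rcons.
Qed.

Lemma test_l2 Om g : test_function Om g -> l2 leb3 g.
Proof. by move=> tg; have [_ [K [cK _ g0]]] := tg; exact: compact_support_l2 cK (test_cont tg) g0. Qed.

Lemma test_patch Om g : test_function Om g -> g \_ Om = g.
Proof.
move=> [_ [K [_ KOm g0]]]; apply/funext => x; rewrite patchE; case: ifPn => // /negP xOm.
by rewrite g0// => /KOm h; apply: xOm; exact/mem_set.
Qed.

Lemma test_ibp Om (phi theta : pt R -> R) j : test_function Om phi -> test_function Om theta ->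
  \int[leb3]_(x in Om) (phi x * partial j theta x) = - \int[leb3]_(x in Om) (partial j phi x * theta x).
Proof.
move=> tp tt; have [hp [K [cK KOm p0]]] := tp; have [ht [K' [cK' _ t0]]] := tt.
have dp x : derivable phi x (Defs.basis j) by have [_] := hp [::]; apply.
have dt x : derivable theta x (Defs.basis j) by have [_] := ht [::]; apply.
have E (u v : pt R -> R) : u \_ Om = u -> (fun x => u x * v x) \_ Om = (fun x => u x * v x).
  move=> fE; apply/funext => x; rewrite patchE; case: ifPn => // xOm.
  by have := congr1 (fun k => k x) fE; rewrite patchE (negbTE xOm) => <-; rewrite mul0r.
rewrite Rintegral_mkcond [X in _ = - X]Rintegral_mkcond !E ?test_patch//; last exact: test_partial.
have Dm x : partial j (phi * theta) x = phi x * partial j theta x + partial j phi x * theta x.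
  by rewrite /partial deriveM// [X in _ + X]mulrC.
apply/eqP; rewrite -addr_eq0 -RintD; last 2 first.
- by apply: l2M; apply: test_l2; [exact: tp|exact: test_partial tt].
- by apply: l2M; apply: test_l2; [exact: test_partial tp|exact: tt].
apply/eqP; rewrite -(@integral_partial0 j (phi * theta) K) => //.
- by apply: eq_Rintegral => x _; rewrite Dm.
- by move=> x nK; rewrite [LHS](_ : _ = phi x * theta x)// p0// mul0r.
- by move=> x; exact: derivableM.
rewrite (_ : partial j (phi * theta) = fun x => phi x * partial j theta x + partial j phi x * theta x).
  have c1 := test_cont tp; have c2 := test_cont tt.
  have c3 := test_cont (test_partial j tp); have c4 := test_cont (test_partial j tt).
  by move=> x; apply: cvgD; apply: cvgM; [exact: (c1 x)|exact: (c4 x)|exact: (c3 x)|exact: (c2 x)].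
by apply/funext => x; rewrite Dm.
Qed.

End IntegrationByParts.

(** * Bochner integrals *)

Section GoodRepresentatives.
Variables (R : realType) (Om : set (pt R)) (T : R).
Local Notation leb := (@lebesgue_measure R).
Local Notation D := (dom (L2 Om)).
Local Notation p := (ip Om).
Let H := L2_semihilbert Om.

Lemma good_sum (I : Type) (r : seq I) (F : I -> R -> field R) : (forall i, good D p (F i)) ->
  good D p (fun t => \sum_(i <- r) F i t).
Proof.
move=> gF; elim: r => [|i r IH].
  rewrite (_ : (fun t => _) = fun t => \1_(setT : set R) t *: (0 : field R)).
    by apply: good_cst => //; exact: (sh_D0 H).
  by apply/funext => t; rewrite big_nil scaler0.
rewrite (_ : (fun t => _) = fun t => F i t + \sum_(j <- r) F j t); first exact: good_add.
by apply/funext => t; rewrite big_cons.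
Qed.

Lemma simple_good (S : set R) (s : simple (L2 Om)) : measurable S ->
  good D p (fun t => \1_S t *: (simple_fun s t : field R)).
Proof.
move=> mS.
rewrite (_ : (fun t => _) = fun t => \sum_(i < ncells s) \1_(S `&` @cell _ _ s i) t *: (@Defs.cst _ _ s i : field R)).
  apply: good_sum => i; apply: good_cst; last exact: cst_dom.
  by apply: measurableI => //; exact: cell_measurable.
apply/funext => t; rewrite /simple_fun scaler_sumr; apply: eq_bigr => i _.
by rewrite scalerA indicI.
Qed.

(** The curve is set to zero outside []0, T[] and on the null set where convergence, membership or
    [P] fails. What remains is an everywhere limit of Borel simple functions, and [P] now holds
    wherever the curve was kept. *)
Lemma strong_good (u : R -> field R) (P : R -> Prop) : strongly_measurable T (X := L2 Om) u ->
  {ae leb, forall t, t \in `]0, T[ -> P t} ->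
  exists v, [/\ good D p v, {ae leb, forall t, t \in `]0, T[ -> v t = u t} &
    forall t, v t = 0 \/ [/\ t \in `]0, T[, P t & v t = u t]].
Proof.
move=> [[N1 [mN1 N10 hN1]] [s [N2 [mN2 N20 hN2]]]] [N3 [mN3 N30 hN3]].
pose S : set R := `]0, T[%classic `\` (N1 `|` N2 `|` N3).
have mS : measurable S.
  apply: measurableD; first exact: measurable_itv.
  by apply: measurableU; [apply: measurableU; [exact: mN1|exact: mN2]|exact: mN3].
have inS t : S t -> [/\ t \in `]0, T[, D (u t), P t &
    nrm (L2 Om) (simple_fun (s n) t - u t) @[n --> \oo] --> (0 : R)].
  move=> [tT /not_orP[/not_orP[n1 n2] n3]]; have t0 : t \in `]0, T[ by [].
  split=> //; apply: contrapT => h; [apply: n1; apply: hN1|apply: n3; apply: hN3|apply: n2; apply: hN2];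
  by move=> /(_ t0).
exists (fun t => \1_S t *: u t); split.
- apply: (good_lim (s := fun n t => \1_S t *: (simple_fun (s n) t : field R))).
  + by move=> n; exact: simple_good.
  + move=> t; rewrite indicE; have [/set_mem/inS[_ Du _ _]|_] := boolP (t \in S).
      by rewrite scale1r.
    by rewrite scale0r; exact: (sh_D0 H).
  + move=> t; rewrite indicE; have [/set_mem/inS[_ _ _ h]|_] := boolP (t \in S).
      apply: cvg_trans h.
      rewrite (_ : (fun n => _) = (fun n => nrm (L2 Om) (simple_fun (s n) t - u t)))//.
      by apply/funext => n; rewrite !scale1r.
    rewrite (_ : (fun n => _) = fun=> 0); first exact: cvg_cst.
    by apply/funext => n; rewrite !scale0r subrr (hnorm0 H).
- exists (N1 `|` N2 `|` N3); split.
  + by apply: measurableU => //; exact: measurableU.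
  + by apply: null_set_setU => //; [exact: measurableU|exact: null_set_setU].
  + move=> t /= ht; apply: contrapT => /not_orP[/not_orP[n1 n2] n3]; apply: ht => tT.
    by rewrite indicE mem_set ?scale1r//; split => // -[[|]|].
- move=> t; rewrite indicE; have [/set_mem/inS[h1 _ h2 _]|_] := boolP (t \in S).
    by right; rewrite scale1r.
  by left; rewrite scale0r.
Qed.

End GoodRepresentatives.

(** * Evaluating functional-valued Bochner integrals at one vector *)

Section DualPairing.
Variables (R : realType) (X : Defs.space R).
Local Notation leb := (@lebesgue_measure R).
Hypothesis nrm_ge0 : forall v, 0 <= nrm X v.
Variables (psi : vec X) (c : R).
Hypothesis (c0 : 0 < c) (Dpsi : dom X psi) (Dcpsi : dom X (c *: psi)) (ncpsi : nrm X (c *: psi) <= 1).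
Implicit Types l : vec X -> R^o.

(** [c *: psi] lies in the unit ball over which the dual norm is a supremum. A free scale [c] is
    used because the norm of [psi] may vanish. *)
Lemma dual_eval l : dual_dom l -> c * `|l psi| <= dual_nrm l.
Proof.
move=> [ll [C hC]].
have -> : c * `|l psi| = `|l (c *: psi)|.
  have := ll (c - 1) psi psi Dpsi Dpsi; rewrite -[X in _ + X]scale1r -scalerDl subrK => ->.
  by rewrite -[X in _ + X]mul1r -mulrDl subrK normrM gtr0_norm.
apply: ub_le_sup; last by exists (c *: psi).
exists `|C| => _ [v [Dv v1] <-]; apply: le_trans (hC v Dv) _.
apply: (@le_trans _ _ (`|C| * nrm X v)); first by rewrite ler_wpM2r// ler_norm.
by rewrite ler_piMr.
Qed.

Lemma dual_nrm_ge0 l : 0 <= dual_nrm l.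
Proof.
rewrite /dual_nrm; set S := (X in sup X).
have [[[x Sx] ub]|hs] := pselect (has_sup S); last by rewrite sup_out.
by apply: le_trans (ub_le_sup ub Sx); case: Sx => v _ <-.
Qed.

Lemma dual_dom_lin a l m : dual_dom l -> dual_dom m -> dual_dom (a *: l + m : vec X -> R^o).
Proof.
move=> [ll [C hC]] [lm [C' hC']].
have E v : (a *: l + m : vec X -> R^o) v = a * l v + m v by [].
split=> [b u v Du Dv|]; first by rewrite !E ll// lm//; ring.
exists (`|a| * C + C') => u Du; rewrite E; apply: le_trans (ler_normD _ _) _.
by rewrite normrM mulrDl lerD ?hC'// -mulrA ler_wpM2l// hC.
Qed.

Lemma dual_domB l m : dual_dom l -> dual_dom m -> dual_dom (l - m : vec X -> R^o).
Proof. by move=> hl hm; rewrite addrC -scaleN1r; exact: dual_dom_lin. Qed.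

Lemma dual_dom0 : dual_dom (0 : vec X -> R^o).
Proof.
split=> [a u v _ _|]; first by rewrite (_ : (0 : vec X -> R^o) _ = 0)// mulr0 addr0.
by exists 0 => u _; rewrite (_ : (0 : vec X -> R^o) _ = 0)// normr0 mul0r.
Qed.

Lemma dual_dom_sum (I : Type) (r : seq I) (k : I -> R) (F : I -> vec X -> R^o) :
  (forall i, dual_dom (F i)) -> dual_dom (\sum_(i <- r) k i *: F i : vec X -> R^o).
Proof.
move=> hF; elim: r => [|i r IH]; first by rewrite big_nil; exact: dual_dom0.
by rewrite big_cons; exact: dual_dom_lin.
Qed.

Lemma Rint_sum (I : Type) (r : seq I) (F : I -> R -> R) : (forall i, ig leb (F i)) ->
  ig leb (fun x => \sum_(i <- r) F i x) /\
  \int[leb]_x (\sum_(i <- r) F i x) = \sum_(i <- r) \int[leb]_x F i x.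
Proof.
move=> hF; elim: r => [|i r [IH1 IH2]].
  by rewrite (_ : (fun x => _) = fun=> 0) ?big_nil ?Rint0; [split=> //; exact: ig0|apply/funext => x; rewrite big_nil].
rewrite (_ : (fun x => _) = fun x => F i x + \sum_(j <- r) F j x); last first.
  by apply/funext => x; rewrite big_cons.
by split; [exact: igD|rewrite RintD// big_cons IH2].
Qed.

Variable T : R.
Local Notation I := (`]0, T[%classic : set R).

Lemma simple_eval (s : simple (dual X)) :
  ig leb (fun t => \1_I t * (simple_fun s t : vec X -> R^o) psi) /\
  \int[leb]_t (\1_I t * (simple_fun s t : vec X -> R^o) psi) =
    (simple_integral T s : vec X -> R^o) psi.
Proof.
have mI i : measurable (I `&` @cell _ _ s i).
  by apply: measurableI; [exact: measurable_itv|exact: cell_measurable].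
pose F i t : R := (@Defs.cst _ _ s i : vec X -> R^o) psi * \1_(I `&` @cell _ _ s i) t.
have fin i : (leb (I `&` @cell _ _ s i) < +oo)%E.
  apply: (@le_lt_trans _ _ (leb I)).
    by apply: le_measure; rewrite ?inE; [exact: mI|exact: measurable_itv|exact: subIsetl].
  have -> : leb I = (if (0 < T)%R then (T - 0)%:E else 0)%E.
    by have := @lebesgue_measure_itv R `]0, T[; rewrite /= lte_fin EFinB.
  by case: ifP; rewrite ltry.
have ig1 i : ig leb (\1_(I `&` @cell _ _ s i)).
  apply: ge0_ig => //; first by apply: measurable_indic; exact: mI.
  by rewrite integral_indic// ?setIT; [exact: fin|exact: mI].
have igF i : ig leb (F i) by exact: igZ.
have E : (fun t => \1_I t * (simple_fun s t : vec X -> R^o) psi) =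
    fun t => \sum_(i < ncells s) F i t.
  apply/funext => t; rewrite /simple_fun fct_sumE mulr_sumr; apply: eq_bigr => i _.
  rewrite /F indicI /= [LHS](_ : _ = \1_I t * (\1_(@cell _ _ s i) t * (@Defs.cst _ _ s i : vec X -> R^o) psi))//.
  by rewrite [RHS]mulrC mulrA.
have [h1 h2] := Rint_sum (index_enum _) igF.
rewrite E; split=> //; rewrite h2 /simple_integral fct_sumE; apply: eq_bigr => i _.
rewrite RintZ// mulrC; congr (_ * _).
rewrite /Rintegral integral_indic// ?setIT//; exact: mI.
Qed.

(** On simple functions evaluation commutes with integration. By [dual_eval] both approximation
    errors, of the curve and of its integral, dominate the errors after evaluation. [w] supplies a
    Borel version of the evaluated curve. *)
Lemma bochner_pairing (u : R -> vec X -> R^o) (y : vec X -> R^o) (w : R -> R) :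
  bochner_integral T (X := dual X) u y -> measurable_fun setT w ->
  {ae leb, forall t, t \in `]0, T[ -> u t psi = w t} ->
  y psi = \int[leb]_t (\1_I t * w t).
Proof.
move=> [[Du _] Dy [s [_ aT dT]]] mw uw.
pose a n : \bar R := (\int[leb]_(t in I) (nrm (dual X) (simple_fun (s n) t - u t))%:E)%E.
pose sg n t : R := (simple_fun (s n) t : vec X -> R^o) psi.
have mI : measurable_fun setT (\1_I : R -> R) by apply: measurable_indic; exact: measurable_itv.
have igs n : ig leb (fun t => \1_I t * sg n t) by have [] := simple_eval (s n).
have m n : measurable_fun setT (fun t => \1_I t * sg n t - \1_I t * w t).
  by apply: measurable_funB; [exact: ig_meas (igs n)|exact: measurable_funM].
have Ds n t : dual_dom (simple_fun (s n) t : vec X -> R^o).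
  by apply: dual_dom_sum => i; exact: (cst_dom (s := s n)).
have le_a n : (\int[leb]_t (c * `|\1_I t * sg n t - \1_I t * w t|)%:E <= a n)%E.
  rewrite /a [leRHS]integral_mkcond; apply: (@ge0_ae_le_integral_nonmeas _ _ _ leb setT) => [t _|t _|].
  - by rewrite lee_fin; apply: mulr_ge0 => //; exact: ltW.
  - rewrite patchE; case: ifP => // _; rewrite lee_fin; exact: dual_nrm_ge0.
  apply: (ae_imp2 Du uw) => t hD hu _; rewrite patchE indicE.
  have [/set_mem tI|_] := boolP (t \in I); last by rewrite !mul0r subrr normr0 mulr0.
  rewrite lee_fin !mul1r -hu//.
  by have := dual_eval (dual_domB (Ds n t) (hD tI)).
move/fine_cvgP : aT => [[N0 _ finN] a0].
have igw n : (N0 <= n)%N -> ig leb (fun t => \1_I t * sg n t - \1_I t * w t).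
  move=> hn; have : ig leb (fun t => c * `|\1_I t * sg n t - \1_I t * w t|).
    apply: ge0_ig.
    - apply: measurable_funM; first exact: measurable_cst.
      exact: (measurableT_comp (@normr_measurable R setT) (m n)).
    - by move=> t; apply: mulr_ge0 => //; exact: ltW.
    - by apply: le_lt_trans (le_a n) _; have := finN n hn; rewrite fin_numElt => /andP[].
  move=> /(igZ c^-1) h; apply: (@ig_le _ _ _ leb _ _ (m n) h) => t.
  by rewrite mulrA mulVf ?gt_eqF// mul1r.
(* [w] is a simple function minus an error, and the error is integrable from index [N0] on. *)
have iw : ig leb (fun t => \1_I t * w t).
  have := igB (igs N0) (igw N0 (leqnn _)); apply: eq_integrable => // t _.
  by rewrite /= subKr.
have dist n : (N0 <= n)%N ->
    c * `|(simple_integral T (s n) : vec X -> R^o) psi - \int[leb]_t (\1_I t * w t)| <= fine (a n).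
  move=> hn; have [_ <-] := simple_eval (s n).
  rewrite -RintB; [|exact: igs|exact: iw].
  have nE (z : R) : c * `|z| = `|c * z| by rewrite normrM gtr0_norm.
  rewrite nE -RintZ; last exact: igw.
  have an := finN n hn; rewrite -lee_fin fineK//; apply: le_trans (le_a n).
  have igc := igZ c (ig_norm (igw n hn)).
  rewrite -EFin_Rint// lee_fin; apply: le_norm_Rint => //.
    by apply: measurable_funM; [exact: measurable_cst|exact: (m n)].
  by move=> t; rewrite normrM gtr0_norm.
have disty n : c * `|(simple_integral T (s n) : vec X -> R^o) psi - y psi| <=
    nrm (dual X) (simple_integral T (s n) - y).
  have Di : dual_dom (simple_integral T (s n) : vec X -> R^o).
    by apply: dual_dom_sum => i; exact: (cst_dom (s := s n)).
  exact: (dual_eval (dual_domB Di Dy)).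
apply/eqP; rewrite -subr_eq0 -normr_le0; apply/ler_addgt0Pr => e e0; rewrite add0r.
have ce : 0 < c * e / 2 by rewrite divr_gt0// mulr_gt0.
have [N1 h1] := (cvg0P _).1 a0 _ ce; have [N2 h2] := (cvg0P _).1 dT _ ce.
pose n := maxn N0 (maxn N1 N2).
have n0 : (N0 <= n)%N by rewrite leq_maxl.
have n1 : (N1 <= n)%N by rewrite /n !leq_max leqnn orbT.
have n2 : (N2 <= n)%N by rewrite /n !leq_max leqnn !orbT.
rewrite -(ler_pM2l c0).
set S := (simple_integral T (s n) : vec X -> R^o) psi; set W := \int[leb]_t _.
have -> : y psi - W = (S - W) - (S - y psi) by ring.
apply: le_trans (_ : c * (`|S - W| + `|S - y psi|) <= _).
  by rewrite ler_pM2l// ler_normB.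
rewrite mulrDr; have := dist n n0; have := disty n; rewrite -/S -/W => g1 g2.
have := le_lt_trans (ler_norm _) (h1 n n1); have := le_lt_trans (ler_norm _) (h2 n n2).
move=> g3 g4; apply: le_trans (lerD g2 g1) _; apply/ltW.
apply: lt_le_trans (ltrD g4 g3) _; lra.
Qed.

End DualPairing.

(** * The weak curl and the spaces H(curl) and H_0(curl) *)

Section WeakCurl.
Variables (R : realType) (Om : set (pt R)).
Hypothesis oOm : open Om.
Local Notation D := (dom (L2 Om)).
Local Notation p := (ip Om).
Local Notation pd i f := (Defs.partial i f).
Let H := L2_semihilbert Om.
Implicit Types (v w u phi theta : field R).

Lemma test_out (g : pt R -> R) x : test_function Om g -> ~ Om x -> g x = 0.
Proof. by move=> [_ [K [_ KOm g0]]] nx; apply: g0 => /KOm. Qed.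

Lemma test_comp phi i : test_field Om phi -> comp Om phi i = fun x => phi x i 0.
Proof. by move=> tphi; exact: test_patch. Qed.

Lemma test_field_dom phi : test_field Om phi -> D phi.
Proof. by move=> tphi; apply/domP => i; rewrite test_comp//; exact: test_l2. Qed.

Lemma l2B (f g : pt R -> R) : l2 leb3 f -> l2 leb3 g -> l2 leb3 (fun x => f x - g x).
Proof.
move=> lf lg; rewrite (_ : (fun x => _) = fun x => -1 * g x + f x); first exact: l2_lin.
by apply/funext => x; rewrite mulN1r addrC.
Qed.

Lemma classical_curl_comp phi i : test_field Om phi ->
  comp Om (classical_curl phi) i = fun x => pd (i + 1) (fun y => phi y (i + 2%:R) 0) x
          - pd (i + 2%:R) (fun y => phi y (i + 1) 0) x.
Proof.
move=> tphi; apply/funext => x; rewrite compE [X in _ * X]mxE indicE.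
have [_|/negP nx] := boolP (x \in Om); first by rewrite mul1r.
have nOm : ~ Om x by move=> h; apply: nx; exact/mem_set.
rewrite mul0r (test_out (test_partial (i + 1) (tphi (i + 2%:R))) nOm).
by rewrite (test_out (test_partial (i + 2%:R) (tphi (i + 1))) nOm) subr0.
Qed.

Lemma classical_curl_dom phi : test_field Om phi -> D (classical_curl phi).
Proof.
move=> tphi; apply/domP => i; rewrite classical_curl_comp//.
by apply: l2B; apply: (@test_l2 _ Om); exact: test_partial.
Qed.

Lemma test_function0 : test_function Om (fun=> 0).
Proof.
split; last by exists set0; split=> //; exact: compact0.
move=> s f; have -> : f = fun=> 0.
  rewrite /f; elim: s {f} => //= j s ->; apply/funext => x; exact: derive_cst.
by split; [exact: cst_continuous|move=> j x; exact: derivable_cst].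
Qed.

(** Test fields with a single nonzero component reduce this to the scalar fundamental lemma. *)
Lemma weak_curl_uniq v w w' : weak_curl Om v w -> weak_curl Om v w' -> hnorm p (w - w') = 0.
Proof.
move=> [Dw hw] [Dw' hw']; have Dd : D (w - w') by exact: (shDB H).
have ae0 i : {ae leb3, forall x, Om x -> comp Om (w - w') i x = 0}.
  apply: (fundamental_lemma oOm); first by move/domP : Dd.
  move=> psi tpsi; pose theta : field R := fun x => \col_k (if k == i then psi x else 0).
  have tE k : (fun x => theta x k 0) = if k == i then psi else fun=> 0.
    by apply/funext => x; rewrite mxE; case: ifP.
  have tt : test_field Om theta by move=> k; rewrite tE; case: ifP => _ //; exact: test_function0.
  have Dt := test_field_dom tt.
  have : p (w - w') theta = 0 by rewrite (shpBl H)// -hw// -hw'// subrr.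
  rewrite ip_sum// (bigD1 i)//= big1 ?addr0 => [<-|k ki].
    by apply: eq_Rintegral => x _; congr (_ * _); rewrite (test_comp _ tt) mxE eqxx.
  rewrite -[RHS](@Rint0 _ _ _ leb3); apply: eq_Rintegral => x _.
  by rewrite (test_comp _ tt) mxE (negbTE ki) mulr0.
rewrite /hnorm ip_sum// big1 ?sqrtr0// => i _.
rewrite -[RHS](@Rint0 _ _ _ leb3); apply: Rint_ae_eq; apply: (ae_imp (ae0 i)) => x hx.
have [Omx|nOm] := pselect (Om x); first by rewrite hx// mulr0.
by rewrite [X in X * _]compE indicE memNset// mul0r mul0r.
Qed.

Lemma curlP v : dom (Hcurl Om) v -> weak_curl Om v (curl Om v).
Proof. by move=> [_ hw]; rewrite /curl; exact: (xgetPex 0 hw). Qed.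

(** [curl] is an arbitrary choice among weak curls; inside a scalar product with an L^2 field the
    choice does not matter. *)
Lemma curl_p v w u : D v -> weak_curl Om v w -> D u -> p (curl Om v) u = p w u.
Proof.
move=> Dv hw Du; have hc := curlP (conj Dv (ex_intro _ w hw)).
apply/eqP; rewrite -subr_eq0 -(shpBl H)//; [|exact: hc.1|exact: hw.1].
apply/eqP; apply: (hnorm_eq0_p H) => //; last exact: weak_curl_uniq hc hw.
by apply: (shDB H); [exact: hc.1|exact: hw.1].
Qed.

Lemma weak_curl_scale a v w : D v -> weak_curl Om v w -> weak_curl Om (a *: v) (a *: w).
Proof.
move=> Dv [Dw hw]; split; first exact: (shDZ H).
move=> phi tphi; rewrite (shpZl H)//; last exact: classical_curl_dom.
by rewrite (shpZl H)// ?hw//; exact: test_field_dom.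
Qed.

Lemma Hcurl_scale a v : dom (Hcurl Om) v ->
  dom (Hcurl Om) (a *: v) /\ Hcurl_nrm Om (a *: v) = `|a| * Hcurl_nrm Om v.
Proof.
move=> hv; have [Dv _] := hv; have hc := curlP hv; have hs := weak_curl_scale a Dv hc.
have Dav : D (a *: v) by exact: (shDZ H).
have hav : dom (Hcurl Om) (a *: v) by split=> //; exists (a *: curl Om v).
split=> //; have Dc := hc.1; have Dcs := (curlP hav).1.
rewrite /Hcurl_nrm (curl_p Dav hs)// (sh_C H hs.1)// (curl_p Dav hs); last exact: hs.1.
have sq u : D u -> p (a *: u) (a *: u) = a ^+ 2 * p u u.
  by move=> Du; have Da := shDZ H a Du; rewrite (shpZl H)// (shpZr H)//; ring.
by rewrite !sq// -mulrDr sqrtrM ?sqr_ge0// sqrtr_sqr.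
Qed.

Lemma weak_curl_partials phi (G : 'I_3 -> 'I_3 -> pt R -> R) : D phi ->
  (forall i j, weak_partial Om j (fun x => phi x i 0) (G i j)) ->
  weak_curl Om phi (fun x => \col_i (G (i + 2%:R) (i + 1) x - G (i + 1) (i + 2%:R) x)).
Proof.
move=> Dphi hG; set w : field R := fun x => _; have lphi := (domP Om phi).1 Dphi.
pose g i j := G i j \_ Om; have lg i j : l2 leb3 (g i j) by have [/(Lfun2P leb3)] := hG i j.
have gE i j x : g i j x = \1_Om x * G i j x.
  by rewrite /g patchE indicE; case: ifP; rewrite ?mul1r ?mul0r.
have wE i : comp Om w i = fun x => g (i + 2%:R) (i + 1) x - g (i + 1) (i + 2%:R) x.
  by apply/funext => x; rewrite compE [X in _ * X]mxE !gE mulrBr.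
have Dw : D w by apply/domP => i; rewrite wE; exact: l2B.
split=> // theta tt; have Dt := test_field_dom tt; have Dc := classical_curl_dom tt.
pose K i j k := \int[leb3]_x (g i j x * theta x k 0).
have lt k : l2 leb3 (fun x => theta x k 0) by exact: test_l2 (tt k).
have lp j k : l2 leb3 (pd j (fun x => theta x k 0)) by exact: (test_l2 (test_partial j (tt k))).
have wp i j k : \int[leb3]_x (comp Om phi i x * pd j (fun y => theta y k 0) x) = - K i j k.
  have [_ /(_ _ (tt k)) E] := hG i j.
  rewrite Rintegral_mkcond [X in _ = - X]Rintegral_mkcond in E.
  transitivity (\int[leb3]_x ((fun x => phi x i 0 * pd j (fun y => theta y k 0) x) \_ Om) x).
    apply: eq_Rintegral => x _; rewrite compE patchE indicE; case: ifP; rewrite ?mul1r ?mul0r//.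
  rewrite E; congr (- _); apply: eq_Rintegral => x _; rewrite gE patchE indicE.
  by case: ifP; rewrite ?mul1r ?mul0r.
have -> : p phi (classical_curl theta) =
    \sum_i (- K i (i + 1) (i + 2%:R) + K i (i + 2%:R) (i + 1)).
  rewrite ip_sum//; apply: eq_bigr => i _; rewrite classical_curl_comp//.
  rewrite -[K i (i + 2%:R) (i + 1)]opprK -!wp -RintB; [|exact: l2M|exact: l2M].
  by apply: eq_Rintegral => x _; rewrite mulrBr.
have -> : p w theta = \sum_i (K (i + 2%:R) (i + 1) i - K (i + 1) (i + 2%:R) i).
  rewrite ip_sum//; apply: eq_bigr => i _; rewrite wE (test_comp _ tt).
  rewrite -RintB; [|exact: l2M|exact: l2M].
  by apply: eq_Rintegral => x _; rewrite mulrBl.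
(* Indices live in Z/3: cyclic shifts by 2 and by 1 match the two halves of the antisymmetric
   sum. *)
rewrite !big_split/= addrC; congr (_ + _).
  rewrite (reindex_inj (addIr (2%:R : 'I_3))) /=; apply: eq_bigr => i _.
  by congr (K _ _ _); case: i => [[|[|[|//]]] h]; exact: val_inj.
rewrite (reindex_inj (addIr (1 : 'I_3))) /=; apply: eq_bigr => i _.
by congr (- K _ _ _); case: i => [[|[|[|//]]] h]; exact: val_inj.
Qed.

(** Ensures that the [curl] occurring in the tangential trace is a true weak curl and not the
    default value. *)
Lemma in_H1_Hcurl phi : in_H1 Om phi -> dom (Hcurl Om) phi.
Proof.
move=> [Dphi hphi]; split=> //.
have /choice[G hG] : forall ij : 'I_3 * 'I_3, exists g, weak_partial Om ij.2 (fun x => phi x ij.1 0) g.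
  by move=> [i j]; exact: hphi.
eexists; apply: (@weak_curl_partials phi (fun i j => G (i, j)) Dphi) => i j.
exact: (hG (i, j)).
Qed.

Lemma test_weak_curl phi : test_field Om phi -> weak_curl Om phi (classical_curl phi).
Proof.
move=> tphi.
apply: (@weak_curl_partials phi (fun i j => pd j (fun x => phi x i 0)) (test_field_dom tphi)) => i j.
split; last by move=> psi tpsi; exact: test_ibp.
by apply/(Lfun2P leb3); rewrite test_patch; [exact: (test_l2 (test_partial j (tphi i)))|exact: test_partial].
Qed.

Lemma H0curl_scale a v : dom (H0curl Om) v -> dom (H0curl Om) (a *: v).
Proof.
move=> [hv tv]; have [ha _] := Hcurl_scale a hv; split; first exact: ha.
move=> phi hphi.
have hc := curlP hv; have [Dv _] := hv.
have hp := in_H1_Hcurl hphi; have Dcp := (curlP hp).1.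
have E : p v (curl Om phi) - p (curl Om v) phi = 0 := tv phi hphi.
rewrite /tangential_trace.
have Dphi : D phi := hphi.1; have Dc : D (curl Om v) := hc.1; have Dav : D (a *: v) := ha.1.
rewrite (curl_p Dav (weak_curl_scale a Dv hc) Dphi) (shpZl H a Dv Dcp) (shpZl H a Dc Dphi).
by rewrite -mulrBr E mulr0.
Qed.

Lemma unit_scale (r : R) : 0 <= r -> exists c, 0 < c /\ `|c| * r <= 1.
Proof.
move=> r0; have r1 : 0 < 1 + r by rewrite ltr_pwDl.
exists (1 + r)^-1; rewrite invr_gt0; split=> //.
by rewrite gtr0_norm ?invr_gt0// mulrC ler_pdivrMr// mul1r lerDr.
Qed.

End WeakCurl.

(** * The Maxwell system *)

Section MaxwellBalance.
Variables (R : realType) (Om : set (pt R)) (T : R).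
Hypothesis oOm : open Om.
Local Notation leb := (@lebesgue_measure R).
Local Notation D := (dom (L2 Om)).
Local Notation p := (ip Om).
Local Notation hnorm := (hnorm p).
Local Notation I := (`]0, T[%classic : set R).
Let H := L2_semihilbert Om.

Lemma supported_out (eta : R -> R) : smooth_expr eta -> supported T eta ->
  forall t, t \notin `]0, T[ -> eta t = 0 /\ derive1 eta t = 0.
Proof.
move=> seta [a [b [a0 bT hab]]] t; rewrite in_itv/= negb_and -!leNgt => ht.
have tab : t < a \/ b < t by case/orP: ht => h; [left; lra|right; lra].
split; first exact: hab.
have hd x := (smooth_expr_derive1 seta).2 x.
exact: (der_zero_outside hd hab).
Qed.

Lemma time_test_smooth (eta : R -> R) : smooth_expr eta -> supported T eta -> time_test T eta.
Proof.
move=> seta [a [b [a0 bT hab]]]; split; first by move=> n t; exact: smooth_expr_derivable.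
exists `[a, b]%classic; split; first exact: segment_compact.
  by move=> t /=; rewrite !in_itv/= => /andP[h1 h2]; apply/andP; split; lra.
move=> t ht; apply: hab; have [h|h] := ltP t a; first by left.
by right; rewrite ltNge; apply/negP => h'; apply: ht; rewrite /= in_itv/= h h'.
Qed.

Lemma cut_supported (eta q : R -> R) : (forall t, t \notin `]0, T[ -> eta t = 0) ->
  (fun t => \1_I t * (eta t * q t)) = fun t => eta t * q t.
Proof.
move=> h; apply/funext => t; rewrite indicE.
have [_|tI] := boolP (t \in I); first by rewrite mul1r.
by rewrite h ?mul0r ?mulr0//; apply/negP => h'; move/negP: tI; apply; exact/mem_set.
Qed.

(** Turns the derivative in the dual space into a scalar weak derivative in time, for one fixed
    vector [psi]: both Bochner integrals, [y] and [- y], are evaluated at [psi]. *)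
Lemma weak_derivative_pairing (X : Defs.space R) (u dd : R -> vec X -> R^o) (psi : vec X)
    (eta q r : R -> R) :
  (forall v, 0 <= nrm X v) -> dom X psi ->
  (exists c, [/\ 0 < c, dom X (c *: psi) & nrm X (c *: psi) <= 1]) ->
  weak_derivative T (X := dual X) u dd -> smooth_expr eta -> supported T eta ->
  measurable_fun setT q -> measurable_fun setT r ->
  {ae leb, forall t, t \in `]0, T[ -> u t psi = q t} ->
  {ae leb, forall t, t \in `]0, T[ -> dd t psi = r t} ->
  \int[leb]_t (derive1 eta t * q t) = - \int[leb]_t (eta t * r t).
Proof.
move=> n0 Dpsi [c [c0 Dc nc]] [_ _ hw] seta supp mq mr hu hd.
have [y [h1 h2]] := hw eta (time_test_smooth seta supp).
have out := supported_out seta supp.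
have me : measurable_fun setT eta.
  by apply: continuous_measurable_fun; exact: smooth_expr_cont.
have me' : measurable_fun setT (derive1 eta).
  by apply: continuous_measurable_fun; apply: smooth_expr_cont; have [] := smooth_expr_derive1 seta.
have E1 : y psi = \int[leb]_t (derive1 eta t * q t).
  rewrite -(@cut_supported (derive1 eta)); last by move=> t /out[].
  apply: (bochner_pairing n0 c0 Dpsi Dc nc h1); first exact: measurable_funM.
  by apply: (ae_imp hu) => t ht tI; rewrite -ht.
have E2 : (- y : vec X -> R^o) psi = \int[leb]_t (eta t * r t).
  rewrite -(@cut_supported eta); last by move=> t /out[].
  apply: (bochner_pairing n0 c0 Dpsi Dc nc h2); first exact: measurable_funM.
  by apply: (ae_imp hd) => t ht tI; rewrite -ht.
by rewrite -E1 -E2 (_ : (- y : vec X -> R^o) psi = - y psi)// opprK.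
Qed.

Lemma Hcurl_unit psi : dom (Hcurl Om) psi ->
  exists c, [/\ 0 < c, dom (Hcurl Om) (c *: psi) & nrm (Hcurl Om) (c *: psi) <= 1].
Proof.
move=> h; have [c [c0 hc]] := unit_scale (sqrtr_ge0 _ : 0 <= Hcurl_nrm Om psi).
have [h1 h2] := Hcurl_scale oOm c h.
by exists c; split=> //; rewrite /= h2.
Qed.

Lemma H0curl_unit psi : dom (H0curl Om) psi ->
  exists c, [/\ 0 < c, dom (H0curl Om) (c *: psi) & nrm (H0curl Om) (c *: psi) <= 1].
Proof.
move=> h; have [c [c0 hc]] := unit_scale (sqrtr_ge0 _ : 0 <= Hcurl_nrm Om psi).
have [_ h2] := Hcurl_scale oOm c h.1.
have h3 : dom (H0curl Om) (c *: psi) := H0curl_scale oOm c h.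
exists c; split; [exact: c0|exact: h3|].
by change (Hcurl_nrm Om (c *: psi) <= 1); rewrite h2.
Qed.

Lemma L1_bounded (v : R -> field R) K : good D p v -> (forall t, hnorm (v t) <= K) ->
  (forall t, t \notin `]0, T[ -> v t = 0) -> L1 D p v.
Proof.
move=> gv vK v0; split=> //.
apply: (@ig_le _ _ _ leb (fun t => K * \1_(`[0, T]%classic : set R) t)).
- exact: good_hnorm H _ gv.
- by apply: igZ; exact: itv_indic_ig.
move=> t; rewrite ger0_norm ?hnorm_ge0// indicE.
have [_|/negP tI] := boolP (t \in _); first by rewrite mulr1.
rewrite mulr0 v0 ?(hnorm0 H)//; apply/negP; rewrite in_itv/= => /andP[h1 h2].
by apply: tI; apply/mem_set; rewrite /= in_itv/= !ltW.
Qed.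

Lemma L2t_good (f : R -> field R) : L2t T (X := L2 Om) f -> exists v, L1 D p v /\
  {ae leb, forall t, t \in `]0, T[ -> v t = f t}.
Proof.
move=> [sf ff]; have [|v [gv vf v0]] := @strong_good R Om T f (fun=> True) sf; first exact: aeW.
exists v; split=> //; split=> //; have mv := good_hnorm H gv.
have i2 : ig leb (fun t => hnorm (v t) ^+ 2).
  apply: ge0_ig; [exact: measurable_funX|by move=> t; exact: sqr_ge0|].
  apply: le_lt_trans ff; rewrite [leRHS]integral_mkcond.
  apply: (@ge0_ae_le_integral_nonmeas _ _ _ leb setT) => [t _|t _|].
  - by rewrite lee_fin sqr_ge0.
  - by rewrite patchE; case: ifP => // _; rewrite lee_fin sqr_ge0.
  apply: (ae_imp vf) => t ht _; rewrite patchE; case: ifPn => [/set_mem tI|tI].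
    by rewrite ht.
  case: (v0 t) => [->|[tI' _ _]]; first by rewrite (hnorm0 H) expr0n.
  by case/negP: tI; exact/mem_set.
(* On a bounded interval x <= 1 + x^2 turns square integrability into integrability. *)
apply: (@ig_le _ _ _ leb (fun t => \1_(`[0, T]%classic : set R) t + hnorm (v t) ^+ 2)) => //.
  by apply: igD => //; exact: itv_indic_ig.
move=> t; rewrite ger0_norm ?hnorm_ge0//.
case: (v0 t) => [->|[tI _ _]].
  by rewrite (hnorm0 H) addr_ge0// sqr_ge0.
rewrite indicE mem_set; last by move: tI; rewrite /= !in_itv/= => /andP[h1 h2]; rewrite !ltW.
have := sqr_ge0 (hnorm (v t) - 1); have := sqr_ge0 (hnorm (v t)); rewrite /=; nra.
Qed.

Lemma Linftyt_good (u : R -> field R) : Linftyt T (X := L2 Om) u -> exists v K,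
  [/\ L1 D p v, forall t, hnorm (v t) <= K & {ae leb, forall t, t \in `]0, T[ -> v t = u t}].
Proof.
move=> [su [M hM]]; have [v [gv vu v0]] := strong_good su hM.
have vK t : hnorm (v t) <= `|M|.
  case: (v0 t) => [->|[_ h ->]]; first by rewrite (hnorm0 H).
  exact: le_trans h (ler_norm _).
exists v, `|M|; split=> //; apply: (L1_bounded gv vK) => t tI.
by case: (v0 t) => [//|[tI' _ _]]; rewrite tI' in tI.
Qed.

Variables (eps mui sigma : tensor R) (Ce Cm Cs : R).
Hypothesis he : bounded_symmetric D p (tensor_app eps) Ce.
Hypothesis hm : bounded_symmetric D p (tensor_app mui) Cm.
Hypothesis hs : bounded_symmetric D p (tensor_app sigma) Cs.
Variables (E B f Ev Bv fv : R -> field R).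
Hypotheses (LE : L1 D p Ev) (LB : L1 D p Bv) (Lf : L1 D p fv).
Hypothesis aeE : {ae leb, forall t, t \in `]0, T[ -> Ev t = E t}.
Hypothesis aeB : {ae leb, forall t, t \in `]0, T[ -> Bv t = B t}.
Hypothesis aef : {ae leb, forall t, t \in `]0, T[ -> fv t = f t}.
Variables dE dB : R -> field R -> R^o.
Hypothesis wdE : weak_derivative T (X := dual (H0curl Om)) (fun t => embed Om (tensor_app eps (E t))) dE.
Hypothesis wdB : weak_derivative T (X := dual (Hcurl Om)) (fun t => embed Om (B t)) dB.
Hypothesis ampere : {ae leb, forall t, t \in `]0, T[ -> forall psi, dom (H0curl Om) psi ->
  dE t psi + p (tensor_app sigma (E t)) psi - p (tensor_app mui (B t)) (curl Om psi) = p (f t) psi}.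
Hypothesis faraday : {ae leb, forall t, t \in `]0, T[ -> forall phi, dom (Hcurl Om) phi ->
  dB t phi + p (E t) (curl Om phi) = 0}.

Let DE t : D (Ev t) := good_D H LE.1 t.
Let DB t : D (Bv t) := good_D H LB.1 t.
Let Df t : D (fv t) := good_D H Lf.1 t.

Definition source t := fv t - tensor_app sigma (Ev t).

Lemma source_L1 : L1 D p source.
Proof.
have gs : good D p (fun t => tensor_app sigma (Ev t)).
  exact: (good_op H (bs_D hs) (bs_linear hs) (bs_bound hs) LE.1).
have gF : good D p source by exact: (good_sub H Lf.1 gs).
split=> //; apply: (@ig_le _ _ _ leb (fun t => hnorm (fv t) + Cs * hnorm (Ev t))).
- exact: good_hnorm H _ gF.
- by apply: igD; [exact: Lf.2|apply: igZ; exact: LE.2].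
move=> t; rewrite ger0_norm ?hnorm_ge0//.
apply: le_trans (hnormB H (Df t) (bs_D hs (DE t))) _.
by rewrite lerD2l; exact: (bs_bound hs).
Qed.

(** Faraday's law is used first with all of H(curl) as test space, to see that the time average [U]
    is itself admissible in Ampere's law; only then is Ampere's law tested with it. *)
Lemma maxwell_balance eta : smooth_expr eta -> supported T eta ->
  balance D p (tensor_app eps) (tensor_app mui) Ev Bv source eta.
Proof.
move=> seta supp U U' W W' G [DU hU] [DU' hU'] [DW hW] [DW' hW'] [DG hG].
have [C [C0 bC bC' _ _]] : exists C, [/\ 0 <= C, forall x, `|eta x| <= C,
    forall x, `|derive1 eta x| <= C, True & True].
  have [a [b [_ _ hab]]] := supp.
  by have [C [c1 c2 c3 _ _]] := smooth_expr_kernel_bounds seta hab; exists C.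
have me : measurable_fun setT eta.
  by apply: continuous_measurable_fun; exact: smooth_expr_cont.
(* Faraday's law integrated against [eta], with the field [phi] frozen. *)
have far phi : dom (Hcurl Om) phi -> p W' phi = - p U (curl Om phi).
  move=> hphi; have Dc := (curlP hphi).1.
  have := @weak_derivative_pairing (Hcurl Om) _ _ phi eta (fun t => p (Bv t) phi)
    (fun t => - p (Ev t) (curl Om phi)) (fun v => sqrtr_ge0 _) hphi (Hcurl_unit hphi) wdB seta supp.
  move=> /(_ (good_meas H LB.1 hphi.1)); have mE := good_meas H LE.1 Dc.
  have mNE : measurable_fun setT (fun t => - p (Ev t) (curl Om phi)) by exact: measurableT_comp.
  move=> /(_ mNE) h; have Dphi : D phi := hphi.1; rewrite (hU _ Dc) (hW' _ Dphi).
  rewrite (@eq_Rintegral _ _ _ leb setT (fun t => -1 * (derive1 eta t * p (Bv t) phi))); last first.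
    by move=> t _; rewrite mulN1r mulNr.
  rewrite RintZ; last by apply: (L1_ig H LB _ bC' hphi.1); apply: continuous_measurable_fun;
    apply: smooth_expr_cont; have [] := smooth_expr_derive1 seta.
  rewrite h.
  - rewrite mulN1r opprK -[RHS]mulN1r -RintZ; last exact: (L1_ig H LE me bC Dc).
    by apply: eq_Rintegral => t _; rewrite mulrN mulN1r.
  - by apply: (ae_imp aeB) => t ht tI; rewrite ht.
  - apply: (ae_imp2 faraday aeE) => t hf hE tI; rewrite hE//.
    by have /eqP := hf tI phi hphi; rewrite addr_eq0 => /eqP.
(* Test fields in [far] identify the weak curl of [U]. *)
have wU : weak_curl Om U (- W').
  split; first exact: (shDN H).
  move=> phi tphi; have hphi : dom (Hcurl Om) phi.
    by split; [exact: test_field_dom|exists (classical_curl phi); exact: test_weak_curl].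
  have Dphi := test_field_dom tphi.
  rewrite (shpNl H)// far// opprK (sh_C H)//; last exact: classical_curl_dom.
  rewrite -(curl_p oOm Dphi (test_weak_curl tphi))// (sh_C H)//.
  exact: (curlP hphi).1.
have hUc : dom (Hcurl Om) U by split=> //; exists (- W').
have Dcu := (curlP hUc).1.
(* For a field of class H^1, [far] is Green's formula without boundary term: the tangential trace of
   [U] vanishes. *)
have hU0 : dom (H0curl Om) U.
  split=> // phi hphi; have hp := in_H1_Hcurl hphi; rewrite /tangential_trace.
  have Dphi : D phi := hp.1.
  by rewrite (curl_p oOm DU wU Dphi) (shpNl H DW' Dphi) far// opprK subrr.
(* Ampere's law with [U] as a fixed test field: [q] is the quantity differentiated in time, and [r]
   is its derivative as the equation gives it. *)
pose q t := p (tensor_app eps (Ev t)) U.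
pose r t := p (source t) U + p (tensor_app mui (Bv t)) (curl Om U).
have DeU := bs_D he DU; have Dmc := bs_D hm Dcu.
have LF := source_L1.
have qE t : q t = p (Ev t) (tensor_app eps U) by rewrite /q (bs_sym he).
have rE t : r t = p (source t) U + p (Bv t) (tensor_app mui (curl Om U)).
  by rewrite /r (bs_sym hm).
have mq : measurable_fun setT q.
  rewrite (_ : q = fun t => p (Ev t) (tensor_app eps U)); last exact: funext.
  exact: (good_meas H LE.1 DeU).
have mr : measurable_fun setT r.
  rewrite (_ : r = fun t => p (source t) U + p (Bv t) (tensor_app mui (curl Om U))); last exact: funext.
  by apply: measurable_funD; [exact: (good_meas H LF.1 DU)|exact: (good_meas H LB.1 Dmc)].
have := @weak_derivative_pairing (H0curl Om) _ _ U eta q r (fun v => sqrtr_ge0 _) hU0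
  (H0curl_unit hU0) wdE seta supp mq mr.
have h1 : {ae leb, forall t, t \in `]0, T[ -> embed Om (tensor_app eps (E t)) U = q t}.
  by apply: (ae_imp aeE) => t ht tI; rewrite /q ht.
have h2 : {ae leb, forall t, t \in `]0, T[ -> dE t U = r t}.
  have aeEB : {ae leb, forall t, t \in `]0, T[ -> [/\ Ev t = E t, Bv t = B t & fv t = f t]}.
    have aeBf : {ae leb, forall t, t \in `]0, T[ -> Bv t = B t /\ fv t = f t}.
      by apply: (ae_imp2 aeB aef) => t b1 b2 tI; split; [exact: b1|exact: b2].
    by apply: (ae_imp2 aeE aeBf) => t e1 e2 tI; have [b1 b2] := e2 tI; split=> //; exact: e1.
  apply: (ae_imp2 ampere aeEB) => t ha hb tI; have [e1 e2 e3] := hb tI.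
  have := ha tI U hU0; rewrite /r /source -e1 -e2 -e3 => h.
  by rewrite (shpBl H)//; [move: h; lra|exact: (bs_D hs)].
move=> /(_ h1 h2) key.
have E1 : p (tensor_app eps U') U = - \int[leb]_t (derive1 eta t * q t).
  have me' : measurable_fun setT (derive1 eta).
    by apply: continuous_measurable_fun; apply: smooth_expr_cont; have [] := smooth_expr_derive1 seta.
  rewrite (bs_sym he)// (hU' _ DeU) -[RHS]mulN1r.
  rewrite (_ : \int[leb]_t (derive1 eta t * q t) =
      \int[leb]_t (derive1 eta t * p (Ev t) (tensor_app eps U))); last first.
    by apply: eq_Rintegral => t _; rewrite qE.
  rewrite -RintZ; last exact: (L1_ig H LE me' bC' DeU).
  by apply: eq_Rintegral => t _; rewrite mulN1r mulNr.
rewrite E1 key opprK.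
have -> : \int[leb]_t (eta t * r t) = p G U + p W (tensor_app mui (curl Om U)).
  rewrite hG// hW// -RintD; [|exact: (L1_ig H LF me bC DU)|exact: (L1_ig H LB me bC Dmc)].
  by apply: eq_Rintegral => t _; rewrite rE mulrDr.
have DmW := bs_D hm DW; have DmW' := bs_D hm DW'.
(* By symmetry the magnetic term is (mu^-1 W, curl U) = - (mu^-1 W', W), which cancels the second
   term of the balance. *)
rewrite -(bs_sym hm DW Dcu) (sh_C H DmW Dcu) (curl_p oOm DU wU DmW) (shpNl H DW' DmW).
by rewrite -(bs_sym hm)// subrK.
Qed.

End MaxwellBalance.

(** * Return to the original data and continuity in time *)

Section Conclusions.
Variables (R : realType) (Om : set (pt R)) (T : R).
Local Notation leb := (@lebesgue_measure R).
Local Notation D := (dom (L2 Om)).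
Local Notation p := (ip Om).
Local Notation hnorm := (hnorm p).
Let H := L2_semihilbert Om.

Lemma within_small (g : R -> R) t : (forall s, 0 <= g s) ->
  (forall e, 0 < e -> exists d, 0 < d /\ forall s, 0 <= s <= T -> `|s - t| < d -> g s < e) ->
  g s @[s --> within `[0, T]%classic (nbhs t)] --> (0 : R).
Proof.
move=> g0 h; apply/cvgrPdist_lt => e e0; have [d [d0 hd]] := h e e0.
rewrite near_withinE; apply: filterS (nbhsx_ballx t d d0) => s st.
rewrite /= in_itv/= sub0r normrN ger0_norm// => sT; apply: hd => //.
by move: st; rewrite /ball/= distrC.
Qed.

Variables (E' : R -> field R).
Hypothesis DE' : forall t, D (E' t).
Hypothesis cE' : forall t e, 0 <= t <= T -> 0 < e -> exists d, 0 < d /\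
  forall s, 0 <= s <= T -> `|s - t| < d -> hnorm (E' s - E' t) < e.

Lemma continuous_in_timeP : continuous_in_time T (X := L2 Om) E'.
Proof.
split=> [t _|t]; first exact: DE'.
rewrite in_itv/= => tT; apply: (within_small (g := fun s => hnorm (E' s - E' t))).
  by move=> s; exact: hnorm_ge0.
by move=> e e0; exact: cE'.
Qed.

Lemma continuous_norm : {within `[0, T], continuous (fun t => L2nrm Om (E' t))}.
Proof.
apply/subspace_continuousP => t; rewrite /= in_itv/= => tT.
apply/cvgrPdist_lt => e e0; have [d [d0 hd]] := cE' tT e0.
rewrite near_withinE; apply: filterS (nbhsx_ballx t d d0) => s st.
rewrite /= in_itv/= => sT; rewrite distrC; apply: le_lt_trans (hnorm_dist H (DE' s) (DE' t)) _.
by apply: hd => //; move: st; rewrite /ball/= distrC.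
Qed.

Lemma ae_neq (a : R) : {ae leb, forall t, t != a}.
Proof.
exists [set a]; split; [exact: measurable_set1|exact: lebesgue_measure_set1|].
by move=> t /= /negP; rewrite negbK => /eqP.
Qed.

Variables (f E : R -> field R) (fv Ev : R -> field R) (sigma : tensor R) (Cs K : R).
Hypothesis hs : bounded_symmetric D p (tensor_app sigma) Cs.
Hypotheses (LE : L1 D p Ev) (Lf : L1 D p fv) (bE : forall t, hnorm (Ev t) <= K).
Hypothesis aef : {ae leb, forall t, t \in `]0, T[ -> fv t = f t}.
Hypothesis aeE : {ae leb, forall t, 0 <= t <= T -> hnorm (E' t - Ev t) = 0}.

(** Almost everywhere [fv] is [f] and [E'] differs from [Ev] by norm zero, so the scalar products
    agree. This moves the identity from Borel representatives to the given source and the continuous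
    field. *)
Lemma source_integral t : 0 <= t <= T ->
  \int[leb]_(s in `[0, t]) p (source sigma Ev fv s) (Ev s) =
  \int[leb]_(s in `[0, t]) p (f s) (E' s) -
  \int[leb]_(s in `[0, t]) p (tensor_app sigma (E' s)) (E' s).
Proof.
move=> /andP[t0 tT]; have DE s : D (Ev s) := good_D H LE.1 s.
have Df s : D (fv s) := good_D H Lf.1 s; have DS s : D (tensor_app sigma (Ev s)) := bs_D hs (DE s).
have gs : good D p (fun s => tensor_app sigma (Ev s)).
  exact: (good_op H (bs_D hs) (bs_linear hs) (bs_bound hs) LE.1).
have K0 : 0 <= K := le_trans (hnorm_ge0 _ _) (bE 0).
have igf : ig leb (fun s => p (fv s) (Ev s)).
  apply: (@ig_le _ _ _ leb (fun s => K * hnorm (fv s))).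
  - exact: good_meas2 H _ _ Lf.1 LE.1.
  - by apply: igZ; exact: Lf.2.
  move=> s; apply: le_trans (sh_CS H (Df s) (DE s)) _.
  by rewrite mulrC; apply: ler_wpM2r; [exact: hnorm_ge0|exact: bE].
have igs : ig leb (fun s => p (tensor_app sigma (Ev s)) (Ev s)).
  apply: (@ig_le _ _ _ leb (fun s => `|Cs| * K * hnorm (Ev s))).
  - exact: good_meas2 H _ _ gs LE.1.
  - by apply: igZ; exact: LE.2.
  move=> s; apply: le_trans (bs_form H hs (DE s) (DE s)) _.
  by apply: ler_wpM2r; [exact: hnorm_ge0|rewrite ler_wpM2l].
have cut q : ig leb q -> ig leb (fun s => \1_(`[0, t]%classic : set R) s * q s).
  move=> iq; apply: (@ig_le _ _ _ leb (fun s => `|q s|)).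
  - by apply: measurable_funM; [exact: itv_indic_meas|exact: ig_meas iq].
  - exact: ig_norm.
  by move=> s; rewrite normrM indicE; case: (_ \in _); rewrite ?normr1 ?normr0 ?mul1r ?mul0r.
have b1 : {ae leb, forall s, (s \in `]0, T[ -> fv s = f s) /\
    (0 <= s <= T -> hnorm (E' s - Ev s) = 0)} by apply: (ae_imp2 aef aeE) => s h1 h2; split.
(* The data are identified on the open interval only; the closed interval adds two points of measure
   zero. *)
have b2 : {ae leb, forall s : R, s != 0 /\ s != T}.
  by apply: (ae_imp2 (ae_neq 0) (ae_neq T)) => s h1 h2; split.
have both : {ae leb, forall s : R, 0 <= s <= t -> fv s = f s /\ hnorm (E' s - Ev s) = 0}.
  apply: (ae_imp2 b1 b2) => s [h1 h2] [n0 nT] /andP[s0 st].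
  split; [apply: h1|apply: h2; apply/andP; split=> //; exact: le_trans st tT].
  by rewrite in_itv/= !lt_neqAle s0 (le_trans st tT) nT eq_sym n0.
have -> : \int[leb]_(s in `[0, t]) p (f s) (E' s) = \int[leb]_(s in `[0, t]) p (fv s) (Ev s).
  apply: ae_eq_Rintegral_nonmeas; apply: (ae_imp both) => s hb; rewrite /= in_itv/= => sI.
  have [<- e0] := hb sI; apply/eqP; rewrite -subr_eq0 -(shpBr H)//.
  by rewrite (sh_C H)//; [rewrite (hnorm_eq0_p H _ _ e0)//; exact: (shDB H)|exact: (shDB H)].
have -> : \int[leb]_(s in `[0, t]) p (tensor_app sigma (E' s)) (E' s) =
    \int[leb]_(s in `[0, t]) p (tensor_app sigma (Ev s)) (Ev s).
  apply: ae_eq_Rintegral_nonmeas; apply: (ae_imp both) => s hb; rewrite /= in_itv/= => sI.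
  have [_ e0] := hb sI; have DSE := bs_D hs (DE' s).
  have Dd : D (E' s - Ev s) by exact: (shDB H).
  have z c : D c -> p (E' s) c = p (Ev s) c.
    move=> Dc; apply/eqP; rewrite -subr_eq0 -(shpBl H)//; apply/eqP.
    exact: (hnorm_eq0_p H Dd Dc e0).
  by rewrite (sh_C H DSE (DE' s)) (z _ DSE) -(bs_sym hs)// (sh_C H (DS s) (DE' s)) (z _ (DS s)) (sh_C H).
rewrite !Rint_itvE -RintB; [|exact: cut|exact: cut].
by apply: eq_Rintegral => s _; rewrite /source (shpBl H)// mulrBr.
Qed.

End Conclusions.

Theorem corollary1 (R : realType) (Om : set (pt R)) (T : R)
  (eps mu sigma : tensor R) (eps0 mu0 : R)
  (f : R -> field R) (E0 B0 : field R) (E B : R -> field R)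
  (hOm : bounded_lipschitz_domain Om) (hT : 0 < T)
  (heps : in_Linfty Om eps) (hmu : in_Linfty Om mu) (hsigma : in_Linfty Om sigma)
  (heps_sym : symmetric_tensor Om eps) (hmu_sym : symmetric_tensor Om mu)
  (hsigma_sym : symmetric_tensor Om sigma)
  (heps0 : 0 < eps0) (hmu0 : 0 < mu0)
  (heps_coercive : coercive Om eps0 eps) (hmu_coercive : coercive Om mu0 mu)
  (hsigma_psd : {ae leb3, forall x, Om x -> psd (sigma x)})
  (hf : L2t T (X := L2 Om) f)
  (hE0 : dom (L2 Om) E0) (hB0 : dom (Hdiv0 Om) B0)
  (hsol : weak_solution Om T eps mu sigma f E0 B0 E B) :
  exists E' B' : R -> field R,
    [/\ continuous_representative T (X := L2 Om) E E',
        continuous_representative T (X := L2 Om) B B',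
        (forall t : R, 0 <= t <= T ->
           energy Om eps mu E' B' t
           + \int[leb1]_(s in `[0, t]) ip Om (tensor_app sigma (E' s)) (E' s)
           = energy Om eps mu E' B' 0
           + \int[leb1]_(s in `[0, t]) ip Om (f s) (E' s)),
        {within `[0, T], continuous (fun t => L2nrm Om (E' t))} &
        {within `[0, T], continuous (fun t => L2nrm Om (B' t))}].
Proof.
have [oOm _ _ _ _] := hOm; have mOm := open_measurable3 oOm; have H := L2_semihilbert Om.
have [Ce [Ce0 bde]] := in_Linfty_bounded heps; have [Cm [Cm0 bdm]] := in_Linfty_bounded hmu.
have [Cs [Cs0 bds]] := in_Linfty_bounded hsigma.
have bdi := inv_tensor_bounded mOm hmu0 bdm hmu_coercive.
have mui0 : 0 <= mu0^-1 by rewrite invr_ge0 ltW.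
have symi := inv_tensor_symmetric hmu_sym.
have ci := inv_tensor_coercive hmu0 bdm hmu_coercive.
set a := mu0 / _ in ci.
have a0 : 0 < a by rewrite divr_gt0// ltr_wpDl// sqr_ge0.
have he := tensor_bounded_symmetric Ce0 bde heps_sym.
have hi := tensor_bounded_symmetric mui0 bdi symi.
have hs := tensor_bounded_symmetric Cs0 bds hsigma_sym.
have [Ev [KE [LE bE aeE]]] := Linftyt_good (ws_E_Linfty hsol).
have [Bv [KB [LB bB aeB]]] := Linftyt_good (ws_B_Linfty hsol).
have [fv [Lf aef]] := L2t_good hf.
have [dE [wdE amp]] := ws_ampere hsol; have [dB [wdB far]] := ws_faraday hsol.
have bal := maxwell_balance oOm he hi hs LE LB Lf aeE aeB aef wdE wdB amp far.
have LF := source_L1 hs LE Lf.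
(* The abstract argument takes one bound and one coercivity constant for both fields; [a] is the
   coercivity constant of the inverse of [mu]. *)
pose K := Num.max KE KB; pose c := Num.min eps0 a.
have c0 : 0 < c by rewrite lt_min heps0 a0.
have cE u : dom (L2 Om) u -> c * ip Om u u <= ip Om (tensor_app eps u) u.
  move=> Du; apply: le_trans (tensor_coercive bde heps_coercive Du).
  by apply: ler_wpM2r; [exact: (sh_ge0 H)|rewrite ge_min lexx].
have cB u : dom (L2 Om) u -> c * ip Om u u <= ip Om (tensor_app (inv_tensor mu) u) u.
  move=> Du; apply: le_trans (tensor_coercive bdi ci Du).
  by apply: ler_wpM2r; [exact: (sh_ge0 H)|rewrite ge_min lexx orbT].
have bEK t : hnorm (ip Om) (Ev t) <= K by rewrite le_max bE.
have bBK t : hnorm (ip Om) (Bv t) <= K by rewrite le_max bB orbT.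
have [E' [B' [DEB cEB aeEB en]]] :=
  global_solution H he hi c0 cE cB LE LB LF bEK bBK hT bal.
have DE' t : dom (L2 Om) (E' t) := (DEB t).1.
have DB' t : dom (L2 Om) (B' t) := (DEB t).2.
have ctE t e : 0 <= t <= T -> 0 < e -> exists d, 0 < d /\
    forall s, 0 <= s <= T -> `|s - t| < d -> hnorm (ip Om) (E' s - E' t) < e.
  by move=> tT e0; have [d [d0 h]] := cEB t e tT e0; exists d; split=> // s s1 s2; have [] := h s s1 s2.
have ctB t e : 0 <= t <= T -> 0 < e -> exists d, 0 < d /\
    forall s, 0 <= s <= T -> `|s - t| < d -> hnorm (ip Om) (B' s - B' t) < e.
  by move=> tT e0; have [d [d0 h]] := cEB t e tT e0; exists d; split=> // s s1 s2; have [] := h s s1 s2.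
have tT (t : R) : t \in `]0, T[ -> 0 <= t <= T.
  by rewrite in_itv/= => /andP[h1 h2]; rewrite !ltW.
exists E', B'; split.
- split; first exact: continuous_in_timeP DE' ctE.
  by apply: (ae_imp2 aeEB aeE) => t h1 h2 tI; rewrite -h2//; have [] := h1 (tT _ tI).
- split; first exact: continuous_in_timeP DB' ctB.
  by apply: (ae_imp2 aeEB aeB) => t h1 h2 tI; rewrite -h2//; have [] := h1 (tT _ tI).
- move=> t ht; have aeE' : {ae leb1, forall t, 0 <= t <= T -> hnorm (ip Om) (E' t - Ev t) = 0}.
    by apply: (ae_imp aeEB) => s h1 sT; have [] := h1 sT.
  have /andP[t0 tle] := ht; have := en 0 t (lexx 0) t0 tle.
  rewrite (source_integral DE' hs LE Lf bE aef aeE' ht).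
  have eE s : energy Om eps mu E' B' s =
      energy_form (ip Om) (tensor_app eps) (tensor_app (inv_tensor mu)) (E' s) (B' s).
    rewrite /energy /energy_form (L2nrm_sqrt_tensor (ltW heps0) bde heps_coercive heps_sym (DE' s)).
    by rewrite (L2nrm_sqrt_tensor (ltW a0) bdi ci symi (DB' s)).
  have arith (x y z w : R) : x - y = z - w -> x + w = y + z by lra.
  by rewrite !eE; exact: arith.
- exact: continuous_norm DE' ctE.
- exact: continuous_norm DB' ctB.
Qed.
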